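(* Let $T>0$, $d\ge 1$, and let $\sigma:\mathbb{R}\to\mathbb{R}$ be an activation function such that: (i) $\sigma$ is globally Lipschitz; (ii) the set $\mathcal{F}=\bigcup_{m\in\mathbb{Z}_+}\{x\mapsto\sum_{i=1}^m\alpha_i\sigma(w_i^Tx+\theta_i) : \alpha_i\in\mathbb{R},\, w_i\in\mathbb{R}^d,\,\theta_i\in\mathbb{R}\}$ is dense in $C(\mathbb{R}^d;\mathbb{R})$ for uniform convergence on compact sets, i.e. for every $f\in C(\mathbb{R}^d;\mathbb{R})$, every compact $\Omega\subset\mathbb{R}^d$ and every $\delta>0$ there is $g\in\mathcal{F}$ with $\sup_{x\in\Omega}|f(x)-g(x)|<\delta$. Let $V:[0,T]\times\mathbb{R}^d\to\mathbb{R}^d$, $(t,x)\mapsto V_t(x)$, be such that $t\mapsto V_t(x)$ is measurable for every $x\in\mathbb{R}^d$, there is $K>0$ with $|V_t(x)-V_t(y)|\le K|x-y|$ for all $x,y\in\mathbb{R}^d$ and $t\in[0,T]$, and $V$ is uniformly bounded on $[0,T]\times\mathbb{R}^d$. Let $\mu_0\in\mathcal{P}_2(\mathbb{R}^d)$ have compact support, and let $\mu$ be the weak solution of the continuity equation $\frac{\partial\mu}{\partial t}+\nabla\cdot(V_t(x)\mu)=0$, $\mu(0)=\mu_0$. Then for every $\epsilon>0$ there exist piecewise constant functions $A^\epsilon:[0,T]\to\mathbb{R}^{d\times d}$, $W^\epsilon:[0,T]\to\mathbb{R}^{d\times d}$ and $\theta^\epsilon:[0,T]\to\mathbb{R}^d$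 such that the corresponding weak solution $\mu^\epsilon$ of $$\frac{\partial\mu^\epsilon}{\partial t}+\nabla\cdot\Big(\big(A^\epsilon(t)\Sigma(W^\epsilon(t)x+\theta^\epsilon(t))\big)\mu^\epsilon\Big)=0,\qquad \mu^\epsilon(0)=\mu_0,$$ satisfies $$\sup_{t\in[0,T]}W_2(\mu^\epsilon_t,\mu_t)\le\epsilon.$$
   Context: $\Sigma:\mathbb{R}^d\to\mathbb{R}^d$ is defined by applying $\sigma$ componentwise: $\Sigma(x)=[\sigma(x_1),\dots,\sigma(x_d)]^T$. $\mathbb{Z}_+$ denotes the positive integers. $\mathcal{P}_2(\mathbb{R}^d)$ is the set of Borel probability measures on $\mathbb{R}^d$ with finite second moment, and $W_2$ is the $2$-Wasserstein distance, $W_2(\mu,\nu)=\min_{\gamma\in\Gamma(\mu,\nu)}\big(\int|x-y|^2d\gamma(x,y)\big)^{1/2}$, where $\Gamma(\mu,\nu)$ is the set of probability measures on $\mathbb{R}^d\times\mathbb{R}^d$ with marginals $\mu$ and $\nu$. $C([0,T],\mathcal{P}_2(\mathbb{R}^d))$ is the set of curves $t\mapsto\mu_t$ continuous with respect to $W_2$. For a vector field $V:[0,T]\times\mathbb{R}^d\to\mathbb{R}^d$, a curve $\mu\in C([0,T],\mathcal{P}_2(\mathbb{R}^d))$ is a weak solution of $\frac{\partial\mu}{\partial t}+\nabla\cdot(V_t(x)\mu)=0$, $\mu(0)=\mu_0$, if $$\int_0^T\int_{\mathbb{R}^d}\Big(\frac{\partial\phi(t,x)}{\partial t}+\nabla\phi(t,x)\cdot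 V_t(x)\Big)d\mu_t(x)\,dt=-\int_{\mathbb{R}^d}\phi(0,x)\,d\mu_0(x)$$ for all compactly supported real-valued $\phi\in C^\infty([0,T)\times\mathbb{R}^d)$. A function on $[0,T]$ is piecewise constant if $[0,T]$ can be partitioned into finitely many intervals on each of which it is constant. *)

(* Defs.v *)
From HB Require Import structures.
From mathcomp Require Import all_boot all_order all_algebra.
From mathcomp Require Import all_classical all_reals all_analysis.

Set Implicit Arguments.
Unset Strict Implicit.
Unset Printing Implicit Defensive.

Import Order.TTheory GRing.Theory Num.Theory.
Import numFieldNormedType.Exports.

Local Open Scope classical_set_scope.
Local Open Scope ring_scope.

(* R^d is 'cV[R]_d.  The library's norm on matrices is the sup norm; it induces
   the usual topology, but the Euclidean norm has to be introduced. *)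
Definition dot (R : realType) (d : nat) (u v : 'cV[R]_d) : R := (u^T *m v) 0 0.

Definition enorm (R : realType) (d : nat) (x : 'cV[R]_d) : R :=
  Num.sqrt (dot x x).

Notation borelRd R d := (g_sigma_algebraType (@open 'cV[R]_d)).

(* The real line with the sigma-algebra of Lebesgue measurable sets, on which
   completed_lebesgue_measure lives.  The canonical sigma-algebra of R is only
   the Borel one. *)
Notation lebesgueR R := (caratheodory_type
  (mu_ext (wlength (idfun : Real.sort R -> Real.sort R)))).

(* R^d x R^d carries the product sigma-algebra, i.e. its Borel sigma-algebra. *)
Definition couplings (R : realType) (d : nat)
    (mu nu : probability (borelRd R d) R) :
    set (probability (borelRd R d * borelRd R d)%type R) :=
  [set gamma | forall A : set (borelRd R d), measurable A ->
     gamma (fst @^-1` A) = mu A /\ gamma (snd @^-1` A) = nu A].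

(* The infimum is attained, so that it is the minimum of the usual definition. *)
Definition W2 (R : realType) (d : nat) (mu nu : probability (borelRd R d) R) :
    \bar R :=
  ereal_inf [set ((\int[gamma]_p (enorm (p.1 - p.2 : 'cV[R]_d) ^+ 2)%:E)
                    `^ 2^-1)%E | gamma in couplings mu nu].

Definition finite_second_moment (R : realType) (d : nat)
    (mu : probability (borelRd R d) R) : Prop :=
  (\int[mu]_x (enorm (x : 'cV[R]_d) ^+ 2)%:E < +oo)%E.

Definition msupport (R : realType) (d : nat)
    (mu : probability (borelRd R d) R) : set 'cV[R]_d :=
  [set x | forall U : set 'cV[R]_d, open U -> U x -> (0 < mu U)%E].

(* C([0,T], P_2(R^d)); curves are total functions of time, and their values
   outside [0,T] are irrelevant. *)
Definition W2_continuous_curve (R : realType) (d : nat) (T : R)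
    (mu : R -> probability (borelRd R d) R) : Prop :=
  (forall t : R, t \in `[0, T] -> finite_second_moment (mu t)) /\
  (forall t : R, t \in `[0, T] ->
     W2 (mu s) (mu t) @[s --> within `[0, T] (nbhs t)] --> 0%E).

(* C^oo: all iterated directional derivatives exist and are continuous. *)
Definition smooth (R : realType) (E : normedModType R) (f : E -> R) : Prop :=
  forall vs : seq E, let g := foldr (fun v (h : E -> R) => 'D_v h) f vs in
    continuous g /\ (forall x v, derivable g x v).

(* Compactly supported elements of C^oo([0,T) x R^d), given by an extension to a
   smooth function on R x R^d.  The support is that of the restriction to
   [0,T) x R^d: it may meet {t = 0} but not {t = T}. *)
Definition test_function (R : realType) (d : nat) (T : R)
    (phi : R * 'cV[R]_d -> R) : Prop :=
  let S := closure [set p | 0 <= p.1 < T /\ phi p != 0] in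
  [/\ smooth phi, compact S & S `<=` [set p | 0 <= p.1 < T]].

Definition dt (R : realType) (d : nat) (phi : R * 'cV[R]_d -> R)
    (t : R) (x : 'cV[R]_d) : R :=
  'D_((1, 0) : R * 'cV[R]_d) phi (t, x).

Definition grad (R : realType) (d : nat) (phi : R * 'cV[R]_d -> R)
    (t : R) (x : 'cV[R]_d) : 'cV[R]_d :=
  \col_i 'D_((0, delta_mx i 0) : R * 'cV[R]_d) phi (t, x).

Definition weak_solution (R : realType) (d : nat) (T : R)
    (V : R -> 'cV[R]_d -> 'cV[R]_d) (mu0 : probability (borelRd R d) R)
    (mu : R -> probability (borelRd R d) R) : Prop :=
  W2_continuous_curve T mu /\
  forall phi : R * 'cV[R]_d -> R, test_function T phi ->
    (\int[completed_lebesgue_measure]_(t in (`[0%R, T] : set (lebesgueR R)))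
       \int[mu t]_x (dt phi t x + dot (grad phi t x) (V t x))%:E
     = - \int[mu0]_x (phi (0%R, x))%:E)%E.

Definition piecewise_constant (R : realType) (U : Type) (T : R) (f : R -> U) :
    Prop :=
  exists (n : nat) (I : 'I_n -> interval R),
    [/\ \bigcup_i [set` I i] = [set` `[0, T]],
        trivIset setT (fun i => [set` I i])
      & forall i s t, s \in I i -> t \in I i -> f s = f t].

(* The class F of finite sums of neurons. *)
Definition networks (R : realType) (d : nat) (sigma : R -> R) :
    set ('cV[R]_d -> R) :=
  \bigcup_(m in [set m : nat | (0 < m)%N])
    [set g | exists (alpha : 'I_m -> R) (w : 'I_m -> 'cV[R]_d)
                    (theta : 'I_m -> R),
       g = fun x => \sum_(i < m) alpha i * sigma (dot (w i) x + theta i)].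

Definition universal (R : realType) (d : nat) (sigma : R -> R) : Prop :=
  forall (f : 'cV[R]_d -> R) (Omega : set 'cV[R]_d) (delta : R),
    continuous f -> compact Omega -> 0 < delta ->
    exists2 g, networks sigma g
      & (ereal_sup [set `|f x - g x|%:E | x in Omega] < delta%:E)%E.

(* Main.v *)
Require Import Defs.
From HB Require Import structures.
From mathcomp Require Import all_boot all_order all_algebra.
From mathcomp Require Import all_classical all_reals all_analysis.
From mathcomp Require Import measurable_realfun.
From mathcomp Require Import ring lra zify.

Set Implicit Arguments.
Unset Strict Implicit.
Unset Printing Implicit Defensive.

Import Order.TTheory GRing.Theory Num.Theory.
Import numFieldNormedType.Exports.

Local Open Scope classical_set_scope.
Local Open Scope ring_scope.

(** A partition of unity at a fine scale replaces the field V by finitely many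
    time integrals of V at nodes, with derivatives that stay bounded in terms of
    the Lipschitz constant K.  Composing a test function backwards with the
    resulting smooth Euler maps x + sum_k psi_k(x) int V(node_k) and telescoping
    shows that every weak solution is the push-forward of mu0 by the flow of V.
    Conversely such push-forwards are weak solutions.

    For the approximation, average V over coarse time cells and approximate each
    average by a sum of N neurons on a ball that no trajectory from the support of
    mu0 leaves.  Divide each coarse
    cell into many rounds, and each round into N equal pieces; on the l-th
    piece use the l-th neuron with weight N.  The integral over a round is then that
    of the whole sum, so by Groenwall the flow Y of this piecewise constant field is
    close to the flow X of V, and the coupling (Y_t, X_t)#mu0 bounds W2. *)

(** * Smooth functions on normed spaces *)

(** [V] is only Lipschitz in space, so composing a test function with an exact Euler step, or with
    the flow, does not give a test function. Smoothing over a partition of unity repairs this, but N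
    composed steps must keep first derivatives bounded uniformly in N and in the partition. Hence
    the constant [C] of [partition_of_unity] depends on the dimension alone: a step of length h
    multiplies first derivatives by at most 1 + C K h, and all the steps together by at most exp(C K
    T). Second derivatives do blow up as the partition is refined, but they enter only through
    remainders of size h^2 per step; so the partition is fixed first and h tends to 0 afterwards.
    Expanding the field at the nodes also separates time from space: this yields the measurability
    in time of the integrals involved and takes the place of Fubini. In the neural approximation the
    order of choices matters again: the Lipschitz constants of the cell fields are fixed before the
    number of rounds, which alone makes the errors of cycling small. *)

Section smooth_functions.
Context {R : realType}.
Implicit Types E W : normedModType R.

Lemma derivable_line E (g : E -> R) (x v : E) (t : R) :
  derivable g (x + t *: v) v ->
  is_derive t (1 : R) (fun s : R => g (x + s *: v)) ('D_v g (x + t *: v)).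
Proof.
move=> dg.
have e : (fun h : R => h^-1 *: (((fun s : R => g (x + s *: v)) \o shift t) (h *: (1 : R))
            - g (x + t *: v))) =
         (fun h : R => h^-1 *: ((g \o shift (x + t *: v)) (h *: v) - g (x + t *: v))).
  apply/funext => h /=; congr (_ *: (g _ - _)).
  by rewrite scaler1 scalerDl addrCA addrA.
by split; rewrite ?/derivable ?/derive /= e.
Qed.

Lemma MVT_line E (g : E -> R) (x v : E) :
  (forall y w, derivable g y w) ->
  exists2 t : R, 0 <= t <= 1 & g (x + v) - g x = 'D_v g (x + t *: v).
Proof.
move=> dg.
have d (t : R) : is_derive t (1 : R) (fun s : R => g (x + s *: v)) ('D_v g (x + t *: v)).
  by apply: derivable_line.
have c : {within `[0, 1], continuous (fun s : R => g (x + s *: v))}.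
  apply: continuous_subspaceT => t; apply: differentiable_continuous.
  by apply/derivable1_diffP; apply: ex_derive.
have [t t01] := MVT_segment ler01 (fun t _ => d t) c.
rewrite scale1r scale0r addr0 subr0 mulr1 => eq.
by exists t => //; move: t01; rewrite in_itv.
Qed.

Lemma is_derive_lineP E (g : E -> R) (x v : E) (D : R) :
  is_derive (0 : R) (1 : R) (fun s : R => g (x + s *: v)) D <-> is_derive x v g D.
Proof.
have e : (fun h : R => h^-1 *: (((fun s : R => g (x + s *: v)) \o shift 0) (h *: (1 : R))
            - g (x + (0:R) *: v))) =
         (fun h : R => h^-1 *: ((g \o shift x) (h *: v) - g x)).
  apply/funext => h /=; rewrite scale0r addr0; congr (_ *: (g _ - g _)).
  by rewrite [_%:A]mulr1 addrC.
  by rewrite addr0.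
by split; move=> [d1 d2]; split; move: d1 d2;
  rewrite /derivable /derive /= ?e => d1 d2; rewrite ?e.
Qed.

(** On the line through [x] the scaling becomes the one-variable chain rule with [h * a], which
    covers [a = 0] without a division. *)
Lemma derive_scale E (g : E -> R) (x v : E) (a : R) :
  derivable g x v -> 'D_(a *: v) g x = a * 'D_v g x.
Proof.
move=> dg.
have d1 : is_derive (0 * a) (1 : R) (fun s : R => g (x + s *: v)) ('D_v g x).
  by rewrite mul0r; apply/is_derive_lineP; exact/derivableP.
have d2 : is_derive (0:R) (1:R) (fun h : R => h * a) a.
  have := @is_deriveM _ _ id (cst a) (0 : R) (1 : R) 1 0 _ _.
  rewrite scaler0 add0r [_%:A]mulr1 /=; apply.
have d3 := @is_derive1_comp _ (fun s : R => g (x + s *: v)) (fun h : R => h * a) _ _ _ d1 d2.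
have d4 : is_derive x (a *: v) g ('D_v g x * a).
  apply/is_derive_lineP; rewrite (_ : (fun s => _) = (fun s : R => g (x + s *: v)) \o (fun h : R => h * a)) //.
  by apply/funext => h /=; rewrite scalerA.
by rewrite derive_val mulrC.
Qed.

(** Directional derivatives need not be additive in the direction. Continuity of ['D_v g] at [x]
    makes them so: the increment along [h *: v] starts at the moving point [h *: w + x], and the
    mean value theorem turns it into a value of ['D_v g] at a point tending to [x]. *)
Lemma derive_add E (g : E -> R) (x v w : E) :
  (forall y u, derivable g y u) -> {for x, continuous ('D_v g)} ->
  'D_(v + w) g x = 'D_v g x + 'D_w g x.
Proof.
move=> dg cg; apply/cvg_lim => //.
have -> : (fun h : R => h^-1 *: ((g \o shift x) (h *: (v + w)) - g x)) =
  (fun h => h^-1 * (g (h *: w + x + h *: v) - g (h *: w + x)) + h^-1 *: ((g \o shift x) (h *: w) - g x)).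
  apply/funext => h /=; rewrite -mulrDr; congr (_ * _).
  by rewrite addrA subrK scalerDr; congr (g _ - _); rewrite addrC addrAC addrA [RHS]addrC addrA addrAC.
apply: cvgD; last exact: dg.
apply/cvgrPdist_lt => e e0.
move/cvgrPdist_lt : cg => /(_ e e0) /nbhs_ballP [r /= r0 cg].
near=> h.
have h0 : h != 0 by near: h; exact: nbhs_dnbhs_neq.
have [t /andP[t0 t1] ->] := MVT_line (h *: w + x) (h *: v) dg.
rewrite derive_scale // mulrA mulVf // mul1r.
apply: cg; rewrite -ball_normE /ball_ /= distrC addrAC -addrA.
rewrite [X in `|X|](_ : _ = h *: (w + t *: v)); last first.
  by rewrite addrA addrK scalerDr !scalerA mulrC.
rewrite normrZ.
have hv : `|h| * (`|w| + `|v| + 1) < r.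
  rewrite -ltr_pdivlMr; last by rewrite ltr_wpDl ?addr_ge0.
  near: h; apply: dnbhs0_lt; rewrite divr_gt0 //.
apply: le_lt_trans hv; rewrite ler_wpM2l // (le_trans (ler_normD _ _)) //.
rewrite normrZ ger0_norm // -addrA lerD2l (@le_trans _ _ `|v|) ?lerDl //.
by rewrite ler_piMl.
Unshelve. all: by end_near.
Qed.

Lemma derive_sum_dir E (g : E -> R) (x : E) n (v : 'I_n -> E) (a : 'I_n -> R) :
  (forall y u, derivable g y u) -> (forall u, continuous ('D_u g)) ->
  'D_(\sum_i a i *: v i) g x = \sum_i a i * 'D_(v i) g x.
Proof.
move=> dg cg; elim/big_ind2 : _ => [|u1 d1 u2 d2 <- <-|i _]; first exact: derive0.
  by apply: derive_add => //; exact: cg.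
by rewrite derive_scale.
Qed.

Lemma smooth_cont E (g : E -> R) : smooth g -> continuous g.
Proof. by move=> /(_ [::]) []. Qed.

Lemma smooth_derivable E (g : E -> R) x v : smooth g -> derivable g x v.
Proof. by move=> /(_ [::]) []. Qed.

Lemma smooth_derive E (g : E -> R) v : smooth g -> smooth ('D_v g).
Proof. by move=> sg vs; have := sg (rcons vs v); rewrite foldr_rcons. Qed.

Lemma smooth_derive_sum E (g : E -> R) (x : E) n (v : 'I_n -> E) (a : 'I_n -> R) :
  smooth g -> 'D_(\sum_i a i *: v i) g x = \sum_i a i * 'D_(v i) g x.
Proof.
move=> sg; apply: derive_sum_dir => [y u|u]; first exact: smooth_derivable.
exact/smooth_cont/smooth_derive.
Qed.

Lemma cvg_sumf (T : Type) (F : set_system T) (FF : Filter F) W n (f : 'I_n -> T -> W)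
  (l : 'I_n -> W) : (forall i, f i x @[x --> F] --> l i) ->
  (\sum_i f i x) @[x --> F] --> \sum_i l i.
Proof.
move=> H; elim: (index_enum _) => [|i s IH].
  by under eq_fun do rewrite big_nil; rewrite big_nil; exact: cvg_cst.
by under eq_fun do rewrite big_cons; rewrite big_cons; exact: cvgD.
Qed.

Lemma derivable_cvg_line E (g : E -> R) (x v : E) :
  derivable g x v -> g (h *: v + x) @[h --> (0 : R)^'] --> g x.
Proof.
move=> /derivableP /is_derive_lineP [/derivable1_diffP/differentiable_continuous + _].
rewrite /prop_for /continuous_at scale0r addr0 => H.
under eq_fun do rewrite addrC.
apply: cvg_trans H; apply: cvg_app; exact: cvg_within.
Qed.

(** Derivatives of products and composites are sums of products, so an induction on the list of
    directions needs a class that is closed under one derivative. This is such a class, and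
    [smooth_genP] shows that all its members are smooth. *)
Inductive smooth_gen E : (E -> R) -> Prop :=
| gen_smooth f of smooth f : smooth_gen f
| gen_add f g of smooth_gen f & smooth_gen g : smooth_gen (f + g)
| gen_mul f g of smooth_gen f & smooth_gen g : smooth_gen (f * g)
| gen_inv f of smooth_gen f & (forall x, f x != 0) : smooth_gen (fun x => (f x)^-1)
| gen_comp n W (w : 'I_n -> W) (u : 'I_n -> E -> R) (g : W -> R) of
    (forall i, smooth_gen (u i)) & smooth g :
    smooth_gen (fun x => g (\sum_i u i x *: w i)).

(** A chain rule without Frechet derivatives: on the segment from [F x] to [F (h *: v + x)] the mean
    value theorem for [g] and the linearity of its derivative in the direction give a finite sum,
    and the intermediate point [G h (t h)] tends to [F x]. *)
Lemma is_derive_comp_sum E n W (w : 'I_n -> W) (u : 'I_n -> E -> R) (g : W -> R) x v :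
  (forall i, derivable (u i) x v) -> smooth g ->
  is_derive x v (fun x => g (\sum_i u i x *: w i))
    (\sum_i 'D_v (u i) x * 'D_(w i) g (\sum_i u i x *: w i)).
Proof.
move=> du sg; set F := fun x => \sum_i u i x *: w i.
suff H : (fun h : R => h^-1 *: (((fun x => g (F x)) \o shift x) (h *: v) - g (F x)))
   @ 0^' --> \sum_i 'D_v (u i) x * 'D_(w i) g (F x).
  by split; [apply/cvg_ex; eexists; exact: H|exact/cvg_lim].
have FD h : F (h *: v + x) = F x + \sum_i (u i (h *: v + x) - u i x) *: w i.
  by rewrite /F -big_split /=; apply: eq_bigr => i _; rewrite scalerBl addrC subrK.
have cF : (F (h *: v + x)) @[h --> (0:R)^'] --> F x.
  rewrite /F; apply: cvg_sumf => i; apply: cvgZl.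
  exact: derivable_cvg_line.
pose G h t := F x + t *: \sum_i (u i (h *: v + x) - u i x) *: w i.
(* The condition [h != 0] sits under the existential so that [t] can be chosen as a function of
   every [h]. *)
have HG h : exists t, h != 0 -> 0 <= t <= 1 /\ h^-1 *: (((fun x => g (F x)) \o shift x) (h *: v) - g (F x)) =
   \sum_i h^-1 *: (u i (h *: v + x) - u i x) * 'D_(w i) g (G h t).
  have [t t01] := MVT_line (F x) (F (h *: v + x) - F x) (fun y z => @smooth_derivable _ g y z sg).
  rewrite subrKC => e; exists t => h0; split => //=; rewrite e FD addrAC subrr add0r.
  rewrite smooth_derive_sum // [LHS]scaler_sumr; apply: eq_bigr => i _.
  by rewrite scalerAl.
pose t h := projT1 (cid (HG h)).
have Ht h : h != 0 -> 0 <= t h <= 1 /\ h^-1 *: (((fun x => g (F x)) \o shift x) (h *: v) - g (F x)) =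
   \sum_i h^-1 *: (u i (h *: v + x) - u i x) * 'D_(w i) g (G h (t h)) := projT2 (cid (HG h)).
have cG : G h (t h) @[h --> 0^'] --> F x.
  apply/cvgrPdist_lt => e e0.
  move/cvgrPdist_lt : cF => /(_ e e0) cF.
  near=> h; have h0 : h != 0 by near: h; exact: nbhs_dnbhs_neq.
  have [/andP[t0 t1] _] := Ht h h0.
  rewrite /G opprD addrA subrr add0r normrN normrZ (ger0_norm t0).
  rewrite (_ : \sum_i _ = F (h *: v + x) - F x); last by rewrite FD addrAC subrr add0r.
  apply: le_lt_trans (_ : `|F x - F (h *: v + x)| < e); last by near: h.
  by rewrite distrC ler_piMl.
have C : (\sum_i h^-1 *: (u i (h *: v + x) - u i x) * 'D_(w i) g (G h (t h))) @[h --> 0^'] -->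
   \sum_i 'D_v (u i) x * 'D_(w i) g (F x).
  apply: cvg_sumf => i; apply: cvgM; first exact: du.
  have cD := smooth_cont (smooth_derive (w i) sg).
  exact: (continuous_cvg _ (cD (F x)) cG).
apply: cvg_trans C; apply: near_eq_cvg; near=> h; apply/esym.
by have [] := Ht h _ ; first by near: h; exact: nbhs_dnbhs_neq.
Unshelve. all: by end_near.
Qed.

Lemma smooth_cst E (c : R) : smooth (cst c : E -> R).
Proof.
move=> vs /=; suff [c' ->] : exists c', foldr (fun v (h : E -> R) => 'D_v h) (cst c) vs = cst c'.
  by split=> [|x v]; [exact: cst_continuous|exact: derivable_cst].
elim: vs => [|v vs [c' /= ->]]; first by exists c.
by exists 0; apply/funext => x; rewrite derive_cst.
Qed.

Lemma gen_sum E n (f : 'I_n -> E -> R) :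
  (forall i, smooth_gen (f i)) -> smooth_gen (fun x => \sum_i f i x).
Proof.
elim: n f => [|n IH] f gf.
  by under eq_fun do rewrite big_ord0; exact/gen_smooth/smooth_cst.
under eq_fun do rewrite big_ord_recl.
exact: gen_add (gf ord0) (IH _ (fun i => gf (lift ord0 i))).
Qed.

Lemma smooth_lin E (l : E -> R) : continuous l ->
  (forall v, exists c, forall x, is_derive x v l c) -> smooth l.
Proof.
move=> cl dl; suff H v : smooth ('D_v l).
  move=> vs /=; case: (lastP vs) => [|vs' v] /=.
    by split=> // x v; have [c /(_ x) d] := dl v; exact: ex_derive.
  by rewrite foldr_rcons; exact: H.
have [c d] := dl v; rewrite (_ : 'D_v l = cst c); first exact: smooth_cst.
by apply/funext => x; rewrite derive_val.
Qed.

Lemma smooth_genP E (f : E -> R) : smooth_gen f -> smooth f.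
Proof.
(* Once every derivative of a member is again a member, the directions can be peeled off one by one
   from the inner end of the list. *)
suff H : forall f : E -> R, smooth_gen f ->
    [/\ continuous f, (forall x v, derivable f x v) & forall v, smooth_gen ('D_v f)].
  move=> sf vs; move: f sf; elim/last_ind : vs => [|vs v IH] f sf /=.
    by have [] := H f sf.
  by rewrite foldr_rcons; apply: IH; have [] := H f sf.
move=> {}f; elim => {f}.
- move=> f sf; split=> [|x v|v]; [exact: smooth_cont|exact: smooth_derivable|].
  exact/gen_smooth/smooth_derive.
- move=> f g gf [cf df Df] gg [cg dg Dg]; split => [x|x v|v].
  + by apply: cvgD; [exact: cf|exact: cg].
  + exact: derivableD.
  + rewrite (_ : 'D_v _ = 'D_v f + 'D_v g); first exact: gen_add.
    by apply/funext => x; rewrite deriveD.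
- move=> f g gf [cf df Df] gg [cg dg Dg]; split => [x|x v|v].
  + by apply: cvgM; [exact: cf|exact: cg].
  + exact: derivableM.
  + rewrite (_ : 'D_v _ = f * 'D_v g + g * 'D_v f).
      by apply: gen_add; apply: gen_mul.
    by apply/funext => x; rewrite deriveM.
- move=> f gf [cf df Df] f0; split => [x|x v|v].
  + by apply: cvgV; [exact: f0|exact: cf].
  + exact: derivableV.
  + rewrite (_ : 'D_v _ = cst (-1) * ((fun x => (f x)^-1) * (fun x => (f x)^-1)) * 'D_v f).
      do 2 ?apply: gen_mul => //; [exact/gen_smooth/smooth_cst|].
      by apply: gen_mul; apply: gen_inv.
    apply/funext => x; rewrite deriveV //.
    by rewrite expr2 invfM /GRing.mul/= /GRing.scale /= !mulNr mul1r.
- move=> n W w u g gu IH sg.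
  have dc x v := is_derive_comp_sum w (fun i => (let: And3 _ d _ := IH i in d) x v) sg.
  split => [x|x v|v].
  + apply: (continuous_comp (f := fun x => \sum_i u i x *: w i)); last exact: smooth_cont.
    by apply: cvg_sumf => i; apply: cvgZl; have [+ _ _] := IH i; exact.
  + exact: ex_derive.
  + rewrite (_ : 'D_v _ = fun x => \sum_i 'D_v (u i) x * 'D_(w i) g (\sum_i u i x *: w i)).
      apply: gen_sum => i; apply: gen_mul; first by have [] := IH i.
      exact: (gen_comp w gu (smooth_derive (w i) sg)).
    by apply/funext => x; have := dc x v => d; rewrite derive_val.
Qed.

Lemma smooth_add E (f g : E -> R) : smooth f -> smooth g -> smooth (fun x => f x + g x).
Proof. by move=> sf sg; apply/smooth_genP/gen_add; exact: gen_smooth. Qed.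

Lemma smooth_mul E (f g : E -> R) : smooth f -> smooth g -> smooth (fun x => f x * g x).
Proof. by move=> sf sg; apply/smooth_genP/gen_mul; exact: gen_smooth. Qed.

Lemma smooth_inv E (f : E -> R) :
  smooth f -> (forall x, f x != 0) -> smooth (fun x => (f x)^-1).
Proof. by move=> sf f0; apply/smooth_genP/gen_inv => //; exact: gen_smooth. Qed.

Lemma smooth_sum E n (f : 'I_n -> E -> R) :
  (forall i, smooth (f i)) -> smooth (fun x => \sum_i f i x).
Proof. by move=> sf; apply/smooth_genP/gen_sum => i; exact: gen_smooth. Qed.

Lemma smooth_comp E n W (w : 'I_n -> W) (u : 'I_n -> E -> R) (g : W -> R) :
  (forall i, smooth (u i)) -> smooth g -> smooth (fun x => g (\sum_i u i x *: w i)).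
Proof. by move=> su sg; apply/smooth_genP/gen_comp => // i; exact: gen_smooth. Qed.

Lemma smooth_comp1 E (g : R -> R) (u : E -> R) :
  smooth u -> smooth (g : R -> R) -> smooth (fun x => g (u x)).
Proof.
move=> su sg; have := @smooth_comp E 1 R (fun _ => 1) (fun _ => u) g (fun _ => su) sg.
rewrite (_ : (fun x => g (\sum_i _)) = fun x => g (u x)) //.
by apply/funext => x; rewrite big_ord1 [_%:A]mulr1.
Qed.

Lemma smooth_prod E n (f : 'I_n -> E -> R) :
  (forall i, smooth (f i)) -> smooth (fun x => \prod_i f i x).
Proof.
elim: n f => [|n IH] f sf.
  rewrite (_ : (fun x => _) = cst 1); first exact: smooth_cst.
  by apply/funext => x; rewrite big_ord0.
rewrite (_ : (fun x => _) = fun x => f ord0 x * \prod_i f (lift ord0 i) x); last first.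
  by apply/funext => x; rewrite big_ord_recl.
exact: smooth_mul (sf ord0) (IH _ (fun i => sf (lift ord0 i))).
Qed.

Lemma smooth_opp E (f : E -> R) : smooth f -> smooth (fun x => - f x).
Proof.
move=> sf; rewrite (_ : (fun x => _) = fun x => -1 * f x); last first.
  by apply/funext => x; rewrite mulN1r.
exact: (smooth_mul (smooth_cst (-1))).
Qed.

Lemma smooth_sub E (f g : E -> R) : smooth f -> smooth g -> smooth (fun x => f x - g x).
Proof. by move=> sf sg; apply: smooth_add sf (smooth_opp sg). Qed.

Lemma smooth_id : smooth (id : R -> R).
Proof. by apply: smooth_lin => [x //|v]; exists v => x; exact: is_derive_id. Qed.

Lemma is_derive_coord d (i : 'I_d) (x v : 'cV[R]_d) : is_derive x v (fun x : 'cV[R]_d => x i 0) (v i 0).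
Proof.
suff H : (fun h : R => h^-1 *: (((fun x : 'cV[R]_d => x i 0) \o shift x) (h *: v) - x i 0)) @ 0^' --> v i 0.
  by split; [apply/cvg_ex; eexists; exact: H|exact/cvg_lim].
apply: cvg_near_cst; near=> h; rewrite /= !mxE addrK scalerA mulVf ?scale1r //.
by near: h; exact: nbhs_dnbhs_neq.
Unshelve. all: by end_near.
Qed.

Lemma smooth_coord d (i : 'I_d) : smooth (fun x : 'cV[R]_d => x i 0).
Proof.
apply: smooth_lin => [|v]; first exact: coord_continuous.
by exists (v i 0) => x; exact: is_derive_coord.
Qed.

Lemma smooth_fst E (g : R -> R) : smooth (g : R -> R) -> smooth (fun p : R * E => g p.1).
Proof.
move=> sg; apply: (@smooth_comp1 (R * E)%type g fst) => //.
apply: smooth_lin => [p|v]; first exact: cvg_fst.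
exists v.1 => x.
suff H : (fun h : R => h^-1 *: (((fst : R * E -> R) \o shift x) (h *: v) - x.1)) @ 0^' --> v.1.
  by split; [apply/cvg_ex; eexists; exact: H|exact/cvg_lim].
apply: cvg_near_cst; near=> h; rewrite /= addrK scalerA mulVf ?scale1r //.
by near: h; exact: nbhs_dnbhs_neq.
Unshelve. all: by end_near.
Qed.

Lemma col_sum_delta d (x : 'cV[R]_d) : x = \sum_i x i 0 *: delta_mx i 0.
Proof. by rewrite {1}[x]matrix_sum_delta; apply: eq_bigr => i _; rewrite big_ord1. Qed.

Lemma smooth_snd d (g : 'cV[R]_d -> R) : smooth g -> smooth (fun p : R * 'cV[R]_d => g p.2).
Proof.
move=> sg.
rewrite (_ : (fun _ => _) = fun p : R * 'cV[R]_d => g (\sum_i p.2 i 0 *: delta_mx i 0)); last first.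
  by apply/funext => p; rewrite -col_sum_delta.
apply: (@smooth_comp (R * 'cV[R]_d)%type d 'cV[R]_d (fun i => delta_mx i 0)
  (fun i (p : R * 'cV[R]_d) => p.2 i 0) g) => // i.
apply: smooth_lin => [p|v].
  apply: (continuous_comp (f := snd) (g := fun x : 'cV[R]_d => x i 0)); first exact: cvg_snd.
  exact: coord_continuous.
exists (v.2 i 0) => x.
suff H : (fun h : R => h^-1 *: (((fun p : R * 'cV[R]_d => p.2 i 0) \o shift x) (h *: v) - x.2 i 0)) @ 0^' --> v.2 i 0.
  by split; [apply/cvg_ex; eexists; exact: H|exact/cvg_lim].
apply: cvg_near_cst; near=> h; rewrite /= !mxE addrK scalerA mulVf ?scale1r //.
by near: h; exact: nbhs_dnbhs_neq.
Unshelve. all: by end_near.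
Qed.
End smooth_functions.

(** * A smooth step function built from exp(-1/y) *)

Section smooth_step.
Context {R : realType}.

(** Flat at 0 to every order. The polynomial factor in 1/y makes the family stable under
    differentiation, which replaces [P] by ['X^2 * (P - deriv P)]. *)
Definition expb (P : {poly R}) (y : R) : R :=
  if 0 < y then P.[y^-1] * expR (- y^-1) else 0.

(** For positive n, e^z is the n-th power of e^(z/n), and e^(z/n) >= z/n. *)
Lemma expr_expRN_le n (z : R) : 0 <= z -> z ^+ n * expR (- z) <= n%:R ^+ n.
Proof.
move=> z0; case: n => [|n]; first by rewrite !expr0 mul1r expR_le1 oppr_le0.
rewrite expRN ler_pdivrMr ?expR_gt0 //.
have -> : expR z = expR (z / n.+1%:R) ^+ n.+1 by rewrite -expRM_natl mulrC divfK.
rewrite -exprMn lerXn2r ?nnegrE ?mulr_ge0 ?expR_ge0 //.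
rewrite mulrC -ler_pdivrMr ?ltr0n //.
by apply: le_trans (expR_ge1Dx _); rewrite lerDr.
Qed.

Lemma poly_expRN_bound (Q : {poly R}) :
  exists2 C : R, 0 <= C & forall z, 0 < z -> `|Q.[z] * expR (- z)| <= C / z.
Proof.
exists (\sum_(i < size Q) `|Q`_i| * i.+1%:R ^+ i.+1) => [|z z0].
  by apply: sumr_ge0 => i _; rewrite mulr_ge0 // exprn_ge0.
rewrite ler_pdivlMr // -[X in _ * X]gtr0_norm // -normrM horner_coef !mulr_suml.
apply: le_trans (ler_norm_sum _ _ _) _; apply: ler_sum => i _.
rewrite -!mulrA normrM ler_wpM2l // ger0_norm; last first.
  by rewrite !mulr_ge0 ?exprn_ge0 ?expR_ge0 // ltW.
by rewrite mulrA mulrAC -exprSr expr_expRN_le // ltW.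
Qed.

Lemma is_derive_expb P (y : R) :
  is_derive y (1 : R) (expb P) (expb ('X^2 * (P - deriv P)) y).
Proof.
have [y0|y0|->] := ltgtP y 0.
- rewrite {2}/expb ltNge (ltW y0) /=.
  apply: (@near_eq_is_derive _ _ _ (cst 0)) => //.
  near=> z; rewrite /expb ltNge ltW //; near: z; exact: lt_nbhsl.
- rewrite {2}/expb y0.
  have ny : y != 0 by rewrite gt_eqF.
  apply: (@near_eq_is_derive _ _ _ (fun z : R => P.[z^-1] * expR (- z^-1) : R)) => //.
    near=> z; rewrite /expb ifT //; near: z; exact: lt_nbhsr.
  have d1 : is_derive y 1 (fun z : R => z^-1) (- y ^- 2).
    have d0 : derivable (id : R -> R) y 1 by exact: derivable_id.
    apply: DeriveDef; first exact: (@derivableV _ _ (id : R -> R) y 1 ny d0).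
    by rewrite (@deriveV _ _ (id : R -> R) y 1 ny d0) derive_id [LHS]mulr1.
  have d2 : is_derive y 1 (fun z : R => P.[z^-1]) ((deriv P).[y^-1] * - y ^- 2).
    exact: (@is_derive1_comp _ (horner P) (fun z : R => z^-1) y _ _ (is_derive_poly P _) d1).
  have d3 : is_derive y 1 (fun z : R => expR (- z^-1)) (expR (- y^-1) * y ^- 2).
    have -> : expR (- y^-1) * y ^- 2 = expR (- y^-1) * - - y^-2 by rewrite opprK.
    exact: (@is_derive1_comp _ expR (fun z : R => - z^-1) y _ _ (is_derive_expR _) (is_deriveN d1)).
  apply: (is_derive_eq (is_deriveM d2 d3)).
  by rewrite !hornerE /GRing.scale /= exprVn; ring.
- rewrite {2}/expb ltxx.
  suff H : (fun h : R => h^-1 *: ((expb P \o shift 0) (h *: (1 : R)) - expb P 0)) @ 0^' --> (0 : R).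
    by split; [apply/cvg_ex; eexists; exact: H|exact/cvg_lim].
  (* For [h > 0] the difference quotient at 0 is the value of ['X * P] at [h^-1] times
     [expR (- h^-1)]; the decay [C / z] at [z = h^-1] makes it at most [C * h]. *)
  have [C C0 HC] := poly_expRN_bound ('X * P).
  apply/cvgr0Pnorm_lt => e e0; near=> h.
  rewrite /= addr0 [_%:A]mulr1 {2}/expb ltxx subr0 /expb; case: ifPn => [h0|_]; last by rewrite scaler0 normr0.
  have := HC h^-1; rewrite invr_gt0 => /(_ h0); rewrite hornerM hornerX -mulrA => /le_lt_trans; apply.
  rewrite invrK -[h](gtr0_norm h0) (@le_lt_trans _ _ ((C + 1) * `|h|)) ?ler_wpM2r ?lerDl //.
  rewrite mulrC -ltr_pdivlMr; last by rewrite ltr_wpDl.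
  by near: h; apply: dnbhs0_lt; rewrite divr_gt0 // ltr_wpDl.
Unshelve. all: by end_near.
Qed.

Lemma derive_R1 (g : R -> R) (y v : R) : derivable g y 1 -> 'D_v g y = v * 'D_1 g y.
Proof. by move=> dg; rewrite -derive_scale // [_%:A]mulr1. Qed.

Lemma smooth_expb P : smooth (expb P : R -> R).
Proof.
move=> vs /=; suff [Q ->] : exists Q, foldr (fun v (h : R -> R) => 'D_v h) (expb P) vs = expb Q.
  have dQ y : differentiable (expb Q) y.
    by apply/derivable1_diffP; have d := is_derive_expb Q y; exact: ex_derive.
  by split=> [y|y v]; [exact: differentiable_continuous|exact: diff_derivable].
elim: vs => [|v vs [Q /= ->]]; first by exists P.
exists (v *: ('X^2 * (Q - deriv Q))); apply/funext => y.
have d := is_derive_expb Q y; rewrite derive_R1; last exact: ex_derive.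
by rewrite derive_val /expb; case: ifP; rewrite ?mulr0 // hornerZ mulrA.
Qed.

Definition step (y : R) : R := expb 1 y / (expb 1 y + expb 1 (1 - y)).

Lemma expb1_ge0 y : 0 <= expb 1 y.
Proof. by rewrite /expb; case: ifP => // _; rewrite hornerE mul1r expR_ge0. Qed.

Lemma expb1_gt0 y : 0 < y -> 0 < expb 1 y.
Proof. by rewrite /expb => ->; rewrite hornerE mul1r expR_gt0. Qed.

Lemma expb_le0 P y : y <= 0 -> expb P y = 0.
Proof. by rewrite leNgt /expb => /negbTE ->. Qed.

Lemma step_den_gt0 y : 0 < expb 1 y + expb 1 (1 - y).
Proof.
have [y0|y0] := ltP 0 y; first by rewrite ltr_pwDl ?expb1_gt0 ?expb1_ge0.
by rewrite ltr_wpDl ?expb1_ge0 // expb1_gt0 // subr_gt0 (le_lt_trans y0).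
Qed.

Lemma smooth_step : smooth (step : R -> R).
Proof.
apply: smooth_mul; first exact: smooth_expb.
apply: smooth_inv => [|y]; last by rewrite gt_eqF // step_den_gt0.
apply: smooth_add; first exact: smooth_expb.
apply: smooth_comp1; last exact: smooth_expb.
by apply: smooth_sub; [exact: smooth_cst|exact: smooth_id].
Qed.

Lemma step_le0 y : y <= 0 -> step y = 0.
Proof. by move=> y0; rewrite /step expb_le0 // mul0r. Qed.

Lemma step_ge1 y : 1 <= y -> step y = 1.
Proof.
move=> y1; rewrite /step [X in _ + X]expb_le0 ?subr_le0 // addr0 divff //.
by rewrite gt_eqF // expb1_gt0 // (lt_le_trans _ y1).
Qed.

Lemma step_ge0 y : 0 <= step y.
Proof. by rewrite divr_ge0 ?expb1_ge0 // ltW // step_den_gt0. Qed.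

Lemma step_le1 y : step y <= 1.
Proof. by rewrite ler_pdivrMr ?step_den_gt0 // mul1r lerDl expb1_ge0. Qed.

(** The bound comes from compactness of [0, 1]. The conclusions on ['D_1 g] have the form of the
    hypotheses on [g], so the lemma applies once more to the derivative; this is how [step_bounds]
    reaches the second order. *)
Lemma step_bound (g : R -> R) (c0 c1 : R) : smooth (g : R -> R) ->
  (forall y, y < 0 -> g y = c0) -> (forall y, 1 < y -> g y = c1) ->
  [/\ forall y, y < 0 -> 'D_1 g y = 0, forall y, 1 < y -> 'D_1 g y = 0 &
   exists2 C, 0 <= C & forall y, `|'D_1 g y| <= C].
Proof.
move=> sg g0 g1.
have d0 y : y < 0 -> 'D_1 g y = 0.
  move=> y0; rewrite -(derive_cst c0 y (1 : R)); apply: near_eq_derive.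
  by near=> z; apply: g0; near: z; exact: lt_nbhsl.
have d1 y : 1 < y -> 'D_1 g y = 0.
  move=> y1; rewrite -(derive_cst c1 y (1 : R)); apply: near_eq_derive.
  by near=> z; apply: g1; near: z; exact: lt_nbhsr.
split => //.
have cD : continuous ('D_1 g) := smooth_cont (smooth_derive (1 : R) sg).
have cN : {within `[0, 1], continuous (fun y => `|'D_1 g y|)}.
  by apply: continuous_subspaceT => y; apply: cvg_norm; exact: cD.
have [c _ Hc] := EVT_max ler01 cN.
exists `|'D_1 g c| => // y.
have [y0|y0] := ltP y 0; first by rewrite d0 // normr0.
have [y1|y1] := ltP 1 y; first by rewrite d1 // normr0.
by apply: Hc; rewrite in_itv /= y0.
Unshelve. all: by end_near.
Qed.

Lemma step_bounds : exists2 C : R, 0 < C & (forall y, `|'D_1 step y| <= C) /\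
  (forall y z, `|'D_1 step y - 'D_1 step z| <= C * `|y - z|).
Proof.
have [d0 d1 [C C0 HC]] := step_bound smooth_step (fun y h => step_le0 (ltW h)) (fun y h => step_ge1 (ltW h)).
have [_ _ [C' C0' HC']] := step_bound (smooth_derive (1 : R) smooth_step) d0 d1.
exists (C + C' + 1); first by rewrite ltr_wpDl ?addr_ge0.
split=> [y|y z]; first by rewrite -addrA (le_trans (HC y)) // lerDl addr_ge0.
have [t _] := MVT_line z (y - z) (fun a b => @smooth_derivable _ _ _ a b (smooth_derive (1 : R) smooth_step)).
rewrite subrKC => ->; rewrite derive_R1; last exact/smooth_derivable/smooth_derive/smooth_step.
rewrite normrM mulrC ler_wpM2r //.
by rewrite addrAC (le_trans (HC' _)) // lerDr addr_ge0.
Qed.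

End smooth_step.

(** * The sup norm in coordinates *)

Section cV_norm.
Context {R : realType}.

Lemma cV_norm_le d (x : 'cV[R]_d) (c : R) :
  0 <= c -> (forall i, `|x i 0| <= c) -> `|x| <= c.
Proof.
move=> c0 H; rewrite [leLHS]/Num.norm /= mx_normrE.
by apply/bigmax_leP; split => // -[i j] _; rewrite (ord1 j); exact: H.
Qed.

Lemma le_cV_norm d (x : 'cV[R]_d) i : `|x i 0| <= `|x|.
Proof.
rewrite [leRHS]/Num.norm /= mx_normrE.
by apply: (le_bigmax_cond _ (fun ij : 'I_d * 'I_1 => `|x ij.1 ij.2|) (j := (i, 0))).
Qed.

End cV_norm.

(** * First and second order bounds of smooth functions *)

Section C2_bounds.
Context {R : realType}.
Implicit Types E : normedModType R.

(** [A] is a Lipschitz constant of the first derivative: a second-order bound that mentions no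
    second derivative. *)
Definition C2b E (g : E -> R) (L A : R) : Prop :=
  [/\ smooth g, forall x v, `|'D_v g x| <= L * `|v|
    & forall x y v, `|'D_v g x - 'D_v g y| <= A * `|x - y| * `|v|].

Lemma smooth_deriveD E (g : E -> R) x v w :
  smooth g -> 'D_(v + w) g x = 'D_v g x + 'D_w g x.
Proof.
move=> sg; apply: derive_add => [y u|]; first exact: smooth_derivable.
exact: (smooth_cont (smooth_derive v sg)).
Qed.

Lemma smooth_deriveB E (g : E -> R) x v w :
  smooth g -> 'D_(v - w) g x = 'D_v g x - 'D_w g x.
Proof.
move=> sg; rewrite smooth_deriveD // -scaleN1r derive_scale ?mulN1r //.
exact: smooth_derivable.
Qed.

Lemma smooth_deriveZ E (g : E -> R) x (a : R) v :
  smooth g -> 'D_(a *: v) g x = a * 'D_v g x.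
Proof. by move=> sg; rewrite derive_scale //; exact: smooth_derivable. Qed.

Lemma smooth_MVT E (g : E -> R) (x y : E) : smooth g ->
  exists2 t : R, 0 <= t <= 1 & g y - g x = 'D_(y - x) g (x + t *: (y - x)).
Proof.
move=> sg; have [t t01 e] := MVT_line x (y - x) (fun a b => @smooth_derivable _ _ _ a b sg).
by exists t => //; rewrite -e subrKC.
Qed.

Lemma C2b_lip E (g : E -> R) L A x y : C2b g L A -> `|g x - g y| <= L * `|x - y|.
Proof. by move=> [sg Lg _]; have [t _ ->] := smooth_MVT y x sg; exact: Lg. Qed.

Lemma C2b_taylor E (g : E -> R) L A x u : 0 <= A -> C2b g L A ->
  `|g (x + u) - g x - 'D_u g x| <= A * `|u| ^+ 2.
Proof.
move=> A0 [sg _ Ag]; have [t /andP[t0 t1]] := smooth_MVT x (x + u) sg.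
rewrite addrAC subrr add0r => ->; apply: le_trans (Ag _ _ _) _.
rewrite addrAC subrr add0r normrZ ger0_norm // expr2 [leRHS]mulrA ler_wpM2r //.
by rewrite ler_wpM2l // ler_piMl.
Qed.

Lemma C2b_weaken E (g : E -> R) L A L' A' : L <= L' -> A <= A' -> C2b g L A -> C2b g L' A'.
Proof.
move=> LL AA [sg Lg Ag]; split => // [x v|x y v].
  by rewrite (le_trans (Lg _ _)) // ler_wpM2r.
by rewrite (le_trans (Ag _ _ _)) // -!mulrA ler_wpM2r // mulr_ge0.
Qed.

Lemma C2b_cst E (c : R) : C2b (cst c : E -> R) 0 0.
Proof.
split => [|x v|x y v]; first exact: smooth_cst.
  by rewrite derive_cst normr0 mul0r.
by rewrite !derive_cst subrr normr0 !mul0r.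
Qed.

Lemma C2b_add E (f g : E -> R) L A L' A' : C2b f L A -> C2b g L' A' ->
  C2b (fun x => f x + g x) (L + L') (A + A').
Proof.
move=> [sf Lf Af] [sg Lg Ag].
have e x v : 'D_v (fun x => f x + g x) x = 'D_v f x + 'D_v g x.
  by rewrite deriveD //; exact: smooth_derivable.
split=> [|x v|x y v]; first exact: smooth_add.
  by rewrite e mulrDl (le_trans (ler_normD _ _)) // lerD.
by rewrite !e !mulrDl opprD addrACA (le_trans (ler_normD _ _)) // lerD.
Qed.

Lemma C2b_mul E (f g : E -> R) L A L' A' B B' : 0 <= B -> 0 <= B' -> 0 <= L -> 0 <= L' ->
  (forall x, `|f x| <= B) -> (forall x, `|g x| <= B') ->
  C2b f L A -> C2b g L' A' ->
  C2b (fun x => f x * g x) (B * L' + B' * L) (B * A' + B' * A + 2 * (L * L')).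
Proof.
move=> B0 B0' L0 L0' fB gB Cf Cg; have [sf Lf Af] := Cf; have [sg Lg Ag] := Cg.
have e x v : 'D_v (fun x => f x * g x) x = f x * 'D_v g x + g x * 'D_v f x.
  by rewrite (deriveM (f := f)) //; exact: smooth_derivable.
split=> [|x v|x y v]; first exact: smooth_mul.
  rewrite e mulrDl (le_trans (ler_normD _ _)) // lerD // normrM -mulrA ler_pM //.
rewrite !e.
have -> : f x * 'D_v g x + g x * 'D_v f x - (f y * 'D_v g y + g y * 'D_v f y) =
  f x * ('D_v g x - 'D_v g y) + g x * ('D_v f x - 'D_v f y) +
  ((f x - f y) * 'D_v g y + (g x - g y) * 'D_v f y) by ring.
have -> : (B * A' + B' * A + 2 * (L * L')) * `|x - y| * `|v| =
   B * (A' * `|x - y| * `|v|) + B' * (A * `|x - y| * `|v|) +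
   ((L * `|x - y|) * (L' * `|v|) + (L' * `|x - y|) * (L * `|v|)) by ring.
apply: le_trans (ler_normD _ _) _; apply: lerD; apply: le_trans (ler_normD _ _) _; apply: lerD; rewrite normrM ler_pM //.
  exact: C2b_lip Cf.
exact: C2b_lip Cg.
Qed.

Lemma C2b_scale E (c : R) (g : E -> R) L A : C2b g L A ->
  C2b (fun x => c * g x) (`|c| * L) (`|c| * A).
Proof.
move=> [sg Lg Ag].
have e x v : 'D_v (fun x => c * g x) x = c * 'D_v g x.
  by rewrite (deriveZ c) //; exact: smooth_derivable.
split=> [|x v|x y v].
- exact: (smooth_mul (smooth_cst c) sg).
- by rewrite e normrM -mulrA ler_wpM2l.
- by rewrite !e -mulrBr normrM -!mulrA ler_wpM2l // mulrA.
Qed.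

Lemma C2b_sum E (I : finType) (f : I -> E -> R) (L A : I -> R) :
  (forall i, C2b (f i) (L i) (A i)) ->
  C2b (fun x => \sum_i f i x) (\sum_i L i) (\sum_i A i).
Proof.
move=> H; elim: (index_enum _) => [|i s IH].
  rewrite !big_nil (_ : (fun x => _) = cst 0); first exact: C2b_cst.
  by apply/funext => x; rewrite big_nil.
rewrite !big_cons (_ : (fun x => _) = fun x => f i x + \sum_(j <- s) f j x).
  exact: C2b_add.
by apply/funext => x; rewrite big_cons.
Qed.

(** Factors bounded by 1 let the Leibniz rule simply add the first-order constants. These are kept
    explicit because they must cancel against the mesh in [partition_of_unity]; the second-order
    constant may be anything. *)
Lemma C2b_prod E n (f : 'I_n -> E -> R) (L A : R) : 0 <= L ->
  (forall i x, `|f i x| <= 1) -> (forall i, C2b (f i) L A) ->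
  exists A', C2b (fun x => \prod_i f i x) (n%:R * L) A'.
Proof.
move=> L0; elim: n f => [|n IH] f f1 Cf.
  exists 0; rewrite (_ : (fun x => _) = cst 1); first by rewrite mul0r; exact: C2b_cst.
  by apply/funext => x; rewrite big_ord0.
have [A' CA] := IH (fun i => f (lift ord0 i)) (fun i => f1 _) (fun i => Cf _).
rewrite (_ : (fun x => _) = fun x => f ord0 x * \prod_i f (lift ord0 i) x); last first.
  by apply/funext => x; rewrite big_ord_recl.
exists (1 * A' + 1 * A + 2 * (L * (n%:R * L))).
rewrite mulrSr mulrDl -[X in X + _]mul1r.
apply: C2b_mul => //; first by rewrite mulr_ge0.
by move=> x; rewrite normr_prod; apply: prodr_ile1 => i _; rewrite normr_ge0 f1.
Qed.

Lemma C2b_affine_comp d (s : R -> R) (C a c : R) (i : 'I_d) : smooth (s : R -> R) ->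
  (forall y, `|'D_1 s y| <= C) -> (forall y z, `|'D_1 s y - 'D_1 s z| <= C * `|y - z|) ->
  C2b (fun x : 'cV[R]_d => s (a * x i 0 + c)) (C * `|a|) (C * a ^+ 2).
Proof.
move=> ss s1 s2.
have su : smooth (fun x : 'cV[R]_d => a * x i 0 + c).
  apply: smooth_add (smooth_cst c); apply: smooth_mul (smooth_cst a) _; exact: smooth_coord.
have du (x v : 'cV[R]_d) : 'D_v (fun x : 'cV[R]_d => a * x i 0 + c) x = a * v i 0.
  have dx := is_derive_coord i x v.
  rewrite deriveD; last 2 first.
  - by apply: derivableM => //; exact: ex_derive.
  - exact: derivable_cst.
  rewrite derive_cst addr0 (deriveZ a) ?derive_val //; exact: ex_derive.
have e (x v : 'cV[R]_d) : 'D_v (fun x : 'cV[R]_d => s (a * x i 0 + c)) x = a * v i 0 * 'D_1 s (a * x i 0 + c).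
  have dx := @is_derive_comp_sum _ _ 1 R (fun=> 1) (fun _ (x : 'cV[R]_d) => a * x i 0 + c) s x v
     (fun _ => @smooth_derivable _ _ _ x v su) ss.
  rewrite (_ : (fun x0 : 'cV[R]_d => s (a * x0 i 0 + c)) =
    fun x0 : 'cV[R]_d => s (\sum_(j < 1) (a * x0 i 0 + c) *: (1 : R))); last first.
    by apply/funext => y; rewrite big_ord1 [_%:A]mulr1.
  by rewrite derive_val !big_ord1 [_%:A]mulr1 du.
split=> [|x v|x y v].
- exact: smooth_comp1.
- rewrite e !normrM (_ : C * `|a| * `|v| = `|a| * `|v| * C); last by ring.
  by rewrite ler_pM ?mulr_ge0 // ler_wpM2l ?le_cV_norm.
- rewrite !e -mulrBr !normrM.
  apply: le_trans (_ : `|a| * `|v| * (C * (`|a| * `|x - y|)) <= _).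
    rewrite ler_pM ?mulr_ge0 //; first by rewrite ler_wpM2l ?le_cV_norm.
    apply: le_trans (s2 _ _) _; rewrite ler_wpM2l //.
      by apply: le_trans (normr_ge0 _) (s1 0).
    rewrite opprD addrACA subrr addr0 -mulrBr normrM ler_wpM2l //.
    by have := le_cV_norm (x - y) i; rewrite !mxE.
  have -> : a ^+ 2 = `|a| * `|a| by rewrite -expr2 real_normK ?num_real.
  by rewrite (_ : `|a| * `|v| * _ = C * (`|a| * `|a|) * `|x - y| * `|v|) //; ring.
Qed.
End C2_bounds.

(** * Composition with a perturbation of the identity *)

Section euler_step.
Context {R : realType}.

(** With e(x) = x + U(x), the derivative of g o e at x along v is that of g at e(x) along v + D_v
    U(x). In the application [B] is of the order of the time step, so the factor [1 + B] stays
    bounded over many compositions. *)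
Lemma C2b_euler d (g : 'cV[R]_d -> R) (U : 'I_d -> 'cV[R]_d -> R) (L A B K : R) :
  0 <= L -> 0 <= A -> 0 <= B -> 0 <= K -> C2b g L A -> (forall i, C2b (U i) B K) ->
  C2b (fun x => g (x + \col_i U i x)) (L * (1 + B)) (A * (1 + B) ^+ 2 + L * K).
Proof.
move=> L0 A0 B0 K0 Cg CU; have [sg Lg Ag] := Cg.
pose e (x : 'cV[R]_d) := x + \col_i U i x.
have eE x : e x = \sum_i (x i 0 + U i x) *: delta_mx i 0.
  by rewrite {1}(col_sum_delta (e x)); apply: eq_bigr => i _; rewrite !mxE.
pose DU (v x : 'cV[R]_d) := \col_i 'D_v (U i) x.
have su i : smooth (fun x : 'cV[R]_d => x i 0 + U i x).
  by apply: smooth_add; [exact: smooth_coord|have [] := CU i].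
have De x v : 'D_v (fun x => g (e x)) x = 'D_(v + DU v x) g (e x).
  have -> : (fun x => g (e x)) = fun x => g (\sum_i (x i 0 + U i x) *: delta_mx i 0).
    by apply/funext => z; rewrite eE.
  have dx := @is_derive_comp_sum _ _ d _ (fun i => delta_mx i 0)
    (fun i (x : 'cV[R]_d) => x i 0 + U i x) g x v (fun i => @smooth_derivable _ _ _ x v (su i)) sg.
  rewrite derive_val -eE (col_sum_delta (v + DU v x)) smooth_derive_sum //.
  apply: eq_bigr => i _; rewrite !mxE; congr (_ * _).
  have d1 := is_derive_coord i x v.
  have dU : derivable (U i) x v by apply: smooth_derivable; have [] := CU i.
  by case: d1 => dd1 ed1; rewrite (deriveD dd1 dU) ed1.
have DU1 v x : `|DU v x| <= B * `|v|.
  apply: cV_norm_le => [|i]; first by rewrite mulr_ge0.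
  by rewrite mxE; have [_ + _] := CU i; apply.
have DU2 v x y : `|DU v x - DU v y| <= K * `|x - y| * `|v|.
  apply: cV_norm_le => [|i]; first by rewrite !mulr_ge0.
  by rewrite !mxE; have [_ _] := CU i; apply.
have e1 x y : `|e x - e y| <= (1 + B) * `|x - y|.
  rewrite /e opprD addrACA (le_trans (ler_normD _ _)) // mulrDl mul1r lerD2l.
  apply: cV_norm_le => [|i]; first by rewrite mulr_ge0.
  by rewrite !mxE; exact: C2b_lip (CU i).
have vDU v x : `|v + DU v x| <= (1 + B) * `|v|.
  by rewrite (le_trans (ler_normD _ _)) // mulrDl mul1r lerD2l.
split=> [|x v|x y v].
- have -> : (fun x => g (x + \col_i U i x)) = fun x => g (\sum_i (x i 0 + U i x) *: delta_mx i 0).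
    by apply/funext => z; rewrite -eE.
  exact: (@smooth_comp _ _ d _ (fun i => delta_mx i 0) (fun i (x : 'cV[R]_d) => x i 0 + U i x)).
- by rewrite De (le_trans (Lg _ _)) // -mulrA ler_wpM2l.
- rewrite !De.
  have -> : 'D_(v + DU v x) g (e x) - 'D_(v + DU v y) g (e y) =
    ('D_(v + DU v x) g (e x) - 'D_(v + DU v x) g (e y)) + 'D_(DU v x - DU v y) g (e y).
    have -> : DU v x - DU v y = (v + DU v x) - (v + DU v y) by rewrite opprD addrACA subrr add0r.
    by rewrite (smooth_deriveB _ _ _ sg) addrA subrK.
  rewrite mulrDl mulrDl; apply: le_trans (ler_normD _ _) _; apply: lerD.
    apply: le_trans (Ag _ _ _) _.
    rewrite (_ : _ * _ * _ * _ = A * ((1 + B) * `|x - y|) * ((1 + B) * `|v|)); last by ring.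
    by rewrite ler_pM ?mulr_ge0 // ler_wpM2l.
  by apply: le_trans (Lg _ _) _; rewrite -!mulrA ler_wpM2l // mulrA.
Qed.

End euler_step.

(** * Smooth partitions of unity *)

Section partition.
Context {R : realType}.

(* the k-th of the functions whose telescoping differences form the partition of unity *)
Definition ramp (n : nat) (a e : R) (k : nat) (y : R) : R :=
  if k == 0%N then 1 else if (n < k)%N then 0 else step (e^-1 * y + (1 - (a + k%:R * e) / e)).

Definition hat n a e k (y : R) : R := ramp n a e k y - ramp n a e k.+1 y.

Lemma ramp_ge0 n a e k y : 0 <= ramp n a e k y.
Proof. by rewrite /ramp; case: ifP => // _; case: ifP => // _; exact: step_ge0. Qed.

Lemma ramp_le1 n a e k y : ramp n a e k y <= 1.
Proof. by rewrite /ramp; case: ifP => // _; case: ifP => // _; exact: step_le1. Qed.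

Lemma ramp_eq1 n a e k y : 0 < e -> (k <= n)%N -> a + k%:R * e <= y -> ramp n a e k y = 1.
Proof.
move=> e0 kn ky; rewrite /ramp ltnNge kn /=; case: ifP => // _.
by apply: step_ge1; rewrite addrCA lerDl [e^-1 * y]mulrC subr_ge0 ler_pM2r ?invr_gt0.
Qed.

Lemma ramp_eq0 n a e k y : 0 < e -> k != 0%N -> y <= a + k%:R * e - e -> ramp n a e k y = 0.
Proof.
move=> e0 /negbTE k0 ky; rewrite /ramp k0; case: ifP => // _.
apply: step_le0; rewrite addrCA -[X in X + _](mulfV (lt0r_neq0 e0)) [e^-1 * y]mulrC -mulrBl -mulrDl.
apply: mulr_le0_ge0; last by rewrite invr_ge0 ltW.
move: ky; move: (k%:R * e) => z; lra.
Qed.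

(** An interior ramp [k] rises from 0 to 1 on an interval of length [e] that ends at node [k], so
    ramp [k.+1] is still 0 wherever ramp [k] is below 1. *)
Lemma hat_ge0 n a e k y : 0 < e -> (k <= n)%N -> 0 <= hat n a e k y.
Proof.
move=> e0 kn; rewrite /hat subr_ge0.
have [ky|ky] := leP (a + k%:R * e) y; first by rewrite (ramp_eq1 e0 kn ky) ramp_le1.
rewrite [leLHS]ramp_eq0 ?ramp_ge0 //.
by rewrite -natr1 mulrDl mul1r addrA addrK ltW.
Qed.

Lemma hat_le1 n a e k y : hat n a e k y <= 1.
Proof. by rewrite /hat lerBlDr (le_trans (ramp_le1 _ _ _ _ _)) // lerDl ramp_ge0. Qed.

Lemma sum_hat n a e y : \sum_(k < n.+1) hat n a e k y = 1.
Proof.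
rewrite /hat (eq_bigr (fun k : 'I_n.+1 => - (ramp n a e k.+1 y - ramp n a e k y))); last first.
  by move=> i _; rewrite opprB.
rewrite sumrN -(big_mkord xpredT (fun k => ramp n a e k.+1 y - ramp n a e k y)) telescope_sumr //.
by rewrite /ramp ltnSn /= sub0r opprK.
Qed.

Lemma hat_neq0_lt n a e k y : 0 < e -> (k < n)%N -> hat n a e k y != 0 -> y < a + k%:R * e + e.
Proof.
move=> e0 kn; rewrite ltNge; apply: contra => ky.
have h1 : ramp n a e k.+1 y = 1 by apply: ramp_eq1 => //; rewrite -natr1 mulrDl mul1r addrA.
have h2 : ramp n a e k y = 1.
  by apply: ramp_eq1 => //; [exact: ltnW|rewrite (le_trans _ ky) // lerDl ltW].
by rewrite /hat h1 h2 subrr.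
Qed.

Lemma hat_neq0_gt n a e k y : 0 < e -> k != 0%N -> hat n a e k y != 0 -> a + k%:R * e - e < y.
Proof.
move=> e0 k0; rewrite ltNge; apply: contra => ky.
have h1 : ramp n a e k y = 0 by exact: ramp_eq0.
have h2 : ramp n a e k.+1 y = 0.
  apply: ramp_eq0 => //; rewrite -natr1 mulrDl mul1r addrA addrK.
  by rewrite (le_trans ky) // gerBl ltW.
by rewrite /hat h1 h2 subrr.
Qed.

(* nodes a + k e, k <= n, covering [-r, r] *)
Lemma hat_close n r e k y : 0 < e -> 0 < r -> n%:R * e = 2 * r -> (k <= n)%N ->
  hat n (- r) e k y != 0 -> `|y - (- r + k%:R * e)| <= e + y ^+ 2 / r.
Proof.
move=> e0 r0 nr kn hk.
(* The first and the last hat extend to infinity. Outside [-r, r] the point [y] is at distance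
   [|y| - r] from the end node on its side, and this inequality absorbs that distance into the
   quadratic term. *)
have y2 : `|y| - r <= y ^+ 2 / r.
  rewrite ler_pdivlMr // -[y ^+ 2]real_normK ?num_real //; nra.
have y20 : 0 <= y ^+ 2 / r by rewrite divr_ge0 ?sqr_ge0 // ltW.
have yy := ler_norm y; have yn := ler_norm (- y); rewrite normrN in yn.
rewrite ler_norml; apply/andP; split.
  have [k0|k0] := eqVneq k 0%N; first by rewrite k0 mul0r; lra.
  have := hat_neq0_gt e0 k0 hk; lra.
move: kn; rewrite leq_eqVlt => /predU1P[kn|kn]; first by rewrite kn nr; lra.
have := hat_neq0_lt e0 kn hk; lra.
Qed.

Lemma hat_node_le n r e k y : 0 < e -> 0 < r -> n%:R * e = 2 * r -> (k <= n)%N ->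
  hat n (- r) e k y != 0 -> `|- r + k%:R * e| <= `|y| + e.
Proof.
move=> e0 r0 nr kn hk; have ke : k%:R * e <= n%:R * e by rewrite ler_pM2r // ler_nat.
have ke0 : 0 <= k%:R * e by rewrite mulr_ge0 // ltW.
have yy := ler_norm y; have yn := ler_norm (- y); rewrite normrN in yn.
have n0 : (0 < n)%N by rewrite -(ltr0n R) -(pmulr_lgt0 _ e0) nr mulr_gt0.
rewrite ler_norml; apply/andP; split.
  move: kn; rewrite leq_eqVlt => /predU1P[kn|kn]; first by rewrite kn nr; lra.
  have := hat_neq0_lt e0 kn hk; lra.
have [k0|k0] := eqVneq k 0%N.
  have kn' : (k < n)%N by rewrite k0.
  rewrite k0 mul0r; have := hat_neq0_lt e0 kn' hk; rewrite k0 mul0r; lra.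
have := hat_neq0_gt e0 k0 hk; lra.
Qed.

(** Each hat lives within one mesh of its node, on the sides where it does not extend to
    infinity. *)
Lemma hat_adjacent n a e k l y : 0 < e -> (k <= n)%N -> (l <= n)%N ->
  hat n a e k y != 0 -> hat n a e l y != 0 -> (k <= l.+1)%N.
Proof.
move=> e0 kn ln hk hl; rewrite leqNgt; apply/negP => lk.
have k0 : k != 0%N by rewrite -lt0n (leq_ltn_trans _ lk).
have h1 := hat_neq0_gt e0 k0 hk.
have h2 := hat_neq0_lt e0 (leq_trans (ltnW lk) kn) hl.
have : l.+2%:R * e <= k%:R * e by rewrite ler_wpM2r ?ler_nat // ltW.
rewrite -!natr1 !mulrDl !mul1r => h3; lra.
Qed.

(** [C] is fixed before the mesh [e], so first derivatives are of order 1/e with an absolute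
    constant; the second-order bound [A] may depend on [e]. *)
Lemma C2b_hat : exists2 C : R, 0 < C & forall n a e, 0 < e -> exists2 A : R, 0 <= A &
  forall d (i : 'I_d) k, C2b (fun x : 'cV[R]_d => hat n a e k (x i 0)) (C / e) A.
Proof.
have [C C0 [s1 s2]] := @step_bounds R.
exists (2 * C); first by rewrite mulr_gt0.
move=> n a e e0; exists (2 * (C * (e^-1) ^+ 2)) => [|d i k].
  by rewrite mulr_ge0 // mulr_ge0 ?sqr_ge0 // ltW.
have Cr j : C2b (fun x : 'cV[R]_d => ramp n a e j (x i 0)) (C / e) (C * e^-1 ^+ 2).
  have L0 : 0 <= C / e by rewrite divr_ge0 // ltW.
  have A0 : 0 <= C * e^-1 ^+ 2 by rewrite mulr_ge0 ?sqr_ge0 // ltW.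
  have [->|j0] := eqVneq j 0%N.
    by rewrite /ramp /=; exact: C2b_weaken L0 A0 (C2b_cst _ 1).
  have [nj|jn] := ltnP n j.
    rewrite /ramp (negbTE j0) nj; exact: C2b_weaken L0 A0 (C2b_cst _ 0).
  rewrite /ramp (negbTE j0) ltnNge jn /= -[X in C / X]gtr0_norm // -normfV.
  by apply: C2b_affine_comp => //; exact: smooth_step.
have := C2b_add (Cr k) (C2b_scale (-1) (Cr k.+1)).
rewrite normrN1 !mul1r -mulrA !mulrDl !mul1r.
by under eq_fun do rewrite mulN1r.
Qed.

End partition.

(** * Product partitions of unity and their derivatives *)

Section partition_of_unity.
Context {R : realType}.

Lemma smooth_derive_bigsum (E : normedModType R) (I : Type) (s : seq I) (f : I -> E -> R) x v :
  (forall i, smooth (f i)) ->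
  'D_v (fun x => \sum_(i <- s) f i x) x = \sum_(i <- s) 'D_v (f i) x.
Proof.
move=> sf; suff [] : smooth (fun x => \sum_(i <- s) f i x) /\
  'D_v (fun x => \sum_(i <- s) f i x) x = \sum_(i <- s) 'D_v (f i) x by [].
elim: s => [|i s [sS IH]].
  rewrite (_ : (fun x => _) = cst 0) ?big_nil ?derive_cst; last first.
    by apply/funext => z; rewrite big_nil.
  by split; [exact: smooth_cst|].
rewrite (_ : (fun x => _) = fun x => f i x + \sum_(j <- s) f j x); last first.
  by apply/funext => z; rewrite big_cons.
split; first exact: (smooth_add (sf i) sS).
rewrite big_cons -IH.
exact: (deriveD (@smooth_derivable _ _ _ x v (sf i)) (@smooth_derivable _ _ _ x v sS)).
Qed.

(** A zero of a nonnegative function is a minimum. In a sum of derivatives of a partition of unity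
    this removes every member that vanishes at the point. *)
Lemma derive_at_zero (E : normedModType R) (f : E -> R) x v : smooth f ->
  (forall y, 0 <= f y) -> f x = 0 -> 'D_v f x = 0.
Proof.
move=> sf f0 fx; have df := @smooth_derivable _ _ f _ v sf.
have d1 : is_derive (0 : R) (1 : R) (fun s : R => f (x + s *: v)) 0.
  apply: (@derive1_at_min _ _ (-1) 1) => //.
  - by move=> t _; have d := derivable_line (df (x + t *: v)); exact: ex_derive.
  - by rewrite in_itv /=; apply/andP; split; rewrite ?ltrN10 ?ltr01.
  - by move=> t _; rewrite scale0r addr0 fx.
by have /is_derive_lineP d2 := d1; rewrite derive_val.
Qed.

(** A neighbour is encoded by its offsets [k i + 1 - k0 i], each of which is 0, 1 or 2. *)
Lemma card_adjacent n d (k0 : {ffun 'I_d -> 'I_n}) :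
  (#|[set k : {ffun 'I_d -> 'I_n} | [forall i, (k i <= (k0 i).+1)%N && (k0 i <= (k i).+1)%N]]|
    <= 3 ^ d)%N.
Proof.
pose F (k : {ffun 'I_d -> 'I_n}) : {ffun 'I_d -> 'I_3} := [ffun i => inord (k i + 1 - k0 i)].
have <- : #|{ffun 'I_d -> 'I_3}| = (3 ^ d)%N by rewrite card_ffun !card_ord.
apply: (@leq_card_in _ _ F) => k l.
rewrite !inE => /forallP hk /forallP hl /ffunP Fkl; apply/ffunP => i; apply/val_inj.
have := Fkl i; rewrite !ffunE => /(congr1 val).
have /andP[k1 k2] := hk i; have /andP[l1 l2] := hl i.
by rewrite /= !inordK ?ltnS; lia.
Qed.

(** In the last clause [C] depends on [d] only, although first derivatives are of order 1/e. As
    these derivatives sum to 0, the value [b (node k0)] at a node with [psi k0 x != 0] can be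
    subtracted. At most 3^d members contribute, with nodes within [e] of [node k0], and the
    Lipschitz bound [kap * e] cancels the factor 1/e. *)
Lemma partition_of_unity d : exists2 C : R, 0 <= C & forall eta r : R, 0 < eta -> 0 < r ->
  exists (I : finType) (psi : I -> 'cV[R]_d -> R) (node : I -> 'cV[R]_d) (B A : R),
  [/\ 0 <= B, 0 <= A & forall k, C2b (psi k) B A] /\
  [/\ forall k x, 0 <= psi k x, forall x, \sum_k psi k x = 1,
    forall k x, psi k x != 0 -> `|x - node k| <= eta + `|x| ^+ 2 / r,
    forall k x, psi k x != 0 -> `|node k| <= `|x| + eta &
    forall (b : 'cV[R]_d -> R) kap, (forall x y, `|b x - b y| <= kap * `|x - y|) ->
      forall x v, `|\sum_k 'D_v (psi k) x * b (node k)| <= C * kap * `|v|].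
Proof.
have [C C0 HC] := @C2b_hat R.
exists ((3 ^ d)%:R * (d%:R * C)) => [|eta r eta0 r0]; first by rewrite !mulr_ge0 // ltW.
(* Enough nodes on [-r, r] for a mesh [e] of at most [eta]. *)
pose n := (Num.trunc (2 * r / eta)).+1.
have n0 : 0 < n%:R :> R by rewrite ltr0n.
pose e := 2 * r / n%:R.
have e0 : 0 < e by rewrite divr_gt0 // mulr_gt0.
have ne : n%:R * e = 2 * r by rewrite mulrC divfK // gt_eqF.
have eeta : e <= eta.
  by rewrite ler_pdivrMr // [eta * _]mulrC -ler_pdivrMr // ltW // truncnS_gt.
have [A A0 HA] := HC n (- r) e e0.
have L0 : 0 <= C / e by rewrite divr_ge0 // ltW.
pose I : finType := {ffun 'I_d -> 'I_n.+1}.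
pose psi (k : I) (x : 'cV[R]_d) := \prod_i hat n (- r) e (k i) (x i 0).
pose node (k : I) : 'cV[R]_d := \col_i (- r + (k i)%:R * e).
have h0 k i (x : 'cV[R]_d) : 0 <= hat n (- r) e (fun_of_fin (k : I) i) (x i 0).
  by apply: hat_ge0 => //; rewrite -ltnS.
have Cpsi k : exists A', C2b (psi k) (d%:R * (C / e)) A'.
  apply: C2b_prod => // i x; rewrite ger0_norm ?hat_le1 //.
have psi0 k x : 0 <= psi k x by apply: prodr_ge0 => i _.
have sumpsi x : \sum_k psi k x = 1.
  rewrite /psi -(bigA_distr_bigA (fun i (j : 'I_n.+1) => hat n (- r) e j (x i 0))) /=.
  by rewrite big1 // => i _; rewrite sum_hat.
have psiN k x : psi k x != 0 -> forall i, hat n (- r) e (k i) (x i 0) != 0.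
  by move=> /prodf_neq0 H i; exact: H.
pose Ak k := projT1 (cid (Cpsi k)).
have HAk k : C2b (psi k) (d%:R * (C / e)) (Ak k) := projT2 (cid (Cpsi k)).
exists I, psi, node, (d%:R * (C / e)), (\sum_k `|Ak k|); split; split => //.
- by rewrite mulr_ge0.
- by apply: sumr_ge0.
- move=> k; apply: C2b_weaken (HAk k) => //.
  by rewrite (bigD1 k) //= (le_trans (ler_norm _)) // lerDl sumr_ge0.
- move=> k x /psiN H; apply: cV_norm_le => [|i].
    by rewrite addr_ge0 ?divr_ge0 ?sqr_ge0 // ltW.
  rewrite !mxE; apply: le_trans (hat_close e0 r0 ne _ (H i)) _; first by rewrite -ltnS.
  rewrite lerD // ler_pM2r ?invr_gt0 // -[leLHS]real_normK ?num_real //.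
  by rewrite lerXn2r ?nnegrE // le_cV_norm.
- move=> k x /psiN H; apply: cV_norm_le => [|i]; first by rewrite addr_ge0 // ltW.
  rewrite mxE; apply: le_trans (hat_node_le e0 r0 ne _ (H i)) _; first by rewrite -ltnS.
  by rewrite lerD // le_cV_norm.
- move=> b kap bl x v.
  have kap0 : 0 <= kap * `|v|.
    have := bl v 0; rewrite subr0; exact: le_trans (normr_ge0 _).
  have [->|v0] := eqVneq v 0.
    by rewrite big1 ?normr0 ?mulr0 // => k _; rewrite derive0 mul0r.
  have kp : 0 <= kap by move: kap0; rewrite pmulr_lge0 // normr_gt0.
  have [k0 k0x] : exists k0, psi k0 x != 0.
    apply/not_existsP => H; have := sumpsi x; rewrite big1 => [/esym/eqP|k _].
      by rewrite oner_eq0.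
    by have /negP/negPn/eqP := H k.
  have sD : \sum_k 'D_v (psi k) x = 0.
    rewrite -smooth_derive_bigsum; last by move=> k; have [] := HAk k.
    rewrite (_ : (fun x => _) = cst 1) ?derive_cst //.
    by apply/funext => y; rewrite sumpsi.
  have -> : \sum_k 'D_v (psi k) x * b (node k) = \sum_k 'D_v (psi k) x * (b (node k) - b (node k0)).
    rewrite [RHS](eq_bigr (fun k => 'D_v (psi k) x * b (node k) - 'D_v (psi k) x * b (node k0))).
      by rewrite sumrB -mulr_suml sD mul0r subr0.
    by move=> k _; rewrite mulrBr.
  (* Multi-indices within 1 of [k0] in every coordinate; all other members vanish at [x] and, being
     nonnegative, have derivative 0 there. *)
  pose N := [set k : I | [forall i, (k i <= (k0 i).+1)%N && (k0 i <= (k i).+1)%N]].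
  rewrite (bigID [pred k | k \in N]) /= [X in _ + X]big1 ?addr0; last first.
    move=> k kN; rewrite derive_at_zero ?mul0r //; first by have [] := HAk k.
    apply/eqP; apply: contraNT kN => /psiN kx; rewrite inE; apply/forallP => i.
    have h2 := psiN _ _ k0x i.
    by apply/andP; split; apply: (@hat_adjacent _ n (- r) e _ _ (x i 0)) => //; rewrite -ltnS.
  apply: le_trans (ler_norm_sum _ _ _) _.
  apply: le_trans (_ : \sum_(k in N) d%:R * C * (kap * `|v|) <= _).
    apply: ler_sum => k; rewrite inE => /forallP kN.
    (* The mesh is reintroduced as [(C / e) * e], to match the bound of the derivative with the
       distance between the nodes. *)
    rewrite normrM (_ : _ * (kap * `|v|) = (d%:R * (C / e) * `|v|) * (kap * e)); last first.
      by field; rewrite gt_eqF.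
    apply: ler_pM => //; first by have [_ + _] := HAk k; exact.
    apply: le_trans (bl _ _) _.
    rewrite ler_wpM2l //.
    apply: cV_norm_le => [|i]; first exact: ltW.
    rewrite !mxE opprD addrACA subrr add0r -mulrBl normrM (gtr0_norm e0) ler_piMl ?(ltW e0) //.
    have /andP[k1 k2] := kN i.
    have {}k1 : (k i)%:R <= (k0 i)%:R + 1 :> R by rewrite natr1 ler_nat.
    have {}k2 : (k0 i)%:R <= (k i)%:R + 1 :> R by rewrite natr1 ler_nat.
    by rewrite ler_norml; apply/andP; split; lra.
  rewrite sumr_const -[_ *+ _]mulr_natl.
  rewrite (_ : _ * kap * `|v| = (3 ^ d)%:R * (d%:R * C * (kap * `|v|))); last by ring.
  rewrite ler_wpM2r ?mulr_ge0 ?(ltW C0) // ler_nat; exact: card_adjacent.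
Qed.
End partition_of_unity.

(** * Integrals of functions of quadratic growth *)

Section expectation.
Context {R : realType} {d : nat}.
Implicit Types (nu : probability (borelRd R d) R) (f g : 'cV[R]_d -> R).

Lemma continuous_borel f : continuous f -> measurable_fun setT (f : borelRd R d -> R).
Proof.
move=> /continuousP cf; apply: (measurability _ (measurable_realfun.RGenOpens.measurableE R)).
move=> _ [_ [a [b ->] <-]]; rewrite setTI; apply: sub_sigma_algebra.
exact/cf/interval_open.
Qed.

Lemma coord_measurable i : measurable_fun setT (fun x : borelRd R d => (x : 'cV[R]_d) i 0).
Proof. exact: (continuous_borel (@coord_continuous R d 1 i 0)). Qed.

Lemma enormE (x : 'cV[R]_d) : enorm x ^+ 2 = \sum_i x i 0 ^+ 2.
Proof.
have e : dot x x = \sum_i x i 0 ^+ 2.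
  by rewrite /dot mxE; apply: eq_bigr => i _; rewrite mxE expr2.
by rewrite /enorm sqr_sqrtr e // sumr_ge0 // => i _; rewrite sqr_ge0.
Qed.

Lemma enorm_ge0 (x : 'cV[R]_d) : 0 <= enorm x.
Proof. exact: sqrtr_ge0. Qed.

Lemma norm_le_enorm (x : 'cV[R]_d) : `|x| <= enorm x.
Proof.
apply: cV_norm_le => [|i]; first exact: enorm_ge0.
rewrite -(@ler_pXn2r _ 2) ?nnegrE ?enorm_ge0 // enormE real_normK ?num_real //.
by rewrite (bigD1 i) //= lerDl sumr_ge0 // => j _; rewrite sqr_ge0.
Qed.

Lemma enorm_le_norm (x : 'cV[R]_d) : enorm x <= Num.sqrt d%:R * `|x|.
Proof.
rewrite -(@ler_pXn2r _ 2) ?nnegrE ?mulr_ge0 ?enorm_ge0 ?sqrtr_ge0 //.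
rewrite enormE exprMn sqr_sqrtr ?ler0n //.
have -> : d%:R = \sum_(i < d) (1 : R) by rewrite sumr_const card_ord.
rewrite mulr_suml; apply: ler_sum => i _.
by rewrite mul1r -[leLHS]real_normK ?num_real // lerXn2r ?nnegrE // le_cV_norm.
Qed.

(** Integrands that every measure with finite second moment can integrate; continuity supplies Borel
    measurability. *)
Definition quad f : Prop :=
  continuous f /\ exists a b : R, [/\ 0 <= a, 0 <= b & forall x, `|f x| <= a + b * enorm x ^+ 2].

Lemma quad_bounded f C : continuous f -> (forall x, `|f x| <= C) -> quad f.
Proof.
move=> cf fC; split=> //; exists C, 0; split => //.
  exact: le_trans (normr_ge0 _) (fC 0).
by move=> x; rewrite mul0r addr0.
Qed.

Lemma quad_add f g : quad f -> quad g -> quad (fun x => f x + g x).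
Proof.
move=> [cf [a [b [a0 b0 fab]]]] [cg [a' [b' [a0' b0' gab]]]]; split.
  by move=> x; exact: (cvgD (cf x) (cg x)).
exists (a + a'), (b + b'); split; rewrite ?addr_ge0 // => x.
by rewrite (le_trans (ler_normD _ _)) // mulrDl addrACA lerD.
Qed.

Lemma quad_scale c f : quad f -> quad (fun x => c * f x).
Proof.
move=> [cf [a [b [a0 b0 fab]]]]; split.
  by move=> x; exact: (cvgM (cvg_cst c) (cf x)).
exists (`|c| * a), (`|c| * b); split; rewrite ?mulr_ge0 // => x.
by rewrite normrM -mulrA -mulrDr ler_wpM2l.
Qed.

Lemma quad_cst (c : R) : quad (fun=> c).
Proof. by apply: (@quad_bounded _ `|c|) => //; exact: cst_continuous. Qed.

Lemma continuous_enorm2 : continuous (fun x : 'cV[R]_d => enorm x ^+ 2).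
Proof.
rewrite (_ : (fun x => _) = fun x : 'cV[R]_d => \sum_i x i 0 ^+ 2); last first.
  by apply/funext => x; rewrite enormE.
apply: smooth_cont; apply: smooth_sum => i.
exact: smooth_mul (smooth_coord i) (smooth_coord i).
Qed.

Lemma quad_enorm2 : quad (fun x : 'cV[R]_d => enorm x ^+ 2).
Proof.
split; first exact: continuous_enorm2.
by exists 0, 1; split => // x; rewrite add0r mul1r ger0_norm // sqr_ge0.
Qed.

Lemma quad_sum (I : finType) (f : I -> 'cV[R]_d -> R) :
  (forall i, quad (f i)) -> quad (fun x => \sum_i f i x).
Proof.
move=> qf; elim: (index_enum _) => [|i s IH].
  by under eq_fun do rewrite big_nil; exact: quad_cst.
by under eq_fun do rewrite big_cons; exact: quad_add.
Qed.

Definition ex nu f : R := (\int[nu]_x f x)%R.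

Section fixed_measure.
Variable nu : probability (borelRd R d) R.
Hypothesis m2 : finite_second_moment nu.

Lemma quad_integrable f : quad f -> nu.-integrable setT (EFin \o (f : borelRd R d -> R)).
Proof.
have i2 : nu.-integrable setT (EFin \o (fun x : borelRd R d => enorm (x : 'cV[R]_d) ^+ 2)).
  apply/integrableP; split.
    by apply/measurable_EFinP; exact: (continuous_borel continuous_enorm2).
  apply: le_lt_trans m2; apply: ge0_le_integral => //.
  - apply/measurable_EFinP/measurableT_comp => //.
    exact: (continuous_borel continuous_enorm2).
  - by apply/measurable_EFinP; exact: (continuous_borel continuous_enorm2).
  - by move=> x _; rewrite /= lee_fin ger0_norm // sqr_ge0.
move=> [cf [a [b [a0 b0 fab]]]].
have i3 : nu.-integrable setT (EFin \o (fun x : borelRd R d => a + b * enorm (x : 'cV[R]_d) ^+ 2)).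
  have -> : EFin \o (fun x : borelRd R d => a + b * enorm (x : 'cV[R]_d) ^+ 2) =
    (EFin \o cst a \+ (fun x => b%:E * (EFin \o (fun x : borelRd R d => enorm (x : 'cV[R]_d) ^+ 2)%R) x))%E.
    by apply/funext => x; rewrite /= EFinD EFinM.
  apply: integrableD => //; last exact: integrableZl.
  exact: finite_measure_integrable_cst.
apply: le_integrable i3 => //; first by apply/measurable_EFinP; exact: continuous_borel cf.
move=> x _; rewrite /= lee_fin (le_trans (fab _)) // ler_norm //.
Qed.

Lemma exD f g : quad f -> quad g -> ex nu (fun x => f x + g x) = ex nu f + ex nu g.
Proof. by move=> qf qg; rewrite /ex RintegralD //; exact: quad_integrable. Qed.

Lemma exZ c f : quad f -> ex nu (fun x => c * f x) = c * ex nu f.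
Proof. by move=> qf; rewrite /ex RintegralZl //; exact: quad_integrable. Qed.

Lemma ex_cst c : ex nu (fun=> c) = c.
Proof.
transitivity (c * fine (nu setT)); first exact: Rintegral_cst.
by rewrite (_ : nu setT = 1%E) ?mulr1 //; exact: probability_setT.
Qed.

Lemma exB f g : quad f -> quad g -> ex nu (fun x => f x - g x) = ex nu f - ex nu g.
Proof. by move=> qf qg; rewrite /ex RintegralB //; exact: quad_integrable. Qed.

Lemma ex_le f g : quad f -> quad g -> (forall x, f x <= g x) -> ex nu f <= ex nu g.
Proof. by move=> qf qg fg; apply: le_Rintegral => //; exact: quad_integrable. Qed.

Lemma ex_norm_le f g : quad f -> quad g -> (forall x, `|f x| <= g x) -> `|ex nu f| <= ex nu g.
Proof.
move=> qf qg fg; rewrite ler_norml; apply/andP; split.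
  rewrite lerNl -[X in X <= _]mulN1r -exZ //; apply: ex_le => //; first exact: quad_scale.
  by move=> x; rewrite mulN1r; have := fg x; rewrite ler_norml => /andP[]; rewrite lerNl.
by apply: ex_le => // x; apply: le_trans (ler_norm _) (fg x).
Qed.

Lemma ex_sum (I : finType) (f : I -> 'cV[R]_d -> R) :
  (forall i, quad (f i)) -> ex nu (fun x => \sum_i f i x) = \sum_i ex nu (f i).
Proof.
move=> qf; suff [] : quad (fun x => \sum_i f i x) /\
  ex nu (fun x => \sum_i f i x) = \sum_i ex nu (f i) by [].
elim: (index_enum _) => [|i s [qs IH]].
  by under eq_fun do rewrite big_nil; rewrite big_nil ex_cst; split => //; exact: quad_cst.
under eq_fun do rewrite big_cons; rewrite big_cons -IH.
by split; [exact: quad_add|rewrite exD].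
Qed.

Lemma ex_quad_le f a b : quad f -> 0 <= b -> (forall x, `|f x| <= a + b * enorm x ^+ 2) ->
  `|ex nu f| <= a + b * ex nu (fun x => enorm x ^+ 2).
Proof.
move=> qf b0 fab; have qb := quad_scale b quad_enorm2.
rewrite -exZ; last exact: quad_enorm2.
rewrite -[X in X + _](ex_cst a) -exD //; last exact: quad_cst.
by apply: ex_norm_le => //; apply: quad_add => //; exact: quad_cst.
Qed.

Lemma EFin_ex f : quad f -> (\int[nu]_x (f x)%:E)%E = (ex nu f)%:E.
Proof.
by move=> qf; rewrite /ex /Rintegral fineK //; apply: integrable_fin_num => //; exact: quad_integrable.
Qed.

End fixed_measure.
End expectation.

(** * Integrals in time *)

Section time_integral.
Context {R : realType}.
Implicit Types (h : R -> R) (s t u : R).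

Local Notation LM := (@completed_lebesgue_measure R).

Lemma lebesgueR_measurable (A : set R) :
  measurable (A : set (measurableTypeR R)) -> measurable (A : set (lebesgueR R)).
Proof. exact: sub_caratheodory. Qed.

Lemma itv_lebesgueR (i : interval R) : measurable ([set` i] : set (lebesgueR R)).
Proof. by apply: lebesgueR_measurable; exact: measurable_itv. Qed.

Lemma borel_lebesgueR (D : set R) h : measurable (D : set (measurableTypeR R)) ->
  measurable_fun (D : set (measurableTypeR R)) h -> measurable_fun (D : set (lebesgueR R)) h.
Proof. by move=> mD mh _ Y mY; apply: lebesgueR_measurable; exact: mh. Qed.

Lemma LM_itvoc s t : s <= t -> LM `]s, t] = (t - s)%:E.
Proof.
move=> st; have -> : LM `]s, t] = lebesgue_measure (`]s, t]%classic : set R) by [].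
rewrite lebesgue_measure_itv /=; case: ifPn => [//|].
by rewrite lte_fin -leNgt => ts; rewrite (le_anti (_ : s <= t <= s)) ?subrr // st ts.
Qed.

(** Adjacent half-open intervals are disjoint, so [tint_add] holds without any discussion of
    endpoints. *)
Definition tint s t h : R :=
  Rintegral (@completed_lebesgue_measure R) (`]s, t] : set (lebesgueR R)) h.

Variable T : R.

(** Lebesgue rather than Borel measurability, since this is what is assumed of [V] in time. *)
Definition bmeas h : Prop :=
  measurable_fun (`[0, T] : set (lebesgueR R)) (h : lebesgueR R -> R) /\
  exists C, forall r, 0 <= r <= T -> `|h r| <= C.

Lemma bmeas_integrable h s t : bmeas h -> 0 <= s -> t <= T ->
  LM.-integrable (`]s, t] : set (lebesgueR R)) (EFin \o (h : lebesgueR R -> R)).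
Proof.
move=> [mh [C hC]] s0 tT.
have sub : `]s, t] `<=` `[0, T].
  by move=> r /=; rewrite !in_itv /= => /andP[sr rt]; rewrite (le_trans s0 (ltW sr)) (le_trans rt tT).
have [st|ts] := leP s t; last first.
  by rewrite set_itv_ge ?bnd_simp -?leNgt ?ltW //; exact: integrable_set0.
apply: measurable_bounded_integrable.
- exact: itv_lebesgueR.
- by rewrite [X in (X < _)%E](LM_itvoc st) ltry.
- by apply: measurable_funS mh => //; exact: itv_lebesgueR.
- exists C; split; first exact: num_real.
  move=> x Cx r /sub /=; rewrite in_itv /= => rT.
  exact: le_trans (hC r rT) (ltW Cx).
Qed.

Lemma tint_add s u t h : bmeas h -> 0 <= s -> s <= u -> u <= t -> t <= T ->
  tint s t h = tint s u h + tint u t h.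
Proof.
move=> bh s0 su ut tT; rewrite /tint.
have e : `]s, t]%classic = `]s, u]%classic `|` `]u, t]%classic.
  by rewrite -itv_bndbnd_setU // bnd_simp.
rewrite {1}e; apply: Rintegral_setU; try exact: itv_lebesgueR.
  by rewrite -e; exact: bmeas_integrable.
apply/disj_setPS => r /= [] /=; rewrite !in_itv /= => /andP[_ ru] /andP[ur _].
by move: (lt_le_trans ur ru); rewrite ltxx.
Qed.

Lemma tintD s t h1 h2 : bmeas h1 -> bmeas h2 -> 0 <= s -> t <= T ->
  tint s t (fun r => h1 r + h2 r) = tint s t h1 + tint s t h2.
Proof.
move=> b1 b2 s0 tT; rewrite /tint RintegralD //; first exact: itv_lebesgueR.
  exact: bmeas_integrable.
exact: bmeas_integrable.
Qed.

Lemma tintZ s t c h : bmeas h -> 0 <= s -> t <= T ->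
  tint s t (fun r => c * h r) = c * tint s t h.
Proof.
move=> b1 s0 tT; rewrite /tint RintegralZl //; first exact: itv_lebesgueR.
exact: bmeas_integrable.
Qed.

Lemma tint_cst s t c : s <= t -> tint s t (fun=> c) = c * (t - s).
Proof.
move=> st; rewrite /tint; have mI := itv_lebesgueR `]s, t].
transitivity (c * fine (LM `]s, t])); first exact: Rintegral_cst.
by rewrite [X in fine X](LM_itvoc st).
Qed.

Lemma tint_eq s t h1 h2 : (forall r, s < r <= t -> h1 r = h2 r) -> tint s t h1 = tint s t h2.
Proof.
move=> e; apply: eq_Rintegral => r; rewrite inE /= in_itv /=; exact: e.
Qed.

Lemma bmeas_cst c : bmeas (fun=> c).
Proof. by split; [exact: measurable_cst|exists `|c|]. Qed.

Lemma bmeasD h1 h2 : bmeas h1 -> bmeas h2 -> bmeas (fun r => h1 r + h2 r).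
Proof.
move=> [m1 [C1 b1]] [m2 [C2 b2]]; split; first exact: measurable_funD.
by exists (C1 + C2) => r rT; rewrite (le_trans (ler_normD _ _)) // lerD ?b1 ?b2.
Qed.

Lemma bmeasM h1 h2 : bmeas h1 -> bmeas h2 -> bmeas (fun r => h1 r * h2 r).
Proof.
move=> [m1 [C1 b1]] [m2 [C2 b2]]; split; first exact: measurable_funM.
by exists (C1 * C2) => r rT; rewrite normrM ler_pM ?b1 ?b2.
Qed.

Lemma bmeasZ c h : bmeas h -> bmeas (fun r => c * h r).
Proof. exact: bmeasM (bmeas_cst c). Qed.

Lemma bmeas_sum (I : finType) (h : I -> R -> R) :
  (forall i, bmeas (h i)) -> bmeas (fun r => \sum_i h i r).
Proof.
move=> bh; elim: (index_enum _) => [|i l IH].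
  by under eq_fun do rewrite big_nil; exact: bmeas_cst.
by under eq_fun do rewrite big_cons; exact: bmeasD.
Qed.

Lemma tint_sum (I : finType) (h : I -> R -> R) s t : (forall i, bmeas (h i)) ->
  0 <= s -> s <= t -> t <= T -> tint s t (fun r => \sum_i h i r) = \sum_i tint s t (h i).
Proof.
move=> bh s0 st tT; suff [] : bmeas (fun r => \sum_i h i r) /\
  tint s t (fun r => \sum_i h i r) = \sum_i tint s t (h i) by [].
elim: (index_enum _) => [|i l [bl IH]].
  under eq_fun do rewrite big_nil; rewrite big_nil tint_cst // mul0r.
  by split => //; exact: bmeas_cst.
under eq_fun do rewrite big_cons; rewrite big_cons -IH.
by split; [exact: bmeasD|exact: tintD].
Qed.

Lemma tint_norm_le s t h C : bmeas h -> 0 <= s -> s <= t -> t <= T ->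
  (forall r, s < r <= t -> `|h r| <= C) -> `|tint s t h| <= C * (t - s).
Proof.
move=> bh s0 st tT hC; rewrite /tint.
have mI := itv_lebesgueR `]s, t]; have ih := bmeas_integrable bh s0 tT.
apply: le_trans (le_normr_Rintegral mI ih) _.
rewrite -tint_cst // /tint; apply: le_Rintegral => //.
- have bn : bmeas (fun r => `|h r|).
    case: bh => mh [C' hC']; split; first exact: measurableT_comp.
    by exists C' => r rT; rewrite normr_id hC'.
  exact: bmeas_integrable bn s0 tT.
- exact: bmeas_integrable (bmeas_cst C) s0 tT.
Qed.

Lemma tintB s t h1 h2 : bmeas h1 -> bmeas h2 -> 0 <= s -> t <= T ->
  tint s t (fun r => h1 r - h2 r) = tint s t h1 - tint s t h2.
Proof.
move=> b1 b2 s0 tT; under eq_fun do rewrite -mulN1r.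
have bZ := bmeasZ (-1) b2.
by rewrite (tintD b1 bZ s0 tT) (tintZ (-1) b2 s0 tT) mulN1r.
Qed.

Lemma bmeasB h1 h2 : bmeas h1 -> bmeas h2 -> bmeas (fun r => h1 r - h2 r).
Proof.
move=> b1 b2; under eq_fun do rewrite -mulN1r.
exact: (bmeasD b1 (bmeasZ (-1) b2)).
Qed.

Lemma bmeas_continuous h : {within `[0, T], continuous h} -> bmeas h.
Proof.
move=> ch; split.
  apply: borel_lebesgueR; first exact: measurable_itv.
  by apply: subspace_continuous_measurable_fun => //; exact: measurable_itv.
have [T0|T0] := leP 0 T; last first.
  by exists 0 => r /andP[r0 rT]; move: (le_lt_trans (le_trans r0 rT) T0); rewrite ltxx.
have [|c _ Hc] := @EVT_max R (fun r => `|h r|) 0 T T0.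
  by move=> r; apply: cvg_norm; exact: ch.
by exists `|h c| => r rT; apply: Hc; rewrite in_itv.
Qed.

Lemma bmeas_eq h1 h2 : bmeas h1 -> (forall r, 0 <= r <= T -> h1 r = h2 r) -> bmeas h2.
Proof.
move=> [m1 [C b1]] e; split; last by exists C => r rT; rewrite -e // b1.
by apply: eq_measurable_fun m1 => r; rewrite inE /= in_itv /=; exact: e.
Qed.

(** Approximants with errors 1/(n+1) converge pointwise. The fluxes below get their measurability in
    this way, from finite sums. *)
Lemma bmeas_lim h : (forall e, 0 < e -> exists2 k, bmeas k & forall r, 0 <= r <= T -> `|h r - k r| <= e) ->
  bmeas h.
Proof.
move=> H; have i0 n : 0 < n.+1%:R^-1 :> R by rewrite invr_gt0.
pose k n := s2val (cid2 (H _ (i0 n))).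
have bk n : bmeas (k n) := s2valP (cid2 (H _ (i0 n))).
have hk n r : 0 <= r <= T -> `|h r - k n r| <= n.+1%:R^-1 := s2valP' (cid2 (H _ (i0 n))) r.
split; last first.
  have [_ [C hC]] := bk 0; exists (C + 1) => r rT.
  rewrite -[h r](subrK (k 0 r)) (le_trans (ler_normD _ _)) // addrC lerD ?hC //.
  by have := hk 0 r rT; rewrite invr1.
apply/measurable_EFinP.
apply: (emeasurable_fun_cvg (fun n (r : lebesgueR R) => (k n r)%:E)) => [n|r].
  by apply/measurable_EFinP; have [] := bk n.
rewrite /= in_itv /= => rT; apply/cvg_EFin; first by near=> n.
apply/cvgrPdist_lt => e e0; near=> n.
apply: le_lt_trans (hk n r rT) _.
by near: n; exact: near_infty_natSinv_lt (PosNum e0).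
Unshelve. all: by end_near.
Qed.

(** The closed interval of the weak formulation exceeds []0, T]] by a single point, a null set. *)
Lemma integral_tint h : 0 <= T -> bmeas h ->
  (\int[LM]_(r in (`[0%R, T] : set (lebesgueR R))) (h r)%:E)%E = (tint 0 T h)%:E.
Proof.
move=> T0 bh.
have ih := bmeas_integrable bh (lexx 0) (lexx T).
have m0 : measurable ([set 0 : R] : set (lebesgueR R)).
  by apply: lebesgueR_measurable; exact: measurable_set1.
have mc := itv_lebesgueR `[0, T].
have LM1 : LM [set 0] = 0%E.
  have -> : LM [set 0] = lebesgue_measure ([set 0] : set R) by [].
  exact: lebesgue_measure_set1.
have LMc : LM `[0, T] = T%:E.
  have -> : LM `[0, T] = lebesgue_measure (`[0, T]%classic : set R) by [].
  rewrite lebesgue_measure_itv /= lte_fin; case: ifPn => [_|]; first by rewrite sube0.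
  by rewrite -leNgt => T0'; congr EFin; apply: le_anti; rewrite T0 T0'.
have ic : LM.-integrable (`[0, T] : set (lebesgueR R)) (EFin \o (h : lebesgueR R -> R)).
  have [mh [C hC]] := bh; apply: measurable_bounded_integrable => //.
    by rewrite [X in (X < _)%E]LMc ltry.
  exists C; split; first exact: num_real.
  by move=> x Cx r; rewrite /= in_itv /= => rT; exact: le_trans (hC r rT) (ltW Cx).
apply: (etrans (negligible_integral m0 mc ic LM1)).
have -> : `[0, T]%classic `\` [set (0 : R)] = `]0, T]%classic by rewrite setDitv1l.
rewrite /tint /Rintegral fineK //; apply: (integrable_fin_num _ ih).
exact: itv_lebesgueR.
Qed.

End time_integral.

Lemma integrable_scale {R : realType} {dX : measure_display} {X : measurableType dX}
  (P : {measure set X -> \bar R}) (f : X -> R) (k : R) :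
  P.-integrable setT (EFin \o f) -> P.-integrable setT (EFin \o (fun x => k * f x)).
Proof.
move=> fi; have -> : EFin \o (fun x => k * f x) = (fun x => k%:E * (EFin \o f) x)%E.
  by apply/funext => x; rewrite /= EFinM.
exact: integrableZl.
Qed.

(** * Change of variables between a measure and its image *)

Section transfer.
Context {R : realType} {d1 d2 : measure_display} {X : measurableType d1} {Y : measurableType d2}.
Variables (P : probability X R) (Q : probability Y R) (phi : X -> Y).
Hypothesis mphi : measurable_fun setT phi.
Hypothesis PQ : forall A, measurable A -> P (phi @^-1` A) = Q A.

Lemma ge0_transfer (f : Y -> \bar R) : measurable_fun setT f -> (forall y, (0 <= f y)%E) ->
  (\int[Q]_y f y = \int[P]_x f (phi x))%E.
Proof.
move=> mf f0; have := @ge0_integral_pushforward _ _ _ _ _ _ mphi P setT f measurableT mf (fun y _ => f0 y).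
rewrite preimage_setT => <-; apply: eq_measure_integral => A mA _.
exact/esym/PQ.
Qed.

Lemma transfer_integrable (f : Y -> R) : Q.-integrable setT (EFin \o f) ->
  P.-integrable setT (EFin \o (f \o phi)).
Proof.
move=> /integrableP[mf fy]; apply/integrableP; split; first exact: measurableT_comp mf mphi.
rewrite -(ge0_transfer (f := fun y => `|(f y)%:E|%E)) //.
exact: measurableT_comp mf.
Qed.

Lemma transfer_Rintegral (f : Y -> R) : Q.-integrable setT (EFin \o f) ->
  (\int[Q]_y f y = \int[P]_x f (phi x))%R.
Proof.
move=> fi; have fi' := transfer_integrable fi; have /integrableP[mf _] := fi.
congr fine; transitivity (\int[pushforward P phi]_y (f y)%:E)%E.
  by apply: eq_measure_integral => A mA _; exact/esym/PQ.
by rewrite (integral_pushforward mphi mf) ?preimage_setT.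
Qed.

End transfer.

(** * Couplings and curves in Wasserstein space *)

Section wasserstein.
Context {R : realType} {d : nat}.
Implicit Types (P Q : probability (borelRd R d) R) (f g : 'cV[R]_d -> R).

Lemma measurable_sqdist : measurable_fun setT
  (fun p : borelRd R d * borelRd R d => enorm (p.1 - p.2 : 'cV[R]_d) ^+ 2).
Proof.
rewrite (_ : (fun p => _) = fun p : borelRd R d * borelRd R d =>
  \sum_i ((p.1 : 'cV[R]_d) i 0 - (p.2 : 'cV[R]_d) i 0) ^+ 2); last first.
  by apply/funext => p; rewrite enormE; apply: eq_bigr => i _; rewrite !mxE.
apply: measurable_sum => i; apply: measurable_funX; apply: measurable_funB.
  exact: (measurableT_comp (coord_measurable i) measurable_fst).
exact: (measurableT_comp (coord_measurable i) measurable_snd).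
Qed.

(** An infimum below [e] is undercut by some coupling, so no optimal plan is involved. *)
Lemma W2_lt_coupling P Q (e : R) : 0 < e -> (W2 P Q < e%:E)%E ->
  exists2 gam, couplings P Q gam &
  (\int[gam]_p (enorm (p.1 - p.2 : 'cV[R]_d) ^+ 2)%:E <= (e ^+ 2)%:E)%E.
Proof.
move=> e0 /ereal_inf_lt[_ [gam cg <-] lte]; exists gam => //.
rewrite leNgt; apply/negP => lt; move: lte; apply/negP; rewrite -leNgt.
have -> : e%:E = ((e ^+ 2)%:E `^ 2^-1)%E.
  by rewrite poweR_EFin -powR_mulrn ?ltW // -powRrM divff ?powRr1 // ltW.
apply: gt0_ler_poweR; rewrite ?invr_ge0 //.
- by rewrite in_itv /= lee_fin sqr_ge0 leey.
- by rewrite in_itv /= leey andbT integral_ge0 // => p _; rewrite lee_fin sqr_ge0.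
- exact: ltW.
Qed.

Lemma W2_le_coupling P Q gam (e : R) : 0 <= e -> couplings P Q gam ->
  (\int[gam]_p (enorm (p.1 - p.2 : 'cV[R]_d) ^+ 2)%:E <= (e ^+ 2)%:E)%E ->
  (W2 P Q <= e%:E)%E.
Proof.
move=> e0 cg le; apply: (@le_trans _ _ ((\int[gam]_p (enorm (p.1 - p.2 : 'cV[R]_d) ^+ 2)%:E) `^ 2^-1)%E).
  by apply: ereal_inf_lbound; exists gam.
have -> : e%:E = ((e ^+ 2)%:E `^ 2^-1)%E.
  by rewrite poweR_EFin -powR_mulrn // -powRrM divff ?powRr1.
apply: gt0_ler_poweR; rewrite ?invr_ge0 //.
- by rewrite in_itv /= leey andbT integral_ge0 // => p _; rewrite lee_fin sqr_ge0.
- by rewrite in_itv /= lee_fin sqr_ge0 leey.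
Qed.

Section coupling.
Variables (P Q : probability (borelRd R d) R) (gam : probability (borelRd R d * borelRd R d)%type R) (e : R).
Hypotheses (mP : finite_second_moment P) (mQ : finite_second_moment Q).
Hypotheses (e0 : 0 < e) (cg : couplings P Q gam).
Hypothesis (ge : (\int[gam]_p (enorm (p.1 - p.2 : 'cV[R]_d) ^+ 2)%:E <= (e ^+ 2)%:E)%E).

Let D := fun p : borelRd R d * borelRd R d => enorm (p.1 - p.2 : 'cV[R]_d) ^+ 2.

Let iD : gam.-integrable setT (EFin \o D).
Proof.
apply/integrableP; split; first by apply/measurable_EFinP; exact: measurable_sqdist.
apply: le_lt_trans (ltry (e ^+ 2)); apply: le_trans ge.
rewrite le_eqVlt; apply/orP; left; apply/eqP/eq_integral => p _.
by rewrite gee0_abs // lee_fin sqr_ge0.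
Qed.

Let D_le : \int[gam]_p D p <= e ^+ 2.
Proof.
rewrite -lee_fin /Rintegral fineK //; exact: integrable_fin_num.
Qed.

Lemma coupling_fst f : quad f ->
  gam.-integrable setT (EFin \o (fun p => f p.1)) /\ ex P f = \int[gam]_p f p.1.
Proof.
move=> qf; have i1 := quad_integrable mP qf.
have e1 A : measurable A -> gam (fst @^-1` A) = P A by move=> mA; have [] := cg mA.
split; first exact: (transfer_integrable measurable_fst e1 i1).
exact: (transfer_Rintegral measurable_fst e1 i1).
Qed.

Lemma coupling_snd f : quad f ->
  gam.-integrable setT (EFin \o (fun p => f p.2)) /\ ex Q f = \int[gam]_p f p.2.
Proof.
move=> qf; have i1 := quad_integrable mQ qf.
have e1 A : measurable A -> gam (snd @^-1` A) = Q A by move=> mA; have [] := cg mA.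
split; first exact: (transfer_integrable measurable_snd e1 i1).
exact: (transfer_Rintegral measurable_snd e1 i1).
Qed.

Lemma coupling_lip f L : 0 <= L -> quad f -> (forall x y, `|f x - f y| <= L * `|x - y|) ->
  `|ex P f - ex Q f| <= L * e.
Proof.
move=> L0 qf Lf; have [i1 ->] := coupling_fst qf; have [i2 ->] := coupling_snd qf.
rewrite -RintegralB //.
have i3 : gam.-integrable setT (EFin \o (fun p => f p.1 - f p.2)).
  exact: (integrableB measurableT i1 i2).
apply: le_trans (le_normr_Rintegral _ i3) _ => //.
have i4 : gam.-integrable setT (EFin \o (fun p => (L / 2 / e) * D p)).
  exact: integrable_scale iD.
have i5 : gam.-integrable setT (EFin \o (fun _ : borelRd R d * borelRd R d => L * e / 2)).
  exact: finite_measure_integrable_cst.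
have i6 : gam.-integrable setT (EFin \o (fun p => (L / 2 / e) * D p + L * e / 2)).
  exact: (integrableD measurableT i4 i5).
apply: le_trans (_ : \int[gam]_p ((L / 2 / e) * D p + L * e / 2) <= _).
  apply: le_Rintegral => //.
    exact: (integrable_abse i3).
  move=> p _; apply: le_trans (Lf _ _) _.
  apply: le_trans (_ : L * enorm (p.1 - p.2 : 'cV[R]_d) <= _).
    by rewrite ler_wpM2l // norm_le_enorm.
  rewrite /D; set z := enorm _.
  (* AM-GM: z <= (z^2 / e + e) / 2 *)
  have -> : L / 2 / e * z ^+ 2 + L * e / 2 = L * (z + (z - e) ^+ 2 / (2 * e)).
    by field; rewrite gt_eqF.
  by rewrite ler_wpM2l // lerDl divr_ge0 ?sqr_ge0 // mulr_ge0 // ltW.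
rewrite RintegralD // RintegralZl //.
have -> : \int[gam]_(x in [set: borelRd R d * borelRd R d]) (L * e / 2) = L * e / 2.
  transitivity (L * e / 2 * fine (gam setT)); first exact: Rintegral_cst.
  by rewrite (_ : gam setT = 1%E) ?mulr1 //; exact: probability_setT.
apply: le_trans (_ : L / 2 / e * e ^+ 2 + L * e / 2 <= _).
  by rewrite lerD2r ler_wpM2l // !divr_ge0 // ltW.
by rewrite le_eqVlt; apply/orP; left; apply/eqP; field; rewrite gt_eqF.
Qed.

Lemma coupling_m2 : ex P (fun x => enorm x ^+ 2) <= 2 * ex Q (fun x => enorm x ^+ 2) + 2 * e ^+ 2.
Proof.
have aux (a b : R) : a ^+ 2 <= 2 * b ^+ 2 + 2 * (a - b) ^+ 2.
  rewrite -subr_ge0 (_ : _ - _ = (2 * b - a) ^+ 2) ?sqr_ge0 //; ring.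
have [i1 ->] := coupling_fst (@quad_enorm2 R d); have [i2 ->] := coupling_snd (@quad_enorm2 R d).
have i4 : gam.-integrable setT (EFin \o (fun p => 2 * D p)).
  exact: integrable_scale iD.
have i5 : gam.-integrable setT (EFin \o (fun p : borelRd R d * borelRd R d => 2 * enorm (p.2 : 'cV[R]_d) ^+ 2)).
  exact: (integrable_scale _ i2).
have i6 : gam.-integrable setT (EFin \o (fun p : borelRd R d * borelRd R d => 2 * enorm (p.2 : 'cV[R]_d) ^+ 2 + 2 * D p)).
  exact: (integrableD measurableT i5 i4).
apply: le_trans (_ : \int[gam]_p (2 * enorm (p.2 : 'cV[R]_d) ^+ 2 + 2 * D p) <= _).
  apply: le_Rintegral => // p _; rewrite /D !enormE !mulr_sumr -big_split /=.
  by apply: ler_sum => i _; rewrite !mxE; exact: aux.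
by rewrite RintegralD // !RintegralZl // lerD2l ler_wpM2l.
Qed.

End coupling.

Section curve.
Variables (T : R) (mu : R -> probability (borelRd R d) R).
Hypothesis (cmu : W2_continuous_curve T mu).

Lemma curve_local t e : 0 <= t <= T -> 0 < e ->
  \forall s \near t, 0 <= s <= T -> exists2 gam, couplings (mu s) (mu t) gam &
  (\int[gam]_p (enorm (p.1 - p.2 : 'cV[R]_d) ^+ 2)%:E <= (e ^+ 2)%:E)%E.
Proof.
move=> tT e0; have [_ /(_ t)] := cmu; rewrite in_itv /= => /(_ tT) H.
have H1 : nbhs (0%E : \bar R) [set x | (x < e%:E)%E].
  by apply: open_nbhs_nbhs; split; [exact: open_ereal_lt_ereal|rewrite /= lte_fin].
have H2 : \forall s \near t, `[0, T]%classic s -> (W2 (mu s) (mu t) < e%:E)%E := H _ H1.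
apply: filterS H2 => s Hs sT; apply: W2_lt_coupling => //; apply: Hs.
by rewrite /= in_itv.
Qed.

Lemma curve_m2 t : 0 <= t <= T -> finite_second_moment (mu t).
Proof. by move=> tT; have [H _] := cmu; apply: H; rewrite in_itv. Qed.

(** Near each time a coupling of cost at most 1 bounds the second moment through [coupling_m2];
    compactness of [0, T] makes the local bounds uniform. *)
Lemma curve_moment : exists2 S, 0 <= S & forall t, 0 <= t <= T -> ex (mu t) (fun x => enorm x ^+ 2) <= S.
Proof.
have /compact_near_coveringP H := @segment_compact R 0 T.
have := H nat \oo (fun n s => 0 <= s <= T -> ex (mu s) (fun x => enorm x ^+ 2) <= n%:R) _.
case=> [t|N _ HN].
  rewrite /= in_itv /= => tT.
  exists ([set s | 0 <= s <= T -> exists2 gam, couplings (mu s) (mu t) gam &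
      (\int[gam]_p (enorm (p.1 - p.2 : 'cV[R]_d) ^+ 2)%:E <= (1 ^+ 2)%:E)%E],
    [set n | 2 * ex (mu t) (fun x => enorm x ^+ 2) + 2 * 1 ^+ 2 <= n%:R]).
    by split => /=; [exact: curve_local tT ltr01|exact: nbhs_infty_ger].
  case=> s n [/= Hs Hn] sT; have [gam cg gle] := Hs sT.
  exact: le_trans (coupling_m2 (curve_m2 sT) (curve_m2 tT) cg gle) Hn.
exists N%:R => // t tT; by apply: (HN N) => //=.
Qed.

Lemma curve_continuous f L : 0 <= L -> quad f -> (forall x y, `|f x - f y| <= L * `|x - y|) ->
  {within `[0, T], continuous (fun t => ex (mu t) f)}.
Proof.
move=> L0 qf Lf; apply/subspace_continuousP => t /=; rewrite in_itv /= => tT.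
apply/cvgrPdist_lt => e e0.
have e0' : 0 < e / (L + 1) by rewrite divr_gt0 // ltr_wpDl.
near=> s.
have sT : 0 <= s <= T.
  have : s \in `[0, T]%R by near: s; exact: withinT.
  by rewrite in_itv.
have [gam cg gle] : exists2 gam, couplings (mu s) (mu t) gam &
  (\int[gam]_p (enorm (p.1 - p.2 : 'cV[R]_d) ^+ 2)%:E <= ((e / (L + 1)) ^+ 2)%:E)%E.
  move: sT; near: s; apply: cvg_within; exact: curve_local tT e0'.
rewrite distrC.
apply: le_lt_trans (coupling_lip (curve_m2 sT) (curve_m2 tT) e0' cg gle L0 qf Lf) _.
by rewrite mulrA ltr_pdivrMr ?ltr_wpDl // mulrC ltr_pM2l // ltrDl.
Unshelve. all: by end_near.
Qed.
End curve.
End wasserstein.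

(** * Functions with quadratically small increments *)

Section telescoping.
Context {R : realType}.

Lemma telescoping_const (D : R -> R) (a b C : R) : a <= b ->
  (forall s t, a <= s -> s <= t -> t <= b -> `|D t - D s| <= C * (t - s) ^+ 2) -> D b = D a.
Proof.
move=> ab H; apply/eqP; rewrite -subr_eq0 -normr_le0; apply/ler_addgt0Pr => e e0; rewrite add0r.
have C0 : 0 <= C * (b - a) ^+ 2 by exact: le_trans (normr_ge0 _) (H a b (lexx _) ab (lexx _)).
pose n := (Num.trunc (C * (b - a) ^+ 2 / e)).+1.
have n0 : 0 < n%:R :> R by rewrite ltr0n.
have nC : C * (b - a) ^+ 2 / n%:R <= e.
  by rewrite ler_pdivrMr // [e * _]mulrC -ler_pdivrMr // ltW // truncnS_gt.
apply: le_trans nC; pose h := (b - a) / n%:R.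
have h0 : 0 <= h by rewrite divr_ge0 // subr_ge0.
have nh : n%:R * h = b - a by rewrite mulrC divfK // gt_eqF.
pose p k := a + k%:R * h.
have pb : p n = b by rewrite /p nh addrC subrK.
have K k : (k <= n)%N -> `|D (p k) - D a| <= k%:R * (C * h ^+ 2).
  elim: k => [|k IH] kn; first by rewrite /p !mul0r addr0 subrr normr0.
  have -> : D (p k.+1) - D a = (D (p k) - D a) + (D (p k.+1) - D (p k)) by ring.
  have pk : p k.+1 - p k = h by rewrite /p -natr1; ring.
  rewrite -natr1 mulrDl mul1r; apply: le_trans (ler_normD _ _) _; apply: lerD; first exact: IH (ltnW kn).
  rewrite -[in leRHS]pk; apply: H.
  - by rewrite lerDl mulr_ge0.
  - by rewrite -subr_ge0 pk.
  - by rewrite -pb lerD2l ler_wpM2r // ler_nat.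
rewrite -[in leLHS]pb; apply: le_trans (K n (leqnn n)) _.
rewrite le_eqVlt; apply/orP; left; apply/eqP; rewrite /h; field; rewrite gt_eqF //.
Qed.

(** The mean value theorem writes [f b - f a] as [df c * (b - a)], and the Lipschitz bound on [df]
    makes the difference with the integral quadratic in [b - a]. *)
Lemma tint_FTC (T : R) (f df : R -> R) (C : R) s t : bmeas T df ->
  (forall y, is_derive y (1 : R) f (df y)) -> (forall y z, `|df y - df z| <= C * `|y - z|) ->
  0 <= s -> s <= t -> t <= T -> tint s t df = f t - f s.
Proof.
move=> bd dfd lip s0 st tT.
have C0 : 0 <= C by have := lip 1 0; rewrite subr0 normr1 mulr1; exact: le_trans (normr_ge0 _).
suff : f t - tint s t df = f s - tint s s df.
  have -> : tint s s df = 0 by rewrite /tint set_itvoc0 Rintegral_set0.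
  by rewrite subr0 => <-; ring.
apply: (@telescoping_const (fun u => f u - tint s u df) s t C st) => a b sa ab bt.
have -> : f b - tint s b df - (f a - tint s a df) = (f b - f a) - tint a b df.
  rewrite (@tint_add _ T s a b) //; [ring|exact: le_trans bt tT].
have cf : {within `[a, b], continuous f}.
  apply: continuous_subspaceT => y; apply: differentiable_continuous.
  by apply/derivable1_diffP; have d := dfd y; exact: ex_derive.
have [c] := MVT_segment ab (fun y _ => dfd y) cf; rewrite in_itv /= => /andP[ac cb] ->.
have a0 := le_trans s0 sa; have bT := le_trans bt tT.
rewrite -tint_cst // -(tintB (bmeas_cst T (df c)) bd a0 bT).
rewrite expr2 mulrA; apply: (tint_norm_le (bmeasB (bmeas_cst T (df c)) bd) a0 ab bT).
move=> r /andP[ar rb]; apply: le_trans (lip _ _) _; rewrite ler_wpM2l // ler_norml.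
by apply/andP; split; lra.
Qed.

End telescoping.

(** * Compact balls and test functions in product form *)

Section compact_sets.
Context {R : realType}.

Lemma trmx_continuous m n : continuous (fun x : 'M[R]_(m, n) => x^T).
Proof.
move=> x s /= /nbhs_ballP[e /= e0 es]; apply/nbhs_ballP; exists e => //= y [_ xy].
by apply: es; split => // i j; rewrite !mxE; exact: xy.
Qed.

Lemma normr_trmx n (x : 'rV[R]_n) : `|x^T| = `|x|.
Proof.
apply/eqP; rewrite eq_le; apply/andP; split.
  apply: cV_norm_le => // i; rewrite mxE [leRHS]/Num.norm /= mx_normrE.
  by apply: (le_bigmax_cond _ (fun ij : 'I_1 * 'I_n => `|x ij.1 ij.2|) (j := (0, i))).
rewrite [leLHS]/Num.norm /= mx_normrE; apply/bigmax_leP; split => // -[i j] _ /=.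
by rewrite (ord1 i); have := le_cV_norm x^T j; rewrite mxE.
Qed.

(** Heine-Borel for row vectors, carried over to columns by transposition. *)
Lemma closed_ball_compact d (r : R) : compact [set x : 'cV[R]_d | `|x| <= r].
Proof.
have -> : [set x : 'cV[R]_d | `|x| <= r] = (fun x => x^T) @` [set x : 'rV[R]_d | `|x| <= r].
  apply/seteqP; split => [x /= xr|_ [x /= xr <-]]; last by rewrite normr_trmx.
  by exists x^T; rewrite ?trmxK // -normr_trmx trmxK.
apply: continuous_compact; first by apply: continuous_subspaceT; exact: trmx_continuous.
apply: bounded_closed_compact.
  by exists r; split; [exact: num_real|move=> M rM x /= /le_trans; apply; exact: ltW].
have -> : [set x : 'rV[R]_d | `|x| <= r] = (fun x => `|x|) @^-1` [set y | y <= r] by [].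
apply: closed_comp; last exact: closed_le.
by move=> x _; exact: norm_continuous.
Qed.

(** The support stays in the compact set [0, t1] times a ball, and [t1 < T] keeps it away from the
    final time. *)
Lemma product_test_function d (T t1 r : R) (eta : R -> R) (g : 'cV[R]_d -> R) :
  t1 < T -> smooth (eta : R -> R) -> smooth g ->
  (forall t, t1 < t -> eta t = 0) -> (forall x, r < `|x| -> g x = 0) ->
  test_function T (fun p : R * 'cV[R]_d => eta p.1 * g p.2).
Proof.
move=> t1T se sg eta0 g0.
pose S0 := [set p : R * 'cV[R]_d | 0 <= p.1 < T /\ eta p.1 * g p.2 != 0].
have cK : compact (`[0, t1]%classic `*` [set x : 'cV[R]_d | `|x| <= r]).
  by apply: compact_setX; [exact: segment_compact|exact: closed_ball_compact].
have clK : closed (`[0, t1]%classic `*` [set x : 'cV[R]_d | `|x| <= r]).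
  by apply: compact_closed cK; exact: norm_hausdorff.
have sub : closure S0 `<=` (`[0, t1]%classic `*` [set x : 'cV[R]_d | `|x| <= r]).
  move/closure_id : clK => ->; apply: closure_subset => -[t x] /= [/andP[t0 _] ne].
  rewrite in_itv /= t0 /=; split; rewrite leNgt; apply/negP => lt; move/eqP : ne; apply.
    by rewrite eta0 // mul0r.
  by rewrite g0 // mulr0.
split.
- apply: smooth_mul; first exact: smooth_fst.
  exact: smooth_snd.
- by apply: subclosed_compact cK sub; exact: closed_closure.
- move=> p /sub [/=]; rewrite in_itv /= => /andP[-> p1 _].
  exact: le_lt_trans p1 t1T.
Qed.

Lemma derive_fst d (f : R -> R) (t : R) (x : 'cV[R]_d) (g : 'cV[R]_d -> R) (s : R) (v : 'cV[R]_d) :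
  smooth (f : R -> R) -> smooth g ->
  'D_((s, v) : R * 'cV[R]_d) (fun p => f p.1 * g p.2) (t, x) = s * 'D_1 f t * g x + f t * 'D_v g x.
Proof.
move=> sf sg.
have d1 : is_derive ((t, x) : R * 'cV[R]_d) (s, v) (fun p => f p.1) (s * 'D_1 f t).
  apply/is_derive_lineP => /=; apply/(is_derive_lineP f t s).
  rewrite -derive_R1; last exact: smooth_derivable.
  exact/derivableP/smooth_derivable.
have d2 : is_derive ((t, x) : R * 'cV[R]_d) (s, v) (fun p => g p.2) ('D_v g x).
  apply/is_derive_lineP => /=; apply/(is_derive_lineP g x v).
  exact/derivableP/smooth_derivable.
case: d1 => d1 e1; case: d2 => d2 e2.
rewrite (@deriveM _ _ (fun p : R * 'cV[R]_d => f p.1) (fun p => g p.2) _ _ d1 d2) e1 e2 /=.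
by rewrite addrC [g x *: _]mulrC.
Qed.

End compact_sets.

Lemma lip_continuous {R : realType} (E W : normedModType R) (f : E -> W) (L : R) :
  (forall x y, `|f x - f y| <= L * `|x - y|) -> continuous f.
Proof.
move=> Lf x; apply/cvgrPdist_lt => e e0; near=> y.
have L1 : 0 < `|L| + 1 by rewrite ltr_wpDl.
apply: le_lt_trans (Lf _ _) _; apply: le_lt_trans (_ : (`|L| + 1) * `|x - y| < e).
  by rewrite ler_wpM2r // (le_trans (ler_norm L)) // lerDl.
rewrite mulrC -ltr_pdivlMr //; near: y; apply: cvgr_dist_lt; last by rewrite divr_gt0.
exact: cvg_id.
Unshelve. all: by end_near.
Qed.

(** * Smooth functions of compact support *)

Section compact_support.
Context {R : realType} {d : nat}.
Implicit Types (f g : 'cV[R]_d -> R).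

Definition csupp (rho : R) f := forall x, rho < `|x| -> f x = 0.

Lemma csupp_bounded rho f : continuous f -> csupp rho f ->
  exists2 B, 0 <= B & forall x, `|f x| <= B.
Proof.
move=> cf sf; pose A := [set x : 'cV[R]_d | `|x| <= `|rho|].
have A0 : A !=set0 by exists 0; rewrite /A /= normr0.
have cN : continuous (fun x : 'cV[R]_d => `|f x|) by move=> x; exact: (cvg_norm (cf x)).
have [c _ Hc] := compact_EVT_max A0 (@closed_ball_compact R d _) (continuous_subspaceT cN).
exists `|f c| => // x; have [xA|xA] := leP `|x| `|rho|; first by apply: Hc; rewrite inE.
by rewrite sf ?normr0 // (le_lt_trans (ler_norm rho)).
Qed.

Lemma csupp_derive rho f v : csupp rho f -> csupp rho ('D_v f).
Proof.
move=> sf x rx; rewrite -(derive_cst (0 : R) x v); apply: near_eq_derive.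
have : \forall y \near x, rho < `|y|.
  have cn : (fun y : 'cV[R]_d => `|y|) y @[y --> x] --> `|x| by exact: norm_continuous.
  exact: (cvgr_gt _ cn).
by apply: filterS => y; exact: sf.
Qed.

Lemma derive_coordE g x v : smooth g -> 'D_v g x = \sum_i v i 0 * 'D_(delta_mx i 0) g x.
Proof. by move=> sg; rewrite {1}(col_sum_delta v) smooth_derive_sum. Qed.

(** Writing the direction in the basis reduces each bound to finitely many continuous functions on a
    ball; [key] serves for [f] and then for its partial derivatives. *)
Lemma csupp_C2b rho f : smooth f -> csupp rho f ->
  exists L A, [/\ 0 <= L, 0 <= A & C2b f L A].
Proof.
have key (h : 'cV[R]_d -> R) : smooth h -> csupp rho h ->
    exists2 L, 0 <= L & forall x v, `|'D_v h x| <= L * `|v|.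
  move=> sh ch; have H i := csupp_bounded (smooth_cont (smooth_derive (delta_mx i 0) sh))
    (@csupp_derive rho h (delta_mx i 0) ch).
  pose B i := s2val (cid2 (H i)).
  have B0 i : 0 <= B i := s2valP (cid2 (H i)).
  have HB i x : `|'D_(delta_mx i 0) h x| <= B i := s2valP' (cid2 (H i)) x.
  exists (\sum_i B i) => [|x v]; first exact: sumr_ge0.
  rewrite derive_coordE // mulr_suml; apply: le_trans (ler_norm_sum _ _ _) _.
  by apply: ler_sum => i _; rewrite normrM mulrC ler_pM // le_cV_norm.
move=> sf cf; have [L L0 HL] := key f sf cf.
have H i := key _ (smooth_derive (delta_mx i 0) sf) (@csupp_derive rho f (delta_mx i 0) cf).
pose B i := s2val (cid2 (H i)).
have B0 i : 0 <= B i := s2valP (cid2 (H i)).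
have HB i x v : `|'D_v ('D_(delta_mx i 0) f) x| <= B i * `|v| := s2valP' (cid2 (H i)) x v.
exists L, (\sum_i B i); split => //; first exact: sumr_ge0.
split => // x y v; rewrite !derive_coordE // -sumrB -mulrA mulr_suml.
apply: le_trans (ler_norm_sum _ _ _) _; apply: ler_sum => i _.
have [t _ e] := smooth_MVT y x (smooth_derive (delta_mx i 0) sf).
rewrite -mulrBr e normrM mulrC mulrA ler_pM // ?le_cV_norm //; exact: HB.
Qed.

Lemma norm_delta_mx (i : 'I_d) : `|delta_mx i 0 : 'cV[R]_d| <= 1.
Proof.
apply: cV_norm_le => // j; rewrite mxE; case: (_ && _) => /=; rewrite ?normr1 ?normr0 //.
Qed.

Lemma norm_quad (x : 'cV[R]_d) : `|x| <= 1 + enorm x ^+ 2.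
Proof.
have h := norm_le_enorm x; have h2 : 0 <= (enorm x - 1) ^+ 2 by exact: sqr_ge0.
have h3 := enorm_ge0 x; nra.
Qed.

Lemma norm2_enorm2 (x : 'cV[R]_d) : `|x| ^+ 2 <= enorm x ^+ 2.
Proof. by rewrite lerXn2r ?nnegrE ?enorm_ge0 // norm_le_enorm. Qed.

Lemma quad_lip f L : (forall x y, `|f x - f y| <= L * `|x - y|) -> quad f.
Proof.
move=> Lf; split; first exact: (lip_continuous Lf).
exists (`|f 0| + `|L|), `|L|; split; rewrite ?addr_ge0 // => x.
rewrite -[f x](subrK (f 0)) addrC (le_trans (ler_normD _ _)) // -addrA lerD2l.
apply: le_trans (Lf _ _) _; rewrite subr0 (_ : `|L| + _ = `|L| * (1 + enorm x ^+ 2)); last by ring.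
by apply: le_trans (_ : `|L| * `|x| <= _); [rewrite ler_wpM2r // ler_norm|rewrite ler_wpM2l // norm_quad].
Qed.
End compact_support.

(** * Weak solutions integrated in time *)

Section weak_solutions.
Context {R : realType} {d : nat}.

(** The field is bounded at the origin only, because the neural fields constructed below are
    Lipschitz but in general unbounded in space. All norms here are sup norms. *)
Definition admissible (T : R) (V : R -> 'cV[R]_d -> 'cV[R]_d) (M K : R) : Prop :=
  [/\ 0 <= M, 0 <= K, forall x i, bmeas T (fun t => V t x i 0),
      forall t, 0 <= t <= T -> forall x y, `|V t x - V t y| <= K * `|x - y|
    & forall t, 0 <= t <= T -> `|V t 0| <= M].

(** [eta] is the mesh of a partition near the ball of radius [r], and [S / r] the contribution of
    far points, paid for by a bound [S] of the second moment. *)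
Lemma small_errors (S k e : R) : 0 <= S -> 0 <= k -> 0 < e ->
  exists eta r : R, [/\ 0 < eta, eta <= 1, 0 < r & k * (eta + S / r) <= e].
Proof.
move=> S0 k0 e0; have c0 : 0 < 2 * (k + 1) by rewrite mulr_gt0 // ltr_wpDl.
have eta0 : 0 < e / (2 * (k + 1)) by rewrite divr_gt0.
have r0 : 0 < (S + 1) / (e / (2 * (k + 1))) by rewrite divr_gt0 // ltr_wpDl.
exists (Num.min 1 (e / (2 * (k + 1)))), ((S + 1) / (e / (2 * (k + 1)))); split => //.
- by rewrite lt_min ltr01.
- by rewrite ge_min lexx.
have h : S / ((S + 1) / (e / (2 * (k + 1)))) <= e / (2 * (k + 1)).
  by rewrite ler_pdivrMr // mulrC divfK ?lerDl // gt_eqF.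
apply: le_trans (_ : k * (e / (2 * (k + 1)) + e / (2 * (k + 1))) <= _).
  by rewrite ler_wpM2l // lerD // ge_min lexx orbT.
have -> : e / (2 * (k + 1)) + e / (2 * (k + 1)) = e / (k + 1) by field; lra.
rewrite mulrA ler_pdivrMr ?ltr_wpDl // mulrC ler_wpM2l ?(ltW e0) //; lra.
Qed.

Lemma lip_growth (b : 'cV[R]_d -> 'cV[R]_d) (M K : R) :
  `|b 0| <= M -> (forall x y, `|b x - b y| <= K * `|x - y|) -> forall x, `|b x| <= M + K * `|x|.
Proof.
move=> b0 bl x; rewrite -[b x](subrK (b 0)) addrC (le_trans (ler_normD _ _)) // lerD //.
by have := bl x 0; rewrite subr0.
Qed.

(** [b x] is compared with an average of the values of [b] at the nodes that carry weight at [x],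
    all of which are close to [x]. *)
Lemma smoothing_error (I : finType) (psi : I -> 'cV[R]_d -> R) (node : I -> 'cV[R]_d)
  (eta r K : R) (b : 'cV[R]_d -> 'cV[R]_d) x : 0 <= K ->
  (forall k x, 0 <= psi k x) -> (forall x, \sum_k psi k x = 1) ->
  (forall k x, psi k x != 0 -> `|x - node k| <= eta + `|x| ^+ 2 / r) ->
  (forall x y, `|b x - b y| <= K * `|x - y|) ->
  `|b x - \sum_k psi k x *: b (node k)| <= K * (eta + `|x| ^+ 2 / r).
Proof.
move=> K0 psi0 psi1 close bl.
rewrite -{1}[b x]scale1r -(psi1 x) scaler_suml -sumrB.
apply: le_trans (ler_norm_sum _ _ _) _; rewrite -[leRHS]mul1r -(psi1 x) mulr_suml.
apply: ler_sum => k _; rewrite -scalerBr normrZ (ger0_norm (psi0 _ _)).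
have [->|pk] := eqVneq (psi k x) 0; first by rewrite !mul0r.
by rewrite ler_wpM2l // (le_trans (bl _ _)) // ler_wpM2l // close.
Qed.

Section smoothed_pairing.
Variables (I : finType) (psi : I -> 'cV[R]_d -> R) (B A : R).
Hypotheses (B0 : 0 <= B) (Cpsi : forall k, C2b (psi k) B A).
Hypotheses (psi0 : forall k x, 0 <= psi k x) (psi1 : forall x, \sum_k psi k x = 1).
Variables (g : 'cV[R]_d -> R) (L A' : R).
Hypotheses (L0 : 0 <= L) (A0 : 0 <= A') (Cg : C2b g L A').

(** For a field of the form sum of psi_k c_k, the measure enters the integrated derivative of [g]
    through these finitely many numbers only, and coefficients c_k that depend on time stay outside
    the integral. *)
Definition pairing (nu : probability (borelRd R d) R) (k : I) (i : 'I_d) : R :=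
  ex nu (fun x => psi k x * 'D_(delta_mx i 0) g x).

Lemma psi_le1 k x : `|psi k x| <= 1.
Proof.
by rewrite ger0_norm // -(psi1 x) (bigD1 k) //= lerDl sumr_ge0.
Qed.

Lemma pairing_lip k i x y :
  `|psi k x * 'D_(delta_mx i 0) g x - psi k y * 'D_(delta_mx i 0) g y| <=
   (B * L + A') * `|x - y|.
Proof.
have [sg Lg Ag] := Cg.
have -> : psi k x * 'D_(delta_mx i 0) g x - psi k y * 'D_(delta_mx i 0) g y =
  (psi k x - psi k y) * 'D_(delta_mx i 0) g x + psi k y * ('D_(delta_mx i 0) g x - 'D_(delta_mx i 0) g y).
  by ring.
have nd := @norm_delta_mx R d i.
apply: le_trans (ler_normD _ _) _; rewrite [leRHS]mulrDl lerD // normrM.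
  rewrite mulrAC ler_pM //; first exact: C2b_lip (Cpsi k).
  by apply: le_trans (Lg _ _) _; rewrite ler_piMr.
rewrite -[leRHS]mul1r ler_pM ?psi_le1 //.
by apply: le_trans (Ag _ _ _) _; rewrite ler_piMr // mulr_ge0.
Qed.

Lemma pairing_quad k i : quad (fun x => psi k x * 'D_(delta_mx i 0) g x).
Proof. exact: quad_lip (pairing_lip k i). Qed.

Lemma derive_comb (c : I -> 'cV[R]_d) x :
  'D_(\sum_k psi k x *: c k) g x = \sum_k \sum_i c k i 0 * (psi k x * 'D_(delta_mx i 0) g x).
Proof.
have [sg _ _] := Cg.
elim: (index_enum I) => [|k s IH]; first by rewrite !big_nil derive0.
rewrite !big_cons smooth_deriveD // IH; congr (_ + _).
rewrite smooth_deriveZ // derive_coordE // mulr_sumr; apply: eq_bigr => i _.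
by rewrite mulrCA.
Qed.

Lemma smoothed_pairing_quad (c : I -> 'cV[R]_d) : quad (fun x => 'D_(\sum_k psi k x *: c k) g x).
Proof.
under eq_fun do rewrite derive_comb.
apply: quad_sum => k; apply: quad_sum => i; apply: quad_scale; exact: pairing_quad.
Qed.

Lemma smoothed_pairingE nu (c : I -> 'cV[R]_d) : finite_second_moment nu ->
  ex nu (fun x => 'D_(\sum_k psi k x *: c k) g x) = \sum_k \sum_i c k i 0 * pairing nu k i.
Proof.
move=> m2; under eq_fun do rewrite derive_comb.
rewrite ex_sum //; last first.
  by move=> k; apply: quad_sum => i; apply: quad_scale; exact: pairing_quad.
apply: eq_bigr => k _; rewrite ex_sum //; last first.
  by move=> i; apply: quad_scale; exact: pairing_quad.
by apply: eq_bigr => i _; rewrite exZ //; exact: pairing_quad.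
Qed.

End smoothed_pairing.

Lemma pairing_field_quad (g : 'cV[R]_d -> R) L A (b : 'cV[R]_d -> 'cV[R]_d) (M K : R) :
  0 <= L -> C2b g L A -> 0 <= M -> 0 <= K -> `|b 0| <= M ->
  (forall x y, `|b x - b y| <= K * `|x - y|) -> quad (fun x => 'D_(b x) g x).
Proof.
move=> L0 [sg Lg _] M0 K0 b0 bl; split.
  have -> : (fun x => 'D_(b x) g x) = fun x => \sum_i b x i 0 * 'D_(delta_mx i 0) g x.
    by apply/funext => x; rewrite derive_coordE.
  suff : forall i, continuous (fun x => b x i 0 * 'D_(delta_mx i 0) g x).
    move=> H; elim: (index_enum _) => [|i s IH].
      by under eq_fun do rewrite big_nil; exact: cst_continuous.
    under eq_fun do rewrite big_cons.
    by move=> x; exact: (cvgD (H i x) (IH x)).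
  move=> i.
  have bi : forall y z, `|b y i 0 - b z i 0| <= K * `|y - z|.
    by move=> y z; apply: le_trans (bl y z); have := le_cV_norm (b y - b z) i; rewrite !mxE.
  have cb := lip_continuous bi; have cD := smooth_cont (smooth_derive (delta_mx i 0) sg).
  by move=> x; exact: (cvgM (cb x) (cD x)).
exists (L * (M + K)), (L * K); split; rewrite ?mulr_ge0 ?addr_ge0 // => x.
apply: le_trans (Lg _ _) _; rewrite -mulrA -mulrDr ler_wpM2l // (le_trans (lip_growth b0 bl x)) //.
by rewrite -addrA lerD2l -[X in X + _]mulr1 -mulrDr ler_wpM2l // norm_quad.
Qed.

Section weak_equation.
Variables (T M K : R) (V : R -> 'cV[R]_d -> 'cV[R]_d) (mu0 : probability (borelRd R d) R).
Variable (nu : R -> probability (borelRd R d) R).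
Hypotheses (T0 : 0 < T) (okV : admissible T V M K) (m20 : finite_second_moment mu0).
Hypothesis (cnu : W2_continuous_curve T nu).

Lemma curve_bmeas f L : 0 <= L -> (forall x y, `|f x - f y| <= L * `|x - y|) ->
  bmeas T (fun t => ex (nu t) f).
Proof.
move=> L0 Lf; apply: bmeas_continuous; exact: (curve_continuous cnu L0 (quad_lip Lf) Lf).
Qed.

Definition flux (g : 'cV[R]_d -> R) (t : R) : R := ex (nu t) (fun x => 'D_(V t x) g x).

Lemma smoothed_flux_error (I : finType) (psi : I -> 'cV[R]_d -> R) (node : I -> 'cV[R]_d)
  (B A eta r S : R) (g : 'cV[R]_d -> R) (L A' t : R) :
  0 <= B -> (forall k, C2b (psi k) B A) ->
  (forall k x, 0 <= psi k x) -> (forall x, \sum_k psi k x = 1) ->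
  (forall k x, psi k x != 0 -> `|x - node k| <= eta + `|x| ^+ 2 / r) ->
  0 < r -> 0 <= L -> 0 <= A' -> C2b g L A' -> 0 <= t <= T ->
  ex (nu t) (fun x => enorm x ^+ 2) <= S ->
  `|flux g t - ex (nu t) (fun x => 'D_(\sum_k psi k x *: V t (node k)) g x)| <= L * K * (eta + S / r).
Proof.
move=> B0 Cpsi psi0 psi1 close r0 L0 A0 Cg tT hS; have [M0 K0 mV lV V0] := okV.
have m2 := curve_m2 cnu tT; have [sg Lg _] := Cg.
have q1 := pairing_field_quad L0 Cg M0 K0 (V0 t tT) (lV t tT).
have q2 := smoothed_pairing_quad Cpsi psi0 psi1 L0 A0 Cg (fun k => V t (node k)).
rewrite /flux -exB //.
apply: le_trans (_ : L * K * eta + L * K / r * ex (nu t) (fun x => enorm x ^+ 2) <= _).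
  apply: ex_quad_le => //.
  - by have := quad_add q1 (quad_scale (-1) q2); under eq_fun do rewrite mulN1r.
  - by rewrite !mulr_ge0 ?invr_ge0 // ltW.
  - move=> x; rewrite -smooth_deriveB //; apply: le_trans (Lg _ _) _.
    rewrite -!mulrA -mulrDr ler_wpM2l //.
    apply: le_trans (smoothing_error x K0 psi0 psi1 close (lV t tT)) _.
    rewrite -mulrDr ler_wpM2l // lerD2l [leRHS]mulrC ler_wpM2r ?invr_ge0 ?(ltW r0) //.
    exact: norm2_enorm2.
by rewrite [leRHS]mulrDr lerD2l [S / r]mulrC -!mulrA !ler_wpM2l // ?invr_ge0 ltW.
Qed.

(** Field and measure both move with time, and [V] is measurable in time at fixed points only.
    Replacing [V t] by its values at the nodes gives, up to an error uniform in [t], a finite sum of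
    products of a coordinate of [V], measurable in time, and a pairing, continuous in time. *)
Lemma flux_bmeas g rho : smooth g -> csupp rho g -> bmeas T (flux g).
Proof.
move=> sg cg; have [L [A' [L0 A0 Cg]]] := csupp_C2b sg cg.
have [M0 K0 mV lV V0] := okV; have [S S0 HS] := curve_moment cnu.
have [C C0 part] := @partition_of_unity R d.
apply: bmeas_lim => e e0.
have [eta [r [eta0 _ r0 small]]] := small_errors S0 (mulr_ge0 L0 K0) e0.
have [I [psi [node [B [A [[B0 _ Cpsi] [psi0 psi1 close _ _]]]]]]] := part eta r eta0 r0.
exists (fun t => \sum_k \sum_i V t (node k) i 0 * pairing psi g (nu t) k i).
  apply: bmeas_sum => k; apply: bmeas_sum => i; apply: bmeasM; first exact: mV.
  apply: (@curve_bmeas _ (B * L + A')); first by rewrite addr_ge0 // mulr_ge0.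
  by move=> x y; exact: (pairing_lip Cpsi psi0 psi1 L0 A0 Cg).
move=> t tT; rewrite -(smoothed_pairingE Cpsi psi0 psi1 L0 A0 Cg _ (curve_m2 cnu tT)).
apply: le_trans (smoothed_flux_error B0 Cpsi psi0 psi1 close r0 L0 A0 Cg tT (HS t tT)) _.
exact: small.
Qed.

End weak_equation.
End weak_solutions.

(** * The weak equation integrated up to a given time *)

Section step_derivative.
Context {R : realType}.

Lemma derive_step_le0 (y : R) : y <= 0 -> 'D_1 step y = 0.
Proof. by move=> y0; apply: derive_at_zero; [exact: smooth_step|exact: step_ge0|exact: step_le0]. Qed.

Lemma derive_step_ge1 (y : R) : 1 <= y -> 'D_1 step y = 0.
Proof.
move=> y1; have s1 : smooth (fun z : R => 1 - step z).
  by apply: smooth_sub; [exact: smooth_cst|exact: smooth_step].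
have := @derive_at_zero R _ (fun z : R => 1 - step z) y 1 s1.
have d0 := @smooth_derivable _ _ _ y (1 : R) (@smooth_step R).
rewrite (deriveB (derivable_cst (1 : R) y (1 : R)) d0) derive_cst sub0r => H.
apply: oppr_inj; rewrite oppr0; apply: H; last by rewrite step_ge1 ?subrr.
by move=> z; rewrite subr_ge0 step_le1.
Qed.

End step_derivative.

Section integrated_weak_equation.
Context {R : realType} {d : nat}.

Let rearrange (a b c f k : R) : a + (b - c + f) + 0 = - k -> c - k - (a + f) = b.
Proof. by lra. Qed.

Variables (T M K : R) (V : R -> 'cV[R]_d -> 'cV[R]_d) (mu0 : probability (borelRd R d) R).
Variable (nu : R -> probability (borelRd R d) R).
Hypotheses (T0 : 0 < T) (okV : admissible T V M K) (m20 : finite_second_moment mu0).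
Hypothesis (wnu : weak_solution T V mu0 nu).

Let cnu : W2_continuous_curve T nu. Proof. by case: wnu. Qed.

Lemma dotE (u v : 'cV[R]_d) : dot u v = \sum_i u i 0 * v i 0.
Proof. by rewrite /dot mxE; apply: eq_bigr => i _; rewrite mxE. Qed.

Variables (g : 'cV[R]_d -> R) (rho : R).
Hypotheses (sg : smooth g) (cg : csupp rho g).

Let F t := ex (nu t) g.
Let H := flux V nu g.

Lemma weak_product (eta : R -> R) t1 : smooth (eta : R -> R) -> t1 < T ->
  (forall t, t1 < t -> eta t = 0) ->
  tint 0 T (fun t => 'D_1 eta t * F t + eta t * H t) = - (eta 0 * ex mu0 g).
Proof.
move=> se t1T eta0.
have [L [A [L0 A0 Cg]]] := csupp_C2b sg cg.
have gl x y : `|g x - g y| <= L * `|x - y| by exact: C2b_lip Cg.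
have qg := quad_lip gl.
have [M0 K0 mV lV V0] := okV.
have bF : bmeas T F := curve_bmeas cnu L0 gl.
have bH : bmeas T H := flux_bmeas okV cnu sg cg.
have b1 : bmeas T ('D_1 eta).
  by apply: bmeas_continuous; apply: continuous_subspaceT; exact: (smooth_cont (smooth_derive (1 : R) se)).
have b2 : bmeas T eta.
  by apply: bmeas_continuous; apply: continuous_subspaceT; exact: (smooth_cont se).
have bh : bmeas T (fun t => 'D_1 eta t * F t + eta t * H t).
  exact: (bmeasD (bmeasM b1 bF) (bmeasM b2 bH)).
have [_ /(_ _ (product_test_function t1T se sg eta0 cg)) eq] := wnu.
apply: EFin_inj; rewrite -integral_tint ?(ltW T0) //.
have -> : (- (eta 0 * ex mu0 g))%:E = (- \int[mu0]_x (eta 0 * g x)%:E)%E.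
  by rewrite -exZ // EFin_ex //; exact: quad_scale.
rewrite /= in eq; rewrite -eq; apply: eq_integral => t; rewrite inE /= in_itv /= => tT.
have qV : quad (fun x => 'D_(V t x) g x) := pairing_field_quad L0 Cg M0 K0 (V0 t tT) (lV t tT).
have m2 := curve_m2 cnu tT.
have q1 := quad_scale ('D_1 eta t) qg; have q2 := quad_scale (eta t) qV.
transitivity (\int[nu t]_x ('D_1 eta t * g x + eta t * 'D_(V t x) g x)%:E)%E.
  by rewrite (EFin_ex m2 (quad_add q1 q2)) (exD m2 q1 q2) (exZ m2 _ qg) (exZ m2 _ qV).
apply: eq_integral => x _; congr EFin.
rewrite /dt (derive_fst _ _ _ _ se sg) derive0 mul1r mulr0 addr0; congr (_ + _).
rewrite dotE derive_coordE // mulr_sumr; apply: eq_bigr => i _.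
have -> : grad (fun p : R * 'cV[R]_d => eta p.1 * g p.2) t x i 0 = eta t * 'D_(delta_mx i 0) g x.
  by rewrite mxE (derive_fst _ _ _ _ se sg) mul0r mul0r add0r.
by rewrite mulrA mulrAC.
Qed.

(** The test function is [zeta] times [g], where [zeta] falls from 1 to 0 shortly before [t]. The
    derivative of [zeta] has integral -1 and is concentrated near [t], so by continuity of [F] it
    picks out [- F t]. *)
Lemma weak_integrated_pos t : 0 < t -> t <= T -> F t - ex mu0 g = tint 0 t H.
Proof.
move=> t0 tT.
have [L [A [L0 A0 Cg]]] := csupp_C2b sg cg.
have gl x y : `|g x - g y| <= L * `|x - y| by exact: C2b_lip Cg.
have qg := quad_lip gl.
have bF : bmeas T F := curve_bmeas cnu L0 gl.
have cF : {within `[0, T], continuous F} := curve_continuous cnu L0 qg gl.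
have bH : bmeas T H := flux_bmeas okV cnu sg cg.
have [C C0 [s1 s2]] := @step_bounds R.
have [_ [CH hCH]] := bH.
have CH0 : 0 <= CH by apply: le_trans (normr_ge0 _) (hCH 0 _); rewrite lexx ltW.
apply/eqP; rewrite -subr_eq0 -normr_le0; apply/ler_addgt0Pr => e e0; rewrite add0r.
(* The derivative of [zeta] is at most [2 * C / del] on an interval of length [del]; with this [w]
   the resulting error is at most [e / 2]. *)
pose w := e / (4 * (C + 1)).
have w0 : 0 < w by rewrite divr_gt0 // mulr_gt0 // addr_gt0.
have [del [del0 delt delCH delF]] : exists del, [/\ 0 < del, del <= t, del * CH <= e / 2 &
    forall r, t - del <= r -> r <= t -> `|F r - F t| <= w].
  have /subspace_continuousP/(_ t) := cF; rewrite /= in_itv /= (ltW t0) tT => /(_ isT).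
  move/cvgrPdist_le => /(_ w w0).
  rewrite near_withinE => /nbhs_ballP[r /= r0 hr].
  pose dl : R := Num.min (r / 2) (Num.min t (e / 2 / (CH + 1))).
  exists dl; split.
  - by rewrite !lt_min divr_gt0 // t0 !divr_gt0 // ltr_wpDl.
  - by rewrite !ge_min lexx !orbT.
  - apply: le_trans (_ : e / 2 / (CH + 1) * CH <= _).
      by rewrite ler_wpM2r // !ge_min lexx !orbT.
    by rewrite mulrAC ler_pdivrMr ?ltr_wpDl // ler_wpM2l ?lerDl // divr_ge0 // ltW.
  - move=> u ul ut; rewrite distrC; apply: hr.
      rewrite -ball_normE /ball_ /= ger0_norm ?subr_ge0 //.
      have : dl <= r / 2 by rewrite ge_min lexx.
      lra.
    rewrite /= in_itv /= (le_trans ut tT) andbT; apply: le_trans ul.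
    by rewrite subr_ge0 !ge_min lexx !orbT.
(* With this slope [zeta] reaches 0 at [t - del / 2], strictly before [t], so that the product is a
   test function even when [t = T]. *)
pose a := 2 / del; have a0 : 0 < a by rewrite divr_gt0.
pose zeta := fun r : R => 1 - step (a * r + - (t - del) * a).
have sz : smooth (zeta : R -> R).
  apply: smooth_sub; first exact: smooth_cst.
  apply: (@smooth_comp1 _ _ step) smooth_step.
  apply: smooth_add; last exact: smooth_cst.
  exact: smooth_mul (smooth_cst a) smooth_id.
have ae r : a * r + - (t - del) * a = a * (r - (t - del)) by ring.
have z1 r : r <= t - del -> zeta r = 1.
  move=> rl; rewrite /zeta ae step_le0 ?subr0 // mulr_ge0_le0 ?(ltW a0) // subr_le0 //.
have z0 r : t - del / 2 <= r -> zeta r = 0.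
  move=> rl; rewrite /zeta ae step_ge1 ?subrr //.
  have -> : 1 = a * (del / 2) by rewrite /a; field; rewrite gt_eqF.
  by rewrite ler_wpM2l ?(ltW a0) //; lra.
have zb r : `|zeta r - 1| <= 1.
  by rewrite /zeta addrAC subrr sub0r normrN ger0_norm ?step_ge0 // step_le1.
have dz r : is_derive r (1 : R) zeta (- a * 'D_1 step (a * r + - (t - del) * a)).
  have d1 : is_derive r (1 : R) (fun r : R => a * r + - (t - del) * a) a.
    have := is_deriveD (is_deriveZ a (is_derive_id r (1 : R))) (is_derive_cst (- (t - del) * a) r (1 : R)).
    by rewrite addr0 [_%:A]mulr1; apply.
  have d0 := derivableP (@smooth_derivable _ _ _ (a * r + - (t - del) * a) (1 : R) (@smooth_step R)).
  have d2 := @is_derive1_comp R step (fun r : R => a * r + - (t - del) * a) r _ _ d0 d1.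
  apply: (is_derive_eq (is_deriveB (is_derive_cst (1 : R) r (1 : R)) d2)).
  by move: ('D_1 step _) => D; rewrite sub0r mulNr [a * _]mulrC.
have dzE r : 'D_1 zeta r = - a * 'D_1 step (a * r + - (t - del) * a).
  by have dr := dz r; rewrite derive_val.
have tT2 : t - del / 2 < T by lra.
have td0 : 0 <= t - del by rewrite subr_ge0.
have tdt : t - del <= t by lra.
have W := weak_product sz tT2 (fun r h => z0 r (ltW h)).
rewrite z1 ?mul1r // in W.
have dz0 r : r <= t - del -> 'D_1 zeta r = 0.
  by move=> rl; rewrite dzE derive_step_le0 ?mulr0 // ae mulr_ge0_le0 ?(ltW a0) // subr_le0.
have dz1 r : t - del / 2 <= r -> 'D_1 zeta r = 0.
  move=> rl; rewrite dzE derive_step_ge1 ?mulr0 // ae.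
  have -> : 1 = a * (del / 2) by rewrite /a; field; rewrite gt_eqF.
  by rewrite ler_wpM2l ?(ltW a0) //; lra.
have bz : bmeas T zeta.
  by apply: bmeas_continuous; apply: continuous_subspaceT; exact: (smooth_cont sz).
have bdz : bmeas T ('D_1 zeta).
  by apply: bmeas_continuous; apply: continuous_subspaceT; exact: (smooth_cont (smooth_derive (1 : R) sz)).
have bh : bmeas T (fun r => 'D_1 zeta r * F r + zeta r * H r).
  exact: (bmeasD (bmeasM bdz bF) (bmeasM bz bH)).
have bk : bmeas T (fun r => 'D_1 zeta r * (F r - F t) + (zeta r - 1) * H r).
  exact: (bmeasD (bmeasM bdz (bmeasB bF (bmeas_cst T (F t)))) (bmeasM (bmeasB bz (bmeas_cst T 1)) bH)).
have T0' := ltW T0; have t0' := ltW t0.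
have e1 : tint 0 (t - del) (fun r => 'D_1 zeta r * F r + zeta r * H r) = tint 0 (t - del) H.
  by apply: tint_eq => r /andP[_ rl]; rewrite dz0 // z1 // mul0r add0r mul1r.
have e2 : tint t T (fun r => 'D_1 zeta r * F r + zeta r * H r) = 0.
  rewrite -(mul0r (T - t)) -tint_cst //; apply: tint_eq => r /andP[rl _].
  have rd : t - del / 2 <= r by lra.
  by rewrite dz1 // z0 // !mul0r addr0.
(* [F t] is subtracted from [F] and 1 from the factor [zeta] of [H]. The parts split off integrate
   to [- F t] and to the flux; what remains is small. *)
have e3 : tint (t - del) t (fun r => 'D_1 zeta r * F r + zeta r * H r) =
  tint (t - del) t (fun r => 'D_1 zeta r * (F r - F t) + (zeta r - 1) * H r) - F t + tint (t - del) t H.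
  have bFd := bmeasZ (F t) bdz.
  transitivity (tint (t - del) t (fun r => ('D_1 zeta r * (F r - F t) + (zeta r - 1) * H r +
    F t * 'D_1 zeta r) + H r)).
    by apply: tint_eq => r _; ring.
  rewrite (tintD (bmeasD bk bFd) bH td0 tT) (tintD bk bFd td0 tT) (tintZ _ bdz td0 tT).
  have dz' (y : R) : is_derive y (1 : R) zeta ('D_1 zeta y) by have dy := dz y; rewrite dzE.
  have lipz (y z : R) : `|'D_1 zeta y - 'D_1 zeta z| <= a * C * a * `|y - z|.
    rewrite !dzE -mulrBr normrM normrN (gtr0_norm a0).
    have -> : a * C * a * `|y - z| = a * (C * (a * `|y - z|)) by ring.
    rewrite ler_wpM2l ?(ltW a0) //.
    apply: le_trans (s2 _ _) _; rewrite !ae -mulrBr normrM (gtr0_norm a0).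
    by have -> : y - (t - del) - (z - (t - del)) = y - z by ring.
  have td2 : t - del / 2 <= t by lra.
  rewrite (tint_FTC bdz dz' lipz td0 tdt tT) (z1 _ (lexx _)) (z0 _ td2).
  by rewrite sub0r mulrN1.
have e4 : F t - ex mu0 g - tint 0 t H =
  tint (t - del) t (fun r => 'D_1 zeta r * (F r - F t) + (zeta r - 1) * H r).
  move: W; rewrite (tint_add bh (lexx 0) t0' tT (lexx T)) (tint_add bh (lexx 0) td0 tdt tT) e1 e2 e3.
  rewrite (tint_add bH (lexx 0) td0 tdt tT) => W.
  exact: rearrange W.
rewrite e4; apply: le_trans (_ : (a * C * w + CH) * (t - (t - del)) <= _).
  apply: (tint_norm_le bk td0 tdt tT) => r /andP[rl rt].
  apply: le_trans (ler_normD _ _) _; apply: lerD; rewrite normrM.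
    rewrite ler_pM //; last by apply: delF => //; exact: ltW.
    by rewrite dzE normrM normrN (gtr0_norm a0) ler_wpM2l ?(ltW a0).
  rewrite -[leRHS]mul1r ler_pM // hCH // (le_trans td0 (ltW rl)) (le_trans rt tT) //.
have -> : (a * C * w + CH) * (t - (t - del)) = e / 2 * (C / (C + 1)) + del * CH.
  by rewrite /a /w; field; rewrite !gt_eqF ?addr_gt0.
have : C / (C + 1) <= 1 by rewrite ler_pdivrMr ?mul1r ?lerDl ?addr_gt0.
by move=> q1; rewrite [leRHS]splitr lerD // ler_piMr // divr_ge0 // ltW.
Qed.

(** At [t = 0] there is no room for a cut-off before [t]; the identity is obtained in the limit of
    small times [u > 0]. *)
Lemma weak_integrated t : 0 <= t -> t <= T -> F t - ex mu0 g = tint 0 t H.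
Proof.
rewrite le_eqVlt => /predU1P[<- _|t0 tT]; last exact: weak_integrated_pos.
have [L [A [L0 A0 Cg]]] := csupp_C2b sg cg.
have gl x y : `|g x - g y| <= L * `|x - y| by exact: C2b_lip Cg.
have cF : {within `[0, T], continuous F} := curve_continuous cnu L0 (quad_lip gl) gl.
have bH : bmeas T H := flux_bmeas okV cnu sg cg.
have [_ [CH hCH]] := bH.
have CH0 : 0 <= CH by apply: le_trans (normr_ge0 _) (hCH 0 _); rewrite lexx ltW.
rewrite /tint set_itvoc0 Rintegral_set0.
apply/eqP; rewrite -normr_le0; apply/ler_addgt0Pr => e e0; rewrite add0r.
have /subspace_continuousP/(_ 0) := cF; rewrite /= in_itv /= lexx ltW // => /(_ isT).
move/cvgrPdist_le => /(_ (e / 2)); rewrite divr_gt0 // => /(_ isT).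
rewrite near_withinE => /nbhs_ballP[r /= r0 hr].
pose u : R := Num.min (r / 2) (Num.min T (e / 2 / (CH + 1))).
have t0 : 0 < u by rewrite !lt_min divr_gt0 // T0 !divr_gt0 // ltr_wpDl.
have tT : u <= T by rewrite !ge_min lexx !orbT.
have -> : F 0 - ex mu0 g = (F 0 - F u) + tint 0 u H.
  by rewrite -weak_integrated_pos // addrA subrK.
rewrite [leRHS]splitr; apply: le_trans (ler_normD _ _) _; apply: lerD.
  apply: hr; last by rewrite /= in_itv /= ltW.
  rewrite -ball_normE /ball_ /= sub0r normrN gtr0_norm //.
  have : u <= r / 2 by rewrite ge_min lexx.
  lra.
apply: le_trans (_ : CH * (u - 0) <= _).
  apply: (tint_norm_le bH (lexx 0) (ltW t0) tT) => s /andP[s0 su]; apply: hCH.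
  by rewrite ltW // (le_trans su).
rewrite subr0; apply: le_trans (_ : CH * (e / 2 / (CH + 1)) <= _).
  by rewrite ler_wpM2l // !ge_min lexx !orbT.
rewrite mulrA ler_pdivrMr ?ltr_wpDl // mulrC ler_wpM2l ?lerDl //.
by rewrite divr_ge0 // ltW.
Qed.

End integrated_weak_equation.

(** * Limits with a geometric rate *)

Section geometric.
Context {R : realType}.

(** The limit is quantified before [c], so that the flow, built pointwise, satisfies its estimates
    for every radius containing the starting point. With e_n = 2 c 2^-n the sequence u - e is
    nondecreasing and u + e is nonincreasing, which squeezes u. *)
Lemma geometric_cvg (u : R^nat) : exists l, forall c,
  (forall n, `|u n.+1 - u n| <= c * 2^-1 ^+ n) -> forall n, `|u n - l| <= 2 * c * 2^-1 ^+ n.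
Proof.
exists (lim (u @ \oo)) => c Hc; set e := fun n : nat => 2 * c * 2^-1 ^+ n : R.
have c0 : 0 <= c by have := Hc 0%N; rewrite expr0 mulr1; exact: le_trans (normr_ge0 _).
have e0 n : 0 <= e n by rewrite !mulr_ge0 // exprn_ge0 // invr_ge0.
have eS n : e n = e n.+1 + c * 2^-1 ^+ n by rewrite /e exprS; field.
pose v n := u n - e n; pose w n := u n + e n.
have vi : nondecreasing_seq v.
  apply/nondecreasing_seqP => n; have := Hc n; rewrite ler_norml /v (eS n) => /andP[]; lra.
have wi : nonincreasing_seq w.
  apply/nonincreasing_seqP => n; have := Hc n; rewrite ler_norml /w (eS n) => /andP[]; lra.
have vw m n : v m <= w n.
  apply: le_trans (vi _ _ (leq_maxl m n)) _; apply: le_trans (wi _ _ (leq_maxr m n)).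
  by rewrite /v /w lerD2l; have := e0 (maxn m n); lra.
have cv : cvgn v by apply: nondecreasing_is_cvgn => //; exists (w 0%N) => _ [m _ <-]; exact: vw.
have ecv : e @ \oo --> (0 : R).
  rewrite -(mulr0 (2 * c)); apply: cvgM; first exact: cvg_cst.
  by apply: cvg_expr; rewrite ger0_norm ?invr_ge0 // invf_lt1 // ltr1n.
have -> : lim (u @ \oo) = lim (v @ \oo).
  have uE : u = v \+ e by apply/funext => n; rewrite /v /= subrK.
  by rewrite {1}uE; apply: cvg_lim => //; rewrite -[X in _ --> X]addr0; apply: cvgD.
move=> n; rewrite ler_distl; apply/andP; split.
  have : lim (v @ \oo) <= w n by apply: limr_le => //; apply: nearW => m; exact: vw.
  by rewrite /w /e; lra.
have := nondecreasing_cvgn_le vi cv n; rewrite /v /e; lra.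
Qed.

Lemma le_geometric (a b c : R) : (forall n, a <= b + c * 2^-1 ^+ n) -> a <= b.
Proof.
move=> H; have ecv : (fun n => b + c * 2^-1 ^+ n) @ \oo --> b.
  rewrite -[X in _ --> X]addr0 -[X in _ + X](mulr0 c); apply: cvgD; first exact: cvg_cst.
  apply: cvgM; first exact: cvg_cst.
  by apply: cvg_expr; rewrite ger0_norm ?invr_ge0 // invf_lt1 // ltr1n.
rewrite -(cvg_lim _ ecv) //; apply: limr_ge; first by apply/cvg_ex; exists b.
exact: nearW.
Qed.

End geometric.

(** * Discrete Groenwall inequalities *)

Section gronwall.
Context {R : realType}.

Lemma discrete_gronwall (e : nat -> R) (a b : R) N : 0 <= a -> 0 <= b -> 0 <= e 0%N ->
  (forall k, (k < N)%N -> e k.+1 <= (1 + a) * e k + b) ->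
  forall k, (k <= N)%N -> e k <= (e 0%N + k%:R * b) * expR (a * k%:R).
Proof.
move=> a0 b0 e0 H; suff G k : (k <= N)%N -> e k <= (e 0%N + k%:R * b) * (1 + a) ^+ k.
  move=> k kN; apply: le_trans (G k kN) _; rewrite ler_wpM2l ?addr_ge0 ?mulr_ge0 //.
  by rewrite mulrC expRM_natl lerXn2r ?nnegrE ?addr_ge0 ?expR_ge0 // expR_ge1Dx.
elim: k => [|k IH] kN; first by rewrite mul0r addr0 expr0 mulr1.
apply: le_trans (H k kN) _.
have a1 : 1 <= (1 + a) ^+ k.+1 by rewrite exprn_ege1 // lerDl.
apply: le_trans (_ : (1 + a) * ((e 0%N + k%:R * b) * (1 + a) ^+ k) + b * (1 + a) ^+ k.+1 <= _).
  apply: lerD; first by rewrite ler_wpM2l ?addr_ge0 // IH // ltnW.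
  by rewrite ler_peMr.
by rewrite exprS -natr1 le_eqVlt; apply/orP; left; apply/eqP; ring.
Qed.

(** Both sequences nearly solve the recurrence p' = p + B p, with defects [e1] and [e2]; their
    distance is multiplied by at most 1 + a per step, and the defects are added. *)
Lemma gronwall_compare (W : normedModType R) (B : nat -> W -> W) (p q : nat -> W) N (a e1 e2 : R) :
  0 <= a -> 0 <= e1 -> 0 <= e2 ->
  (forall k, (k < N)%N -> `|B k (p k) - B k (q k)| <= a * `|p k - q k|) ->
  (forall k, (k < N)%N -> `|p k.+1 - p k - B k (p k)| <= e1) ->
  (forall k, (k < N)%N -> `|q k.+1 - q k - B k (q k)| <= e2) ->
  forall k, (k <= N)%N ->
    `|p k - q k| <= (`|p 0%N - q 0%N| + k%:R * (e1 + e2)) * expR (a * k%:R).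
Proof.
move=> a0 e10 e20 Bl pe qe; apply: discrete_gronwall => //; first by rewrite addr_ge0.
move=> k kN.
have -> : p k.+1 - q k.+1 = ((p k - q k) + (B k (p k) - B k (q k))) +
   ((p k.+1 - p k - B k (p k)) - (q k.+1 - q k - B k (q k))).
  move: (p k.+1) (q k.+1) (p k) (q k) (B k (p k)) (B k (q k)) => P Q x y u v.
  rewrite -[in LHS](subrK x P) -[in LHS](subrK u (P - x)) -[in LHS](subrK y Q) -[in LHS](subrK v (Q - y)).
  move: (P - x - u) (Q - y - v) => a' b'.
  by rewrite opprD addrACA opprD [a' + u + _]addrACA -addrA [(u - v) + _]addrC [RHS]addrC.
apply: le_trans (ler_normD _ _) _; apply: lerD.
  by rewrite (le_trans (ler_normD _ _)) // mulrDl mul1r lerD2l Bl.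
by rewrite (le_trans (ler_normB _ _)) // lerD ?pe ?qe.
Qed.

End gronwall.

(** * Flows of Lipschitz fields that are measurable in time *)

Section flow.
Context {R : realType} {d : nat}.
Variables (T M K : R) (A : R -> R -> 'cV[R]_d -> 'cV[R]_d).
Hypotheses (T0 : 0 < T) (M0 : 0 <= M) (K0 : 0 <= K).
Hypothesis A_add : forall s u t x, 0 <= s -> s <= u -> u <= t -> t <= T -> A s t x = A s u x + A u t x.
Hypothesis A_lip : forall s t x y, 0 <= s -> s <= t -> t <= T ->
  `|A s t x - A s t y| <= K * (t - s) * `|x - y|.
Hypothesis A_bound : forall s t x, 0 <= s -> s <= t -> t <= T -> `|A s t x| <= (t - s) * (M + K * `|x|).

(** [A s t] stands for the field integrated over [s, t], so a step freezes the position but not the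
    time; this suits fields that are only measurable in time. *)
Fixpoint euler (h : R) (k : nat) (x : 'cV[R]_d) : 'cV[R]_d :=
  if k is j.+1 then euler h j x + A (j%:R * h) (j.+1%:R * h) (euler h j x) else x.

Let E := expR (K * T).
(** The Groenwall radius of the trajectories that start in the ball of radius [r]; [spd r] bounds
    the field there. *)
Let rad (r : R) := (r + M * T) * E.
Let spd (r : R) := M + K * rad r.

Let spd_ge0 r x : `|x : 'cV[R]_d| <= r -> 0 <= spd r.
Proof.
move=> xr; have r0 := le_trans (normr_ge0 _) xr.
by rewrite addr_ge0 // mulr_ge0 // mulr_ge0 ?expR_ge0 // addr_ge0 // mulr_ge0 // ltW.
Qed.

(** Transfers the local estimate from grid times [k], [l] to arbitrary times [s], [t]: [u] and [v]
    are Euler points within [c] of the limit points [x] and [y], and [e] is the mesh. Every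
    additional term carries a factor [c] or [e] and disappears in the limit. *)
Lemma interpolate r k l s t e c (x y u v : 'cV[R]_d) : 0 <= k -> k <= s -> k <= l -> l <= t ->
  s < k + e -> t < l + e -> s <= t -> t <= T -> e <= T -> 0 <= spd r -> `|u| <= rad r ->
  `|u - x| <= c -> `|v - y| <= c -> `|v - u - A k l u| <= K * spd r * (l - k) ^+ 2 ->
  `|y - x - A s t x| <= K * spd r * (t - s) ^+ 2 +
     (c + c + K * (t - s) * c + 2 * spd r * e + K * spd r * (3 * T * e)).
Proof.
move=> k0 ks kl lt sk tl st tT eT S0 ur ux vy loc.
have s0 := le_trans k0 ks; have l0 := le_trans k0 kl.
have step_bound a b : 0 <= a -> a <= b -> b <= T -> `|A a b u| <= (b - a) * spd r.
  move=> a0 ab bT; apply: le_trans (A_bound _ a0 ab bT) _.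
  by rewrite ler_wpM2l ?subr_ge0 // lerD2l ler_wpM2l.
have AE : A k l u - A s t u = A k s u - A l t u.
  have := A_add u k0 ks st tT; rewrite (A_add u k0 kl lt tT) => h.
  by rewrite -[A k l u](addrK (A l t u)) h addrAC addrK.
have -> : y - x - A s t x = (v - u - A k l u) - (v - y) + (u - x) + (A k s u - A l t u) + (A s t u - A s t x).
  by rewrite -AE; apply/matrixP => i j; rewrite !mxE; ring.
apply: le_trans (ler_normD _ _) _.
apply: le_trans (lerD (ler_normD _ _) (lexx _)) _.
apply: le_trans (lerD (lerD (ler_normD _ _) (lexx _)) (lexx _)) _.
apply: le_trans (lerD (lerD (lerD (ler_normB _ _) (lexx _)) (lexx _)) (lexx _)) _.
have h1 : `|A k s u - A l t u| <= 2 * spd r * e.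
  apply: le_trans (ler_normB _ _) _.
  apply: le_trans (lerD (step_bound _ _ k0 ks (le_trans st tT)) (step_bound _ _ l0 lt tT)) _.
  rewrite -mulrDl -mulrA mulrC [leRHS]mulrCA ler_wpM2l //; move: sk tl; lra.
have h2 : `|A s t u - A s t x| <= K * (t - s) * c.
  by apply: le_trans (A_lip _ _ s0 st tT) _; rewrite ler_wpM2l // mulr_ge0 // subr_ge0.
have h3 : K * spd r * (l - k) ^+ 2 <= K * spd r * (t - s) ^+ 2 + K * spd r * (3 * T * e).
  rewrite -mulrDr ler_wpM2l ?mulr_ge0 //.
  apply: le_trans (_ : (t - s + e) ^+ 2 <= _).
    rewrite lerXn2r // ?nnegrE; move: sk tl st kl lt; lra.
  have e0 : 0 <= e by move: sk ks; lra.
  have : (t - s) * e <= T * e by rewrite ler_wpM2r //; move: s0 tT; lra.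
  have : e * e <= T * e by rewrite ler_wpM2r.
  have -> : (t - s + e) ^+ 2 = (t - s) ^+ 2 + 2 * ((t - s) * e) + e * e by ring.
  have -> : 3 * T * e = 3 * (T * e) by ring.
  by move=> w1 w2; move: w1 w2; move: ((t - s) ^+ 2) ((t - s) * e) (e * e) (T * e) => p q w z; lra.
by move: h1 h2 (le_trans loc h3) ux vy; lra.
Qed.

Section grid.
Variables (h : R) (N : nat).
Hypotheses (h0 : 0 <= h) (Nh : N%:R * h <= T).

Let grid0 k : 0 <= k%:R * h. Proof. by rewrite mulr_ge0. Qed.
Let gridS (k : nat) : k%:R * h <= k.+1%:R * h. Proof. by rewrite ler_wpM2r // ler_nat. Qed.
Let gridT k : (k <= N)%N -> k%:R * h <= T.
Proof. by move=> kN; apply: le_trans Nh; rewrite ler_wpM2r // ler_nat. Qed.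
Let gridB (k : nat) : k.+1%:R * h - k%:R * h = h. Proof. by rewrite -natr1; ring. Qed.
Let expE k : (k <= N)%N -> expR (K * h * k%:R) <= E.
Proof. by move=> kN; rewrite ler_expR -mulrA ler_wpM2l // mulrC gridT. Qed.

Lemma euler_bound r k x : (k <= N)%N -> `|x| <= r -> `|euler h k x| <= rad r.
Proof.
move=> kN xr.
have := @discrete_gronwall R (fun k => `|euler h k x|) (K * h) (M * h) N.
move=> /(_ (mulr_ge0 K0 h0) (mulr_ge0 M0 h0) (normr_ge0 _)) H.
have {}H := H _ k kN; apply: le_trans (H _) _.
  move=> j jN /=; apply: le_trans (ler_normD _ _) _.
  apply: le_trans (_ : `|euler h j x| + (h * (M + K * `|euler h j x|)) <= _).
    by rewrite lerD2l; have := A_bound (euler h j x) (grid0 j) (gridS j) (gridT jN); rewrite gridB.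
  by rewrite le_eqVlt; apply/orP; left; apply/eqP; ring.
rewrite /rad ler_pM ?expR_ge0 ?expE //; first by rewrite addr_ge0 // !mulr_ge0.
by rewrite /= lerD // mulrCA ler_wpM2l // gridT.
Qed.

Lemma euler_speed r j i x : (j + i <= N)%N -> `|x| <= r ->
  `|euler h (j + i) x - euler h j x| <= spd r * (i%:R * h).
Proof.
move=> + xr; elim: i => [|i IH] jiN; first by rewrite addn0 subrr normr0 mul0r mulr0.
rewrite addnS in jiN *; rewrite /= addrAC (le_trans (ler_normD _ _)) //.
have -> : spd r * (i.+1%:R * h) = spd r * (i%:R * h) + spd r * h by rewrite -natr1; ring.
rewrite lerD ?IH ?(ltnW jiN) //; apply: le_trans (A_bound _ _ _ _) _ => //; first exact: gridT.
rewrite gridB mulrC ler_wpM2r // lerD2l ler_wpM2l //; apply: euler_bound xr; exact: ltnW.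
Qed.

(** Each new step evaluates the field at a point displaced by at most [spd r] times the elapsed
    time; the displacements sum to a quadratic, by (i+1)^2 = i^2 + i + (i+1), with a constant that
    does not involve the mesh. *)
Lemma euler_local r j i x : (j + i <= N)%N -> `|x| <= r ->
  `|euler h (j + i) x - euler h j x - A (j%:R * h) ((j + i)%:R * h) (euler h j x)| <=
  K * spd r * (i%:R * h) ^+ 2.
Proof.
move=> + xr; have S0 := spd_ge0 xr.
elim: i => [|i IH] jiN.
  have Ajj : A (j%:R * h) (j%:R * h) (euler h j x) = 0.
    apply/eqP; rewrite -normr_le0; apply: le_trans (A_bound _ _ _ _) _ => //; last by rewrite subrr mul0r.
    by apply: gridT; rewrite addn0 in jiN.
  by rewrite addn0 subrr Ajj subrr normr0 mul0r expr0n mulr0.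
rewrite addnS in jiN *.
have ji := ltnW jiN.
have jle : j%:R * h <= (j + i)%:R * h by rewrite ler_wpM2r // ler_nat leq_addr.
rewrite (A_add _ (grid0 j) jle (gridS _) (gridT jiN)) /=.
set y := euler h (j + i) x; set z := euler h j x.
set a := A (j%:R * h) _ z; set b := A _ _ y; set c := A _ _ z.
have -> : y + b - z - (a + c) = (y - z - a) + (b - c).
  by rewrite opprD !addrA; congr (_ - _); rewrite -!addrA; congr (_ + _); rewrite addrC -addrA [- a + b]addrC.
apply: le_trans (ler_normD _ _) _.
apply: le_trans (_ : K * spd r * (i%:R * h) ^+ 2 + K * h * (spd r * (i%:R * h)) <= _).
  apply: lerD; first exact: IH ji.
  apply: le_trans (A_lip _ _ _ _ _) _ => //; first exact: gridT.
  by rewrite gridB ler_wpM2l ?mulr_ge0 // euler_speed.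
have -> : K * spd r * (i%:R * h) ^+ 2 + K * h * (spd r * (i%:R * h)) =
   K * spd r * (h ^+ 2 * (i%:R ^+ 2 + i%:R)) by ring.
have -> : K * spd r * (i.+1%:R * h) ^+ 2 = K * spd r * (h ^+ 2 * (i%:R ^+ 2 + i%:R + i.+1%:R)).
  by rewrite -natr1; ring.
by rewrite ler_wpM2l ?mulr_ge0 // ler_wpM2l ?sqr_ge0 // lerDl.
Qed.

Lemma euler_lip k x y : (k <= N)%N -> `|euler h k x - euler h k y| <= E * `|x - y|.
Proof.
move=> kN; have := @gronwall_compare R _ (fun j => A (j%:R * h) (j.+1%:R * h))
  (fun k => euler h k x) (fun k => euler h k y) N (K * h) 0 0 (mulr_ge0 K0 h0) (lexx 0) (lexx 0).
have z (u v : 'cV[R]_d) : `|u + v - u - v| <= 0 by rewrite -addrA -opprD subrr normr0.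
move=> /(_ _ (fun _ _ => z _ _) (fun _ _ => z _ _)) H.
apply: le_trans (H _ k kN) _.
  by move=> j jN; have := A_lip (euler h j x) (euler h j y) (grid0 j) (gridS j) (gridT jN); rewrite gridB.
by rewrite addr0 mulr0 addr0 mulrC ler_wpM2r // expE.
Qed.

End grid.

(** Dyadic meshes: each grid contains the previous one, so consecutive approximations can be
    compared at common nodes. In this section the name hides the smooth step function. *)
Let step (n : nat) := T * 2^-1 ^+ n.
Let index (n : nat) (t : R) := Num.trunc (t / step n).
Let approx n t x := euler (step n) (index n t) x.

Let step0 n : 0 < step n. Proof. by rewrite mulr_gt0 // exprn_gt0 // invr_gt0. Qed.
Let stepN n : (2 ^ n)%:R * step n = T.
Proof. by rewrite /step mulrCA natrX -exprMn divff ?expr1n ?mulr1. Qed.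
Let stepS n : step n = step n.+1 + step n.+1.
Proof. by rewrite /step exprS; field. Qed.
Let step_le n : step n <= T.
Proof. by rewrite /step ler_piMr ?(ltW T0) // exprn_ile1 // ?invr_ge0 // invf_le1 // ler1n. Qed.

Let index_itv n t : 0 <= t -> (index n t)%:R * step n <= t < (index n t).+1%:R * step n.
Proof.
move=> t0; have := Num.Theory.truncn_itv (divr_ge0 t0 (ltW (step0 n))).
by rewrite -/(index n t) ler_pdivlMr // ltr_pdivrMr.
Qed.
Let index_le n t : 0 <= t <= T -> (index n t <= 2 ^ n)%N.
Proof.
case/andP=> t0 tT; rewrite -(@ler_nat R) -(ler_pM2r (step0 n)) stepN.
by have /andP[h _] := index_itv n t0; exact: le_trans h tT.
Qed.

Let rate (r : R) := (T * K * E + 1) * (spd r * T).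

(** By [euler_local] two fine steps differ from one coarse step by a multiple of the squared mesh,
    hence all the steps by a multiple of the mesh, after Groenwall. At time [t] the fine grid may be
    one node ahead, which costs one more mesh length. *)
Let approx_cauchy n t x r : 0 <= t <= T -> `|x| <= r ->
  `|approx n.+1 t x - approx n t x| <= rate r * 2^-1 ^+ n.
Proof.
move=> tT xr; have S0 := spd_ge0 xr.
have h0 m := ltW (step0 m).
have hT m : (2 ^ m)%:R * step m <= T by rewrite stepN.
have kN := index_le n tT; set k := index n t in kN *.
have kT : k%:R * step n <= T.
  by apply: le_trans (hT n); apply: ler_wpM2r => //; rewrite ler_nat.
have double (j : nat) : j.*2%:R * step n.+1 = j%:R * step n.
  by rewrite (stepS n) -addnn natrD mulrDl mulrDr.
have le2 j : (j <= 2 ^ n)%N -> (j.*2 <= 2 ^ n.+1)%N by rewrite expnS mul2n leq_double.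
have cmp : `|euler (step n.+1) k.*2 x - euler (step n) k x| <= T * K * E * (spd r * T) * 2^-1 ^+ n.
  have := @gronwall_compare R _ (fun j => A (j%:R * step n) (j.+1%:R * step n))
    (fun j => euler (step n.+1) j.*2 x) (fun j => euler (step n) j x) (2 ^ n)
    (K * step n) (K * spd r * (step n ^+ 2)) 0 (mulr_ge0 K0 (h0 _)).
  have z (u v : 'cV[R]_d) : `|u + v - u - v| <= 0 by rewrite -addrA -opprD subrr normr0.
  move=> /(_ _ (lexx 0) _ _ (fun _ _ => z _ _) k kN) H.
  apply: le_trans (H _ _ _) _.
  - by rewrite mulr_ge0 ?sqr_ge0 // mulr_ge0.
  - move=> j jN.
    have e : j.+1%:R * step n - j%:R * step n = step n by rewrite -natr1; ring.
    have -> : K * step n = K * (j.+1%:R * step n - j%:R * step n) by rewrite e.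
    have jT : j.+1%:R * step n <= T.
      by apply: le_trans (hT n); apply: ler_wpM2r => //; rewrite ler_nat.
    by apply: A_lip => //; [exact: mulr_ge0 | apply: ler_wpM2r => //; rewrite ler_nat].
  - move=> j jN; have := @euler_local (step n.+1) (2 ^ n.+1) (h0 _) (hT _) r j.*2 2 x.
    rewrite addn2 -doubleS => /(_ (le2 _ jN) xr).
    rewrite !double; have -> // : 2%:R * step n.+1 = step n by rewrite (stepS n); ring.
  rewrite subrr normr0 add0r addr0.
  have -> : T * K * E * (spd r * T) * 2^-1 ^+ n = (T * (K * spd r * step n)) * E by rewrite /step; ring.
  have E1 : expR (K * step n * k%:R) <= E.
    by rewrite ler_expR -mulrA ler_wpM2l // mulrC kT.
  rewrite ler_pM ?expR_ge0 //; first by rewrite mulr_ge0 // mulr_ge0 ?sqr_ge0 // mulr_ge0.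
  have -> : k%:R * (K * spd r * step n ^+ 2) = (k%:R * step n) * (K * spd r * step n) by ring.
  by apply: ler_wpM2r kT; exact: mulr_ge0 (mulr_ge0 K0 S0) (h0 n).
have [t0 _] := andP tT.
have [i [i1 iE]] : exists i, (i <= 1)%N /\ index n.+1 t = (k.*2 + i)%N.
  have /andP[l1 l2] := index_itv n t0; have /andP[m1 m2] := index_itv n.+1 t0.
  have : (k.*2 < (index n.+1 t).+1)%N.
    by rewrite -(@ltr_nat R) -(ltr_pM2r (step0 n.+1)) double; exact: le_lt_trans m2.
  have : (index n.+1 t < k.+1.*2)%N.
    by rewrite -(@ltr_nat R) -(ltr_pM2r (step0 n.+1)) double; exact: le_lt_trans l2.
  rewrite doubleS => a b; exists (index n.+1 t - k.*2)%N.
  by rewrite leq_subLR addn1 subnKC.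
have := @euler_speed (step n.+1) (2 ^ n.+1) (h0 _) (hT _) r k.*2 i x.
rewrite -iE => /(_ (index_le _ tT) xr) sp.
rewrite -(subrK (euler (step n.+1) k.*2 x) (approx n.+1 t x)) -addrA.
apply: le_trans (ler_normD _ _) _; rewrite /rate 2!mulrDl mul1r [leRHS]addrC; apply: lerD cmp.
apply: le_trans sp _; rewrite -mulrA ler_wpM2l // -/(step n) (stepS n).
apply: le_trans (_ : 1 * step n.+1 <= _); last by rewrite mul1r lerDl.
by apply: ler_wpM2r => //; rewrite (ler_nat _ i 1).
Qed.

Theorem additive_flow_exists : exists X : R -> 'cV[R]_d -> 'cV[R]_d, [/\
  forall x, X 0 x = x,
  forall t x y, 0 <= t <= T -> `|X t x - X t y| <= E * `|x - y|,
  forall t x r, 0 <= t <= T -> `|x| <= r -> `|X t x| <= rad r &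
  forall s t x r, 0 <= s -> s <= t -> t <= T -> `|x| <= r ->
    `|X t x - X s x - A s t (X s x)| <= K * spd r * (t - s) ^+ 2].
Proof.
have ex t x : exists y : 'cV[R]_d, forall r, 0 <= t <= T -> `|x : 'cV[R]_d| <= r ->
    forall n, `|approx n t x - y| <= 2 * rate r * 2^-1 ^+ n.
  have /choice[l Hl] i := geometric_cvg (fun n => approx n t x i 0).
  exists (\col_i l i) => r tT xr n; have S0 := spd_ge0 xr.
  have R0 : 0 <= rate r.
    exact: mulr_ge0 (addr_ge0 (mulr_ge0 (mulr_ge0 (ltW T0) K0) (expR_ge0 _)) ler01) (mulr_ge0 S0 (ltW T0)).
  apply: cV_norm_le; first by apply: mulr_ge0 (mulr_ge0 (ler0n _ 2) R0) _; rewrite exprn_ge0 // invr_ge0.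
  move=> i; rewrite !mxE; apply: Hl => m; apply: le_trans (approx_cauchy m tT xr).
  by have := le_cV_norm (approx m.+1 t x - approx m t x) i; rewrite !mxE.
have [X' HX'] := choice (fun p : R * 'cV[R]_d => ex p.1 p.2).
pose X t x := X' (t, x); exists X.
have HX t x r : 0 <= t <= T -> `|x| <= r -> forall n, `|approx n t x - X t x| <= 2 * rate r * 2^-1 ^+ n.
  exact: (HX' (t, x)).
have h0 m := ltW (step0 m).
have hT m : (2 ^ m)%:R * step m <= T by rewrite stepN.
have Xbound t x r : 0 <= t <= T -> `|x| <= r -> `|X t x| <= rad r.
  move=> tT xr; apply: (@le_geometric _ _ _ (2 * rate r)) => n.
  rewrite -(subrK (approx n t x) (X t x)) (le_trans (ler_normD _ _)) // addrC lerD //.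
    exact: euler_bound (hT n) _ _ _ (index_le n tT) xr.
  by rewrite distrC HX.
split=> //.
- move=> x; apply/esym/eqP; rewrite -subr_eq0 -normr_le0.
  apply: (@le_geometric _ _ _ (2 * rate `|x|)) => n; rewrite add0r.
  have := HX 0 x `|x| _ (lexx _) n; rewrite lexx (ltW T0) => /(_ isT).
  by rewrite /approx /index mul0r truncn0.
- move=> t x y tT; set r := Num.max `|x| `|y|.
  have xr : `|x| <= r by rewrite le_max lexx.
  have yr : `|y| <= r by rewrite le_max lexx orbT.
  apply: (@le_geometric _ _ _ (2 * rate r + 2 * rate r)) => n.
  rewrite mulrDl; have := euler_lip (h0 n) (hT n) x y (index_le n tT).
  have := HX t x r tT xr n; have := HX t y r tT yr n; rewrite -/(approx n t x) -/(approx n t y).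
  move: (approx n t x) (approx n t y) => a b h1 h2 h3.
  have -> : X t x - X t y = (a - b) - ((a - X t x) - (b - X t y)).
    by apply/matrixP => i j; rewrite !mxE; ring.
  apply: le_trans (ler_normB _ _) _; apply: lerD => //.
  exact: le_trans (ler_normB _ _) (lerD h2 h1).
- move=> s t x r s0 st tT xr; have S0 := spd_ge0 xr.
  have t0 := le_trans s0 st; have sT := le_trans st tT.
  have tI : 0 <= t <= T by rewrite t0.
  have sI : 0 <= s <= T by rewrite s0.
  pose c := 2 * rate r.
  apply: (@le_geometric _ _ _ (c + c + K * (t - s) * c + 2 * spd r * T + K * spd r * (3 * T ^+ 2))) => n.
  have := HX t x r tI xr n; have := HX s x r sI xr n; rewrite -/c.
  have := euler_bound (h0 n) (hT n) (index_le n sI) xr.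
  have := @euler_local (step n) (2 ^ n) (h0 n) (hT n) r (index n s) (index n t - index n s) x.
  have kl : (index n s <= index n t)%N.
    by rewrite /index; apply: le_truncn; rewrite ler_wpM2r // invr_ge0.
  rewrite subnKC // => /(_ (index_le n tI) xr).
  rewrite -/(approx n t x) -/(approx n s x).
  have /andP[k1 k2] := index_itv n s0; have /andP[l1 l2] := index_itv n t0.
  have klh : (index n s)%:R * step n <= (index n t)%:R * step n by rewrite ler_wpM2r // ler_nat.
  rewrite -natr1 mulrDl mul1r in k2; rewrite -natr1 mulrDl mul1r in l2.
  rewrite natrB // mulrBl.
  have k0 : 0 <= (index n s)%:R * step n by rewrite mulr_ge0.
  move=> loc bnd bX aX.
  have -> : (c + c + K * (t - s) * c + 2 * spd r * T + K * spd r * (3 * T ^+ 2)) * 2^-1 ^+ n =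
    c * 2^-1 ^+ n + c * 2^-1 ^+ n + K * (t - s) * (c * 2^-1 ^+ n) + 2 * spd r * step n +
    K * spd r * (3 * T * step n) by rewrite /step; ring.
  exact: interpolate k0 k1 klh l1 k2 l2 st tT (step_le n) S0 bnd bX aX loc.
Qed.

End flow.

(** * Time integrals of the field *)

Section increments.
Context {R : realType} {d : nat}.
Variables (T M K : R) (V : R -> 'cV[R]_d -> 'cV[R]_d).
Hypothesis okV : admissible T V M K.

Definition incr (V : R -> 'cV[R]_d -> 'cV[R]_d) (s t : R) (x : 'cV[R]_d) : 'cV[R]_d :=
  \col_i tint s t (fun r => V r x i 0).

Lemma incr_add s u t x : 0 <= s -> s <= u -> u <= t -> t <= T ->
  incr V s t x = incr V s u x + incr V u t x.
Proof.
have [_ _ mV _ _] := okV => s0 su ut tT; apply/matrixP => i j; rewrite !mxE.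
exact: tint_add (mV x i) s0 su ut tT.
Qed.

Lemma incr_lip s t x y : 0 <= s -> s <= t -> t <= T ->
  `|incr V s t x - incr V s t y| <= K * (t - s) * `|x - y|.
Proof.
have [_ K0 mV lV _] := okV => s0 st tT.
have ts : 0 <= t - s by rewrite subr_ge0.
apply: cV_norm_le => [|i]; first exact: mulr_ge0 (mulr_ge0 K0 ts) _.
rewrite !mxE -(tintB (mV x i) (mV y i) s0 tT) mulrAC.
apply: (tint_norm_le (bmeasB (mV x i) (mV y i)) s0 st tT) => r /andP[sr rt].
have rT : 0 <= r <= T by rewrite (le_trans s0 (ltW sr)) (le_trans rt tT).
apply: le_trans (lV r rT x y).
by have := le_cV_norm (V r x - V r y) i; rewrite !mxE.
Qed.

Lemma incr_bound s t x : 0 <= s -> s <= t -> t <= T -> `|incr V s t x| <= (t - s) * (M + K * `|x|).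
Proof.
have [M0 K0 mV lV V0] := okV => s0 st tT.
have ts : 0 <= t - s by rewrite subr_ge0.
apply: cV_norm_le => [|i]; first by rewrite mulr_ge0 // addr_ge0 // mulr_ge0.
rewrite mxE mulrC; apply: (tint_norm_le (mV x i) s0 st tT) => r /andP[sr rt].
have rT : 0 <= r <= T by rewrite (le_trans s0 (ltW sr)) (le_trans rt tT).
by apply: le_trans (le_cV_norm _ _) _; apply: (lip_growth (V0 r rT)); exact: lV.
Qed.

End increments.

Section derivative_of_lipschitz.
Context {R : realType}.

Lemma lip_derive_le (E : normedModType R) (q : E -> R) (c : R) x v : derivable q x v ->
  (forall x y, `|q x - q y| <= c * `|x - y|) -> `|'D_v q x| <= c * `|v|.
Proof.
move=> dq lq; have cv : `|h^-1 *: (q (h *: v + x) - q x)| @[h --> (0 : R)^'] --> `|'D_v q x|.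
  by apply: cvg_norm; exact: dq.
rewrite -(cvg_lim _ cv) //; apply: limr_le; first by apply/cvg_ex; eexists; exact: cv.
near=> h; have h0 : h != 0 by near: h; exact: nbhs_dnbhs_neq.
rewrite normrZ normfV -(ler_pM2l (_ : 0 < `|h|)) ?normr_gt0 // mulrA divff ?normr_eq0 // mul1r.
by apply: le_trans (lq _ _) _; rewrite addrK normrZ mulrCA.
Unshelve. all: by end_near. Qed.

Lemma derive_cmul (E : normedModType R) (f : E -> R) (c : R) x v : derivable f x v ->
  'D_v (fun y => c * f y) x = c * 'D_v f x.
Proof. by move=> df; exact: (deriveZ c df). Qed.

End derivative_of_lipschitz.

(** * Uniqueness of weak solutions *)

Section one_step.
Context {R : realType} {d : nat}.
Variables (T M K S : R) (V : R -> 'cV[R]_d -> 'cV[R]_d) (mu0 : probability (borelRd R d) R).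
Variable (nu : R -> probability (borelRd R d) R).
Hypotheses (T0 : 0 < T) (okV : admissible T V M K) (m20 : finite_second_moment mu0).
Hypothesis (wnu : weak_solution T V mu0 nu).
Hypothesis (S0 : 0 <= S) (HS : forall t, 0 <= t <= T -> ex (nu t) (fun x => enorm x ^+ 2) <= S).

Lemma weak_increment g rho s t : smooth g -> csupp rho g -> 0 <= s -> s <= t -> t <= T ->
  ex (nu t) g - ex (nu s) g = tint s t (flux V nu g).
Proof.
move=> sg cg s0 st tT; have t0 := le_trans s0 st; have sT := le_trans st tT.
have W u u0 uT := @weak_integrated R d T M K V mu0 nu T0 okV m20 wnu g rho sg cg u u0 uT.
have bf := flux_bmeas okV wnu.1 sg cg.
have := W t t0 tT; rewrite (tint_add bf (lexx 0) s0 st tT) -(W s s0 sT).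
move: (ex (nu t) g) (ex (nu s) g) (ex mu0 g) (tint s t _) => a b c e; lra.
Qed.

Variables (I : finType) (psi : I -> 'cV[R]_d -> R) (node : I -> 'cV[R]_d) (B A C eta r : R).
Hypotheses (B0 : 0 <= B) (A0 : 0 <= A) (C0 : 0 <= C) (r0 : 0 < r) (Cpsi : forall k, C2b (psi k) B A).
Hypotheses (psi0 : forall k x, 0 <= psi k x) (psi1 : forall x, \sum_k psi k x = 1).
Hypothesis (close : forall k x, psi k x != 0 -> `|x - node k| <= eta + `|x| ^+ 2 / r).
Hypothesis (dpsi : forall (b : 'cV[R]_d -> R) kap, (forall x y, `|b x - b y| <= kap * `|x - y|) ->
      forall x v, `|\sum_k 'D_v (psi k) x * b (node k)| <= C * kap * `|v|).

Let nodes_speed : R := \sum_k (M + K * `|node k|).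

(** Increments are taken at the nodes only, which makes the map smooth in [x], whereas
    [x + incr V s t x] is merely Lipschitz. *)
Definition euler_map (s t : R) (x : 'cV[R]_d) : 'cV[R]_d :=
  x + \sum_k psi k x *: incr V s t (node k).

Let node_speed k : M + K * `|node k| <= nodes_speed.
Proof.
have [M0 K0 _ _ _] := okV; rewrite /nodes_speed (bigD1 k) //= lerDl sumr_ge0 // => j _.
by rewrite addr_ge0 // mulr_ge0.
Qed.

Let node_speed0 k : 0 <= M + K * `|node k|.
Proof. by have [M0 K0 _ _ _] := okV; rewrite addr_ge0 // mulr_ge0. Qed.

Let speed0 : 0 <= nodes_speed. Proof. by apply: sumr_ge0. Qed.

Section fixed_function.
Variables (L D rho : R) (g : 'cV[R]_d -> R).
Hypotheses (L0 : 0 <= L) (D0 : 0 <= D) (Cg : C2b g L D) (cg : csupp rho g).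

Let Cp : R := (B * L + D) * (M + K * (1 + S)).

(** The integrand [q] of a pairing is itself smooth with compact support, so the integrated weak
    equation applies to it, and the second moment bounds its flux. *)
Lemma pairing_time_lip k i s t : 0 <= s -> s <= t -> t <= T ->
  `|pairing psi g (nu t) k i - pairing psi g (nu s) k i| <= Cp * (t - s).
Proof.
move=> s0 st tT; have [M0 K0 mV lV V0] := okV; have [sg _ _] := Cg.
pose q x := psi k x * 'D_(delta_mx i 0) g x.
have sq : smooth q by apply: smooth_mul; [have [] := Cpsi k|exact: smooth_derive].
have cq : csupp rho q by move=> x rx; rewrite /q (csupp_derive _ cg) ?mulr0.
rewrite /pairing (weak_increment sq cq s0 st tT).
apply: (tint_norm_le (flux_bmeas okV wnu.1 sq cq) s0 st tT) => u /andP[su ut].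
have uT : 0 <= u <= T by rewrite (le_trans s0 (ltW su)) (le_trans ut tT).
have [Lq [Aq [Lq0 Aq0 Cq]]] := csupp_C2b sq cq.
have qq := pairing_field_quad Lq0 Cq M0 K0 (V0 u uT) (lV u uT).
have E0 : 0 <= B * L + D by rewrite addr_ge0 // mulr_ge0.
apply: le_trans (_ : (B * L + D) * (M + K) + (B * L + D) * K * S <= _); last first.
  by rewrite /Cp le_eqVlt; apply/orP; left; apply/eqP; ring.
apply: le_trans (ex_quad_le (a := (B * L + D) * (M + K)) (b := (B * L + D) * K) (curve_m2 wnu.1 uT) qq _ _) _.
- exact: mulr_ge0.
- move=> x; apply: le_trans (lip_derive_le _ _) _.
  + exact: smooth_derivable.
  + exact: (pairing_lip Cpsi psi0 psi1 L0 D0 Cg).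
  rewrite -mulrA -mulrDr ler_wpM2l // (le_trans (lip_growth (V0 u uT) (lV u uT) x)) //.
  by rewrite -addrA lerD2l -[X in _ <= X + _]mulr1 -mulrDr ler_wpM2l // norm_quad.
- by rewrite lerD2l ler_wpM2l ?HS // mulr_ge0.
Qed.

Section interval.
Variables (s t : R).
Hypotheses (s0 : 0 <= s) (st : s <= t) (tT : t <= T).

Let ts : 0 <= t - s. Proof. by rewrite subr_ge0. Qed.

Let incr_node k : `|incr V s t (node k)| <= (t - s) * (M + K * `|node k|).
Proof. exact: (incr_bound okV). Qed.

Let U i (x : 'cV[R]_d) := \sum_k incr V s t (node k) i 0 * psi k x.

Let euler_mapE x : euler_map s t x = x + \col_i U i x.
Proof.
congr (_ + _); apply/matrixP => i j; rewrite summxE mxE; apply: eq_bigr => k _.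
by rewrite !mxE mulrC.
Qed.

(** The first-order constant comes from the last property of the partition, applied to a coordinate
    of [incr V s t], which is Lipschitz with constant [K * (t - s)]; it is therefore independent of
    the mesh. The second-order constant is crude and depends on the partition. *)
Let C2b_U i : C2b (U i) (C * (K * (t - s))) ((t - s) * nodes_speed * A).
Proof.
have [s1 _ A1] := C2b_sum (fun k => C2b_scale (incr V s t (node k) i 0) (Cpsi k)).
split=> //.
- move=> x v; rewrite /U smooth_derive_bigsum; last first.
    by move=> k; have [] := C2b_scale (incr V s t (node k) i 0) (Cpsi k).
  have [_ K0 _ _ _] := okV.
  apply: le_trans (_ : `|\sum_k 'D_v (psi k) x * incr V s t (node k) i 0| <= _).
    rewrite le_eqVlt; apply/orP; left; apply/eqP; congr (`|_|); apply: eq_bigr => k _.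
    have dk : derivable (psi k) x v by apply: smooth_derivable; have [] := Cpsi k.
    by rewrite (derive_cmul _ dk) mulrC.
  apply: (dpsi (b := fun x => incr V s t x i 0)) => y z.
  apply: le_trans (incr_lip okV y z s0 st tT).
  by have := le_cV_norm (incr V s t y - incr V s t z) i; rewrite !mxE.
- move=> x y v; apply: le_trans (A1 x y v) _.
  do 2 apply: ler_wpM2r => //.
  rewrite -mulr_suml ler_wpM2r //.
  rewrite /nodes_speed mulr_sumr; apply: ler_sum => k _.
  by apply: le_trans (le_cV_norm _ _) _; exact: incr_node.
Qed.

Lemma C2b_euler_map : C2b (fun x => g (euler_map s t x)) (L * (1 + C * (K * (t - s))))
   (D * (1 + C * (K * (t - s))) ^+ 2 + L * ((t - s) * nodes_speed * A)).
Proof.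
have [_ K0 _ _ _] := okV; under eq_fun do rewrite euler_mapE.
by apply: (C2b_euler L0 D0 _ _ Cg C2b_U); rewrite !mulr_ge0.
Qed.

Let U_le x : `|\sum_k psi k x *: incr V s t (node k)| <= (t - s) * nodes_speed.
Proof.
apply: le_trans (ler_norm_sum _ _ _) _; rewrite mulr_sumr; apply: ler_sum => k _.
rewrite normrZ -[leRHS]mul1r ler_pM ?(psi_le1 psi0 psi1) //; exact: incr_node.
Qed.

Lemma csupp_euler_map : csupp (rho + (t - s) * nodes_speed) (fun x => g (euler_map s t x)).
Proof.
move=> x rx; apply: cg; have := U_le x; rewrite /euler_map; move: (\sum_k _) => u ul.
have := ler_normB (x + u) u; rewrite addrK; move: ul rx; lra.
Qed.

(** The only term of first order in [t - s] is the smoothing error of the field. The Taylor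
    remainder of [g] and the motion of [nu] during the step are of second order, with constants that
    may depend on the partition. *)
Lemma euler_map_error :
  `|ex (nu t) g - ex (nu s) (fun x => g (euler_map s t x))| <=
    (t - s) * (L * K * (eta + S / r)) + (t - s) ^+ 2 * (D * nodes_speed ^+ 2 + nodes_speed * d%:R * Cp).
Proof.
have [M0 K0 mV lV V0] := okV; have [sg Lg _] := Cg.
have sT : 0 <= s <= T by rewrite s0 (le_trans st).
have m2 := curve_m2 wnu.1 sT.
have gl x y : `|g x - g y| <= L * `|x - y| by exact: C2b_lip Cg.
have qg := quad_lip gl.
have qe : quad (fun x => g (euler_map s t x)).
  by apply: quad_lip => x y; exact: (C2b_lip x y C2b_euler_map).
have qd := smoothed_pairing_quad Cpsi psi0 psi1 L0 D0 Cg (fun k => incr V s t (node k)).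
have e1 : `|ex (nu s) (fun x => g (euler_map s t x)) - ex (nu s) g -
     ex (nu s) (fun x => 'D_(\sum_k psi k x *: incr V s t (node k)) g x)| <= D * ((t - s) * nodes_speed) ^+ 2.
  have qB f1 f2 : quad f1 -> quad f2 -> quad (fun x : 'cV[R]_d => f1 x - f2 x).
    by move=> q1 q2; have := quad_add q1 (quad_scale (-1) q2); under eq_fun do rewrite mulN1r.
  have qeg := qB _ _ qe qg.
  rewrite -(exB m2 qe qg) -(exB m2 qeg qd).
  rewrite -[leRHS](ex_cst (nu s)); apply: (ex_norm_le m2) => [||x]; first exact: qB qeg qd.
    exact: quad_cst.
  apply: le_trans (C2b_taylor x _ D0 Cg) _.
  by rewrite ler_wpM2l // lerXn2r // nnegrE // mulr_ge0.
pose w k i u := V u (node k) i 0 * pairing psi g (nu s) k i.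
have bw k i : bmeas T (w k i) := bmeasM (mV (node k) i) (bmeas_cst T (pairing psi g (nu s) k i)).
have bw' k : bmeas T (fun u => \sum_i w k i u) := bmeas_sum (bw k).
(* [W u] pairs the smoothed field at time [u] with the measure frozen at time [s]; its time integral
   is exactly the linear term of the Taylor expansion ([e2]). *)
pose W u := \sum_k \sum_i w k i u.
have bW : bmeas T W := bmeas_sum bw'.
have e2 : ex (nu s) (fun x => 'D_(\sum_k psi k x *: incr V s t (node k)) g x) = tint s t W.
  rewrite (smoothed_pairingE Cpsi psi0 psi1 L0 D0 Cg _ m2).
  rewrite /W (tint_sum bw' s0 st tT); apply: eq_bigr => k _.
  rewrite (tint_sum (bw k) s0 st tT); apply: eq_bigr => i _.
  rewrite mxE mulrC -(tintZ _ (mV (node k) i) s0 tT).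
  by apply: tint_eq => u _; rewrite mulrC.
have bf := flux_bmeas okV wnu.1 sg cg.
have e3 : `|tint s t (flux V nu g) - tint s t W| <=
    (L * K * (eta + S / r) + (t - s) * (nodes_speed * d%:R * Cp)) * (t - s).
  rewrite -(tintB bf bW s0 tT); apply: (tint_norm_le (bmeasB bf bW) s0 st tT) => u /andP[su ut].
  have uT : 0 <= u <= T by rewrite (le_trans s0 (ltW su)) (le_trans ut tT).
  rewrite -(subrK (ex (nu u) (fun x => 'D_(\sum_k psi k x *: V u (node k)) g x)) (flux V nu g u)) -addrA.
  apply: le_trans (ler_normD _ _) _; apply: lerD.
    exact: (smoothed_flux_error okV wnu.1 B0 Cpsi psi0 psi1 close r0 L0 D0 Cg uT (HS uT)).
  rewrite (smoothed_pairingE Cpsi psi0 psi1 L0 D0 Cg _ (curve_m2 wnu.1 uT)) /W -sumrB.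
  apply: le_trans (ler_norm_sum _ _ _) _.
  have -> : (t - s) * (nodes_speed * d%:R * Cp) = nodes_speed * (d%:R * (Cp * (t - s))) by ring.
  rewrite /nodes_speed mulr_suml; apply: ler_sum => k _.
  rewrite /w -sumrB; apply: le_trans (ler_norm_sum _ _ _) _.
  have -> : (M + K * `|node k|) * (d%:R * (Cp * (t - s))) = \sum_(i < d) (M + K * `|node k|) * (Cp * (t - s)).
    by rewrite sumr_const card_ord -[RHS]mulr_natl mulrCA.
  apply: ler_sum => i _; rewrite -mulrBr normrM ler_pM //.
    by apply: le_trans (le_cV_norm _ _) _; exact: (lip_growth (V0 u uT) (lV u uT)).
  apply: le_trans (pairing_time_lip k i s0 (ltW su) (le_trans ut tT)) _.
  rewrite ler_wpM2l ?lerD2r //.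
  by rewrite mulr_ge0 // addr_ge0 ?mulr_ge0 // addr_ge0.
have := weak_increment sg cg s0 st tT; move: e1 e3; rewrite e2.
move: (ex (nu t) g) (ex (nu s) (fun x => g (euler_map s t x))) (ex (nu s) g) (tint s t W) (tint s t (flux V nu g)) => a b c e f.
move=> e1 e3 e4.
have -> : a - b = (f - e) - (b - c - e) by rewrite -e4; ring.
apply: le_trans (ler_normB _ _) (le_trans (lerD e3 e1) _).
by rewrite le_eqVlt; apply/orP; left; apply/eqP; ring.
Qed.

End interval.
End fixed_function.
End one_step.

(** * Backward composition of Euler maps and comparison with the flow *)

Section chain.
Context {R : realType} {d : nat}.
Variables (T M K S : R) (V : R -> 'cV[R]_d -> 'cV[R]_d) (mu0 : probability (borelRd R d) R).
Variable (nu : R -> probability (borelRd R d) R).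
Hypotheses (T0 : 0 < T) (okV : admissible T V M K) (m20 : finite_second_moment mu0).
Hypothesis (wnu : weak_solution T V mu0 nu).
Hypothesis (S0 : 0 <= S) (HS : forall t, 0 <= t <= T -> ex (nu t) (fun x => enorm x ^+ 2) <= S).

Lemma weak_initial g rho : smooth g -> csupp rho g -> ex (nu 0) g = ex mu0 g.
Proof.
move=> sg cg; apply/eqP; rewrite -subr_eq0 (weak_integrated T0 okV m20 wnu sg cg (lexx 0) (ltW T0)).
have := bmeas_eq (bmeas_cst T 0) (h2 := fun=> 0) (fun _ _ => erefl).
have bf := flux_bmeas okV wnu.1 sg cg.
have := tint_norm_le bf (lexx 0) (lexx 0) (ltW T0) (C := 0).
rewrite subrr mulr0 normr_le0 => + _; apply.
by move=> u /andP[u0 u1]; have := lt_le_trans u0 u1; rewrite ltxx.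
Qed.

Variables (I : finType) (psi : I -> 'cV[R]_d -> R) (node : I -> 'cV[R]_d) (B A C eta r : R).
Hypotheses (B0 : 0 <= B) (A0 : 0 <= A) (C0 : 0 <= C) (r0 : 0 < r) (Cpsi : forall k, C2b (psi k) B A).
Hypotheses (psi0 : forall k x, 0 <= psi k x) (psi1 : forall x, \sum_k psi k x = 1).
Hypothesis (close : forall k x, psi k x != 0 -> `|x - node k| <= eta + `|x| ^+ 2 / r).
Hypothesis (near_node : forall k x, psi k x != 0 -> `|node k| <= `|x| + eta).
Hypothesis (dpsi : forall (b : 'cV[R]_d -> R) kap, (forall x y, `|b x - b y| <= kap * `|x - y|) ->
      forall x v, `|\sum_k 'D_v (psi k) x * b (node k)| <= C * kap * `|v|).

Let ns : R := \sum_k (M + K * `|node k|).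
Let emap := euler_map V psi node.

Fixpoint euler_chain (h : R) (k : nat) (x : 'cV[R]_d) : 'cV[R]_d :=
  if k is j.+1 then emap (j%:R * h) (j.+1%:R * h) (euler_chain h j x) else x.

Variables (h : R) (N : nat).
Hypotheses (h0 : 0 <= h) (Nh : N%:R * h <= T).

Let grid0 k : 0 <= k%:R * h. Proof. by rewrite mulr_ge0. Qed.
Let gridS (k : nat) : k%:R * h <= k.+1%:R * h. Proof. by rewrite ler_wpM2r // ler_nat. Qed.
Let gridT k : (k <= N)%N -> k%:R * h <= T.
Proof. by move=> kN; apply: le_trans Nh; rewrite ler_wpM2r // ler_nat. Qed.
Let gridB (k : nat) : k.+1%:R * h - k%:R * h = h. Proof. by rewrite -natr1; ring. Qed.
Let M0 : 0 <= M. Proof. by have [] := okV. Qed.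
Let K0 : 0 <= K. Proof. by have [] := okV. Qed.
Let ns0 : 0 <= ns. Proof. by apply: sumr_ge0 => k _; rewrite addr_ge0 // mulr_ge0. Qed.

Section test.
Variables (f : 'cV[R]_d -> R) (L D Lm Dm : R).
Hypotheses (L0 : 0 <= L) (D0 : 0 <= D).
(** [q] is the growth factor of first derivatives in one step and [c] bounds the second-order term
    that a step creates; [Lm] and [Dm] are bounds valid for all [N] compositions. *)
Let q : R := 1 + C * (K * h).
Let c : R := Lm * (h * ns * A).
Hypotheses (Lm_le : L * q ^+ N <= Lm) (Dm_le : (D + N%:R * c) * q ^+ (2 * N) <= Dm).

Let e : R := h * (Lm * K * (eta + S / r)) +
  h ^+ 2 * (Dm * ns ^+ 2 + ns * d%:R * ((B * Lm + Dm) * (M + K * (1 + S)))).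

Let q1 : 1 <= q. Proof. by rewrite lerDl !mulr_ge0. Qed.
Let q0 : 0 <= q. Proof. exact: le_trans q1. Qed.
Let Lm0 : 0 <= Lm. Proof. by apply: le_trans Lm_le; rewrite mulr_ge0 // exprn_ge0. Qed.
Let c0 : 0 <= c. Proof. by rewrite !mulr_ge0. Qed.
Let Dm0 : 0 <= Dm.
Proof. by apply: le_trans Dm_le; rewrite mulr_ge0 ?exprn_ge0 // addr_ge0 // mulr_ge0. Qed.

(** [m] Euler maps are already composed into [g] and [k] remain, whence the powers of [q] in the
    bounds for [g]. Each induction step moves one map from the chain into the test function, at the
    cost [e]. *)
Lemma euler_chain_error k m g rho : (k + m <= N)%N ->
  C2b g (L * q ^+ m) ((D + m%:R * c) * q ^+ (2 * m)) -> csupp rho g ->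
  quad (fun x => g (euler_chain h k x)) /\
  `|ex (nu (k%:R * h)) g - ex mu0 (fun x => g (euler_chain h k x))| <= k%:R * e.
Proof.
elim: k m g rho => [|k IH] m g rho kmN Cg cg.
  have [sg _ _] := Cg; split; first by apply: quad_lip => x y; exact: (C2b_lip x y Cg).
  by rewrite !mul0r (weak_initial sg cg) subrr normr0.
have kN : (k.+1 <= N)%N by apply: leq_trans kmN; rewrite leq_addr.
have mN : (m <= N)%N by apply: leq_trans kmN; rewrite leq_addl.
have Lg : L * q ^+ m <= Lm.
  by apply: le_trans Lm_le; rewrite ler_wpM2l // ler_weXn2l.
have Dg : (D + m%:R * c) * q ^+ (2 * m) <= Dm.
  apply: le_trans Dm_le; apply: ler_pM.
  - by rewrite addr_ge0 // mulr_ge0.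
  - by rewrite exprn_ge0.
  - by rewrite lerD2l ler_wpM2r // ler_nat.
  - by rewrite ler_weXn2l // leq_mul2l.
have Lg0 : 0 <= L * q ^+ m by rewrite mulr_ge0 // exprn_ge0.
have Dg0 : 0 <= (D + m%:R * c) * q ^+ (2 * m).
  by rewrite mulr_ge0 ?exprn_ge0 // addr_ge0 // mulr_ge0.
have Cg' := C2b_euler_map okV A0 C0 Cpsi dpsi Lg0 Dg0 Cg (grid0 k) (gridS k) (gridT kN).
rewrite gridB -/q -/ns in Cg'.
have cg' := csupp_euler_map (node := node) okV psi0 psi1 cg (grid0 k) (gridS k) (gridT kN).
have {}Cg' : C2b (fun x => g (emap (k%:R * h) (k.+1%:R * h) x)) (L * q ^+ m.+1) ((D + m.+1%:R * c) * q ^+ (2 * m.+1)).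
  apply: C2b_weaken Cg'; first by rewrite exprSr mulrA.
  have -> : q ^+ (2 * m.+1) = q ^+ (2 * m) * q ^+ 2 by rewrite mulnS addnC exprD.
  apply: le_trans (_ : (D + m%:R * c) * q ^+ (2 * m) * q ^+ 2 + c * (q ^+ (2 * m) * q ^+ 2) <= _).
    rewrite lerD2l; apply: le_trans (_ : c <= _); first by apply: ler_wpM2r Lg; rewrite !mulr_ge0.
    by rewrite ler_peMr // -exprD exprn_ege1.
  by rewrite -natr1 le_eqVlt; apply/orP; left; apply/eqP; ring.
have kmN' : (k + m.+1 <= N)%N by rewrite addnS -addSn.
have [qk ek] := IH m.+1 _ _ kmN' Cg' cg'; split=> //.
have err := euler_map_error T0 okV m20 wnu S0 HS B0 A0 C0 r0 Cpsi psi0 psi1 close dpsi Lm0 Dm0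
  (C2b_weaken Lg Dg Cg) cg (grid0 k) (gridS k) (gridT kN).
rewrite gridB -/ns -/e in err.
have -> : k.+1%:R * e = e + k%:R * e by rewrite -natr1; ring.
apply: le_trans (lerD err ek).
have -> : ex (nu (k.+1%:R * h)) g - ex mu0 (fun x => g (euler_chain h k.+1 x)) =
  (ex (nu (k.+1%:R * h)) g - ex (nu (k%:R * h)) (fun x => g (euler_map V psi node (k%:R * h) (k.+1%:R * h) x))) +
  (ex (nu (k%:R * h)) (fun x => g (euler_map V psi node (k%:R * h) (k.+1%:R * h) x)) -
    ex mu0 (fun x => g (euler_map V psi node (k%:R * h) (k.+1%:R * h) (euler_chain h k x)))) by rewrite addrA subrK.
exact: ler_normD.
Qed.

End test.

Section comparison.
Variable X : R -> 'cV[R]_d -> 'cV[R]_d.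
Let E := expR (K * T).
Let spd r := M + K * ((r + M * T) * E).
Hypothesis X_init : forall x, X 0 x = x.
Hypothesis X_flow : forall s t x r, 0 <= s -> s <= t -> t <= T -> `|x| <= r ->
    `|X t x - X s x - incr V s t (X s x)| <= K * spd r * (t - s) ^+ 2.
Hypothesis eta1 : eta <= 1.

Let eta_ge0 : 0 <= eta.
Proof.
have [k pk] : exists k, psi k 0 != 0.
  apply/not_existsP => H; have := psi1 0; rewrite big1 => [/esym/eqP|k _].
    by rewrite oner_eq0.
  by have /negP/negPn/eqP := H k.
by have := near_node pk; rewrite normr0 add0r; exact: le_trans.
Qed.

Let E1 : 1 <= E. Proof. by rewrite -expR0 ler_expR mulr_ge0 // ltW. Qed.

Let chain_incr (j : nat) y : (j < N)%N ->
  `|\sum_k psi k y *: incr V (j%:R * h) (j.+1%:R * h) (node k)| <= h * (M + K * (`|y| + 1)).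
Proof.
move=> jN; apply: le_trans (ler_norm_sum _ _ _) _.
have -> : h * (M + K * (`|y| + 1)) = \sum_k psi k y * (h * (M + K * (`|y| + 1))).
  by rewrite -mulr_suml psi1 mul1r.
apply: ler_sum => k _; rewrite normrZ (ger0_norm (psi0 _ _)).
have [->|pk] := eqVneq (psi k y) 0; first by rewrite !mul0r.
rewrite ler_wpM2l //; apply: le_trans (incr_bound okV _ (grid0 j) (gridS j) (gridT jN)) _.
rewrite gridB ler_wpM2l // lerD2l ler_wpM2l // (le_trans (near_node pk)) // lerD2l //.
Qed.

Let hk k : (k <= N)%N -> expR (K * h * k%:R) <= E.
Proof. by move=> kN; rewrite ler_expR -mulrA ler_wpM2l // mulrC gridT. Qed.

Lemma euler_chain_growth k x : (k <= N)%N -> `|euler_chain h k x| <= (`|x| + T * (M + K)) * E.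
Proof.
move=> kN; have b0 : 0 <= h * (M + K) by rewrite mulr_ge0 // addr_ge0.
have := @discrete_gronwall R (fun k => `|euler_chain h k x|) (K * h) (h * (M + K)) N (mulr_ge0 K0 h0) b0 (normr_ge0 _).
move=> H; apply: le_trans (H _ k kN) _.
  move=> j jN /=; rewrite {1}/emap /euler_map; apply: le_trans (ler_normD _ _) _.
  apply: le_trans (lerD (lexx _) (chain_incr _ jN)) _.
  by rewrite le_eqVlt; apply/orP; left; apply/eqP; ring.
rewrite ler_pM ?expR_ge0 ?hk //; first by rewrite addr_ge0 // mulr_ge0.
by rewrite /= lerD2l mulrA ler_wpM2r ?addr_ge0 // gridT.
Qed.

(** The defect of the chain is the smoothing error along its path, that of the flow is quadratic in
    the step, and Groenwall sums both. The dependence on [x] is kept explicit, to be integrated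
    against [mu0]. *)
Lemma euler_chain_flow x :
  `|euler_chain h N x - X (N%:R * h) x| <=
    T * E * K * (h * spd `|x| + eta + ((`|x| + T * (M + K)) * E) ^+ 2 / r).
Proof.
set rd := (`|x| + T * (M + K)) * E.
have rd2 : 0 <= rd ^+ 2 / r by rewrite divr_ge0 ?sqr_ge0 // ltW.
have sp0 : 0 <= spd `|x|.
  by rewrite addr_ge0 // mulr_ge0 // mulr_ge0 ?expR_ge0 // addr_ge0 // mulr_ge0 // ltW.
have e10 : 0 <= h * K * (eta + rd ^+ 2 / r) by rewrite mulr_ge0 ?mulr_ge0 // addr_ge0.
have e20 : 0 <= K * spd `|x| * h ^+ 2 by rewrite mulr_ge0 ?mulr_ge0 // sqr_ge0.
have := @gronwall_compare R _ (fun j => incr V (j%:R * h) (j.+1%:R * h))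
  (fun k => euler_chain h k x) (fun k => X (k%:R * h) x) N (K * h)
  (h * K * (eta + rd ^+ 2 / r)) (K * spd `|x| * h ^+ 2) (mulr_ge0 K0 h0) e10 e20.
move=> H; apply: le_trans (H _ _ _ N (leqnn N)) _.
- move=> k kN; have := incr_lip okV (euler_chain h k x) (X (k%:R * h) x) (grid0 k) (gridS k) (gridT kN).
  by rewrite gridB.
- move=> k kN /=; set y := euler_chain h k x.
  rewrite {1}/emap /euler_map [y + _]addrC addrK distrC.
  rewrite [h * K]mulrC.
  have kh : 0 <= K * h by rewrite mulr_ge0.
  apply: le_trans (smoothing_error y kh psi0 psi1 close _) _.
    move=> u v; have := incr_lip okV u v (grid0 k) (gridS k) (gridT kN).
    by rewrite gridB.
  rewrite ler_wpM2l // lerD2l ler_wpM2r ?invr_ge0 ?(ltW r0) //.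
  rewrite lerXn2r ?nnegrE //; last exact: euler_chain_growth (ltnW kN).
  by apply: le_trans (euler_chain_growth _ (ltnW kN)); rewrite normr_ge0.
- move=> k kN; have := X_flow (grid0 k) (gridS k) (gridT kN) (lexx `|x|).
  by rewrite gridB.
rewrite mul0r X_init subrr normr0 add0r.
have -> : N%:R * (h * K * (eta + rd ^+ 2 / r) + K * spd `|x| * h ^+ 2) =
  (N%:R * h) * (K * (h * spd `|x| + eta + rd ^+ 2 / r)) by ring.
rewrite mulrAC -[T * E * K]mulrA -[T * (E * K) * _]mulrA -[E * K * _]mulrA mulrA.
have z0 : 0 <= K * (h * spd `|x| + eta + rd ^+ 2 / r).
  by rewrite mulr_ge0 // addr_ge0 // addr_ge0 // mulr_ge0.
by rewrite ler_wpM2r // ler_pM ?expR_ge0 ?hk // mulr_ge0.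
Qed.

End comparison.
End chain.

(** * Weak solutions agree with the flow on test functions *)

Section uniqueness.
Context {R : realType} {d : nat}.
Variables (T M K : R) (V : R -> 'cV[R]_d -> 'cV[R]_d) (mu0 : probability (borelRd R d) R).
Variable (nu : R -> probability (borelRd R d) R).
Hypotheses (T0 : 0 < T) (okV : admissible T V M K) (m20 : finite_second_moment mu0).
Hypothesis (wnu : weak_solution T V mu0 nu).
Variable X : R -> 'cV[R]_d -> 'cV[R]_d.
Let E := expR (K * T).
Let spd r := M + K * ((r + M * T) * E).
Hypothesis X_init : forall x, X 0 x = x.
Hypothesis X_lip : forall t x y, 0 <= t <= T -> `|X t x - X t y| <= E * `|x - y|.
Hypothesis X_flow : forall s t x r, 0 <= s -> s <= t -> t <= T -> `|x| <= r ->
    `|X t x - X s x - incr V s t (X s x)| <= K * spd r * (t - s) ^+ 2.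

Let M0 : 0 <= M. Proof. by have [] := okV. Qed.
Let K0 : 0 <= K. Proof. by have [] := okV. Qed.
Let E0 : 0 <= E. Proof. exact: expR_ge0. Qed.
Let m0 := ex mu0 (fun x => enorm x ^+ 2).
Let m00 : 0 <= m0.
Proof.
rewrite -(ex_cst mu0 0); apply: (ex_le m20 (quad_cst 0) (@quad_enorm2 R d)) => x; exact: sqr_ge0.
Qed.
(** [Q] and [G] bound the integrals under [mu0] of the squared radius and of the speed in
    [euler_chain_flow], through (a + b)^2 <= 2 a^2 + 2 b^2 and |x| <= 1 + |x|^2. *)
Let Q := 2 * E ^+ 2 * ((T * (M + K)) ^+ 2 + m0).
Let G := M + K * (1 + M * T) * E + K * E * m0.

Lemma pushforward_error f (q : 'cV[R]_d -> 'cV[R]_d) Lf h eta r t :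
  0 <= t <= T -> 0 <= h -> 0 < r -> 0 <= eta -> 0 <= Lf ->
  (forall x y, `|f x - f y| <= Lf * `|x - y|) -> quad (fun x => f (q x)) ->
  (forall x, `|q x - X t x| <= T * E * K * (h * spd `|x| + eta + ((`|x| + T * (M + K)) * E) ^+ 2 / r)) ->
  `|ex mu0 (fun x => f (q x)) - ex mu0 (fun x => f (X t x))| <=
    Lf * (T * E * K) * (h * G + eta + Q / r).
Proof.
move=> tT h0 r0 eta0 Lf0 Lf_lip qq qX; have TE0 : 0 <= T * E * K by rewrite !mulr_ge0 // ltW.
have qx : quad (fun x => f (X t x)).
  apply: (quad_lip (L := Lf * E)) => x y; apply: le_trans (Lf_lip _ _) _.
  by rewrite -mulrA ler_wpM2l // X_lip.
rewrite -(exB m20 qq qx).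
pose a := Lf * (T * E * K) * (h * (M + K * (1 + M * T) * E) + eta + 2 * E ^+ 2 * (T * (M + K)) ^+ 2 / r).
pose b := Lf * (T * E * K) * (h * (K * E) + 2 * E ^+ 2 / r).
have -> : Lf * (T * E * K) * (h * G + eta + Q / r) = a + b * m0 by rewrite /a /b /G /Q; ring.
have KE : 0 <= K * E by rewrite mulr_ge0.
apply: (ex_quad_le m20).
- by have := quad_add qq (quad_scale (-1) qx); under eq_fun do rewrite mulN1r.
- exact: mulr_ge0 (mulr_ge0 Lf0 TE0)
    (addr_ge0 (mulr_ge0 h0 KE) (divr_ge0 (mulr_ge0 (ler0n _ 2) (sqr_ge0 _)) (ltW r0))).
- move=> x; apply: le_trans (Lf_lip _ _) _.
  apply: le_trans (ler_wpM2l Lf0 (qX x)) _.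
  have -> : a + b * enorm x ^+ 2 = Lf * (T * E * K * (h * (M + K * (1 + enorm x ^+ 2 + M * T) * E) + eta +
     2 * E ^+ 2 * (enorm x ^+ 2 + (T * (M + K)) ^+ 2) / r)) by rewrite /a /b; ring.
  apply: ler_wpM2l => //; apply: ler_wpM2l => //; apply: lerD; first apply: lerD => //.
    apply: ler_wpM2l => //; rewrite lerD2l -mulrA; apply: ler_wpM2l => //.
    by apply: ler_wpM2r => //; rewrite lerD2r norm_quad.
  apply: ler_wpM2r; first by rewrite invr_ge0 ltW.
  have -> : 2 * E ^+ 2 * (enorm x ^+ 2 + (T * (M + K)) ^+ 2) =
    (2 * (enorm x ^+ 2 + (T * (M + K)) ^+ 2)) * E ^+ 2 by ring.
  rewrite exprMn; apply: ler_wpM2r; first exact: sqr_ge0.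
  have := norm2_enorm2 x; have := sqr_ge0 (`|x| - T * (M + K)); nra.
Qed.

(** [eta] and [r] are chosen first, to control the errors that do not shrink with the time step.
    This fixes the partition and with it the constant [Cst]; only then is [N] taken large enough to
    beat the terms in [Cst] and [G]. *)
Lemma uniqueness_test f rho t : smooth f -> csupp rho f -> 0 <= t <= T ->
  ex (nu t) f = ex mu0 (fun x => f (X t x)).
Proof.
move=> sf cf tT; have [t0 tT'] := andP tT.
have [L [D [L0 D0 Cf]]] := csupp_C2b sf cf.
have [S S0 HS] := curve_moment wnu.1.
have [C C0 part] := @partition_of_unity R d.
pose Lm := L * expR (C * K * T).
have Lm0 : 0 <= Lm by rewrite mulr_ge0 ?expR_ge0.
apply/eqP; rewrite -subr_eq0 -normr_le0; apply/ler_addgt0Pl => e e0; rewrite addr0.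
have e2 : 0 < e / 2 by rewrite divr_gt0.
have Q0 : 0 <= Q by rewrite !mulr_ge0 ?sqr_ge0 // addr_ge0 ?sqr_ge0.
have TE0 : 0 <= T * E * K by rewrite !mulr_ge0 // ltW.
have k0 : 0 <= T * Lm * K + L * (T * E * K) by rewrite addr_ge0 ?mulr_ge0 // ltW.
have [eta [r [eta0 eta1 r0 small]]] := small_errors (addr_ge0 S0 Q0) k0 e2.
have [I [psi [node [B [A [[B0 A0 Cpsi] [psi0 psi1 close near_node dpsi]]]]]]] := part eta r eta0 r0.
pose ns := \sum_k (M + K * `|node k|).
have ns0 : 0 <= ns by apply: sumr_ge0 => k _; rewrite addr_ge0 // mulr_ge0.
pose Dm := (D + T * (Lm * ns * A)) * expR (C * K * T) ^+ 2.
pose Cst := Dm * ns ^+ 2 + ns * d%:R * ((B * Lm + Dm) * (M + K * (1 + S))).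
(* [W / N] collects everything proportional to the time step, which is at most [T / N]. *)
pose W := T * (T * Cst) + L * (T * E * K) * (T * G).
pose N := (Num.trunc (W / (e / 2))).+1.
have N0 : 0 < N%:R :> R by rewrite ltr0n.
have WN : W / N%:R <= e / 2.
  by rewrite ler_pdivrMr // mulrC -ler_pdivrMr // ltW // truncnS_gt.
pose h := t / N%:R.
have h0 : 0 <= h by rewrite divr_ge0 // ltW.
have Nh : N%:R * h = t by rewrite mulrC divfK // gt_eqF.
have NhT : N%:R * h <= T by rewrite Nh.
have qE : (1 + C * (K * h)) ^+ N <= expR (C * K * T).
  apply: le_trans (_ : expR (C * (K * h)) ^+ N <= _).
    by rewrite lerXn2r ?nnegrE ?addr_ge0 ?mulr_ge0 ?expR_ge0 // expR_ge1Dx.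
  rewrite -expRM_natl ler_expR; have -> : N%:R * (C * (K * h)) = C * K * (N%:R * h) by ring.
  by rewrite ler_wpM2l // mulr_ge0.
have q0 : 0 <= (1 + C * (K * h)) ^+ N by rewrite exprn_ge0 // addr_ge0 // !mulr_ge0.
have Lm_le : L * (1 + C * (K * h)) ^+ N <= Lm by rewrite ler_wpM2l.
have lnA : 0 <= Lm * ns * A by rewrite !mulr_ge0.
have Dm_le : (D + N%:R * (Lm * (h * ns * A))) * (1 + C * (K * h)) ^+ (2 * N) <= Dm.
  have -> : N%:R * (Lm * (h * ns * A)) = (N%:R * h) * (Lm * ns * A) by ring.
  rewrite mulnC exprM ler_pM //.
  - by rewrite addr_ge0 // mulr_ge0 // Nh.
  - by rewrite sqr_ge0.
  - by rewrite lerD2l ler_wpM2r.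
  - by rewrite lerXn2r ?nnegrE ?expR_ge0.
have Cf' : C2b f (L * (1 + C * (K * h)) ^+ 0) ((D + 0%:R * (Lm * (h * ns * A))) * (1 + C * (K * h)) ^+ (2 * 0)).
  by rewrite muln0 !expr0 !mulr1 mul0r addr0.
have NN : (N + 0 <= N)%N by rewrite addn0.
have [qc ec] := euler_chain_error T0 okV m20 wnu S0 HS B0 A0 C0 r0 Cpsi psi0 psi1 close dpsi h0 NhT
  L0 D0 Lm_le Dm_le NN Cf' cf.
have cmp x := euler_chain_flow T0 okV r0 psi0 psi1 close near_node h0 NhT X_init X_flow eta1 x.
have Lf x y : `|f x - f y| <= L * `|x - y| by exact: (C2b_lip x y Cf).
rewrite Nh in cmp; rewrite Nh in ec.
have pe := pushforward_error tT h0 r0 (ltW eta0) L0 Lf qc cmp.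
apply: le_trans (ler_distD (ex mu0 (fun x => f (euler_chain V psi node h N x))) _ _) _.
apply: le_trans (lerD ec pe) _; rewrite -/ns -/Cst.
have [hT S1 Q1] : [/\ h <= T / N%:R, S / r <= (S + Q) / r & Q / r <= (S + Q) / r].
  by split; rewrite ler_wpM2r ?invr_ge0 ?(ltW N0) ?(ltW r0) // ?lerDl ?lerDr.
have -> : N%:R * (h * (Lm * K * (eta + S / r)) + h ^+ 2 * Cst) =
  (N%:R * h) * (Lm * K * (eta + S / r)) + (N%:R * h) * (h * Cst) by ring.
rewrite Nh.
have LmK : 0 <= Lm * K by rewrite mulr_ge0.
have Dm0 : 0 <= Dm by rewrite mulr_ge0 ?sqr_ge0 // addr_ge0 // mulr_ge0 // ltW.
have Cst0 : 0 <= Cst.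
  apply: addr_ge0; first by rewrite mulr_ge0 ?sqr_ge0.
  apply: mulr_ge0; first exact: mulr_ge0.
  exact: mulr_ge0 (addr_ge0 (mulr_ge0 B0 Lm0) Dm0) (addr_ge0 M0 (mulr_ge0 K0 (addr_ge0 ler01 S0))).
have G0 : 0 <= G.
  have MT : 0 <= 1 + M * T by rewrite addr_ge0 // mulr_ge0 // ltW.
  exact: addr_ge0 (addr_ge0 M0 (mulr_ge0 (mulr_ge0 K0 MT) E0)) (mulr_ge0 (mulr_ge0 K0 E0) m00).
have b1 : t * (Lm * K * (eta + S / r)) <= T * (Lm * K * (eta + (S + Q) / r)).
  apply: ler_pM => //; first by rewrite mulr_ge0 // addr_ge0 ?divr_ge0 // ltW.
  by apply: ler_wpM2l => //; rewrite lerD2l.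
have b2 : t * (h * Cst) <= T * (T * Cst) / N%:R.
  have -> : T * (T * Cst) / N%:R = T * (T / N%:R * Cst) by ring.
  by apply: ler_pM => //; [exact: mulr_ge0 | exact: ler_wpM2r].
have b3 : L * (T * E * K) * (h * G + eta + Q / r) <=
    L * (T * E * K) * (T * G) / N%:R + L * (T * E * K) * (eta + (S + Q) / r).
  have -> : L * (T * E * K) * (T * G) / N%:R + L * (T * E * K) * (eta + (S + Q) / r) =
    L * (T * E * K) * (T / N%:R * G + eta + (S + Q) / r) by ring.
  apply: ler_wpM2l; first exact: mulr_ge0.
  by apply: lerD => //; rewrite lerD2r; exact: ler_wpM2r.
apply: le_trans (lerD (lerD b1 b2) b3) _.
have -> : T * (Lm * K * (eta + (S + Q) / r)) + T * (T * Cst) / N%:R +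
   (L * (T * E * K) * (T * G) / N%:R + L * (T * E * K) * (eta + (S + Q) / r)) =
   (T * Lm * K + L * (T * E * K)) * (eta + (S + Q) / r) + W / N%:R by rewrite /W; ring.
by apply: le_trans (lerD small WN) _; rewrite -splitr.
Qed.

End uniqueness.

Lemma pushforward_exists {R : realType} {d1 d2 : measure_display} {X : measurableType d1}
  {Y : measurableType d2} (P : probability X R) (phi : X -> Y) : measurable_fun setT phi ->
  exists Q : probability Y R, forall A, measurable A -> Q A = P (phi @^-1` A).
Proof.
move=> mphi; pose H := isMeasurableFun.Build _ _ _ _ phi mphi.
pose f : {mfun X >-> Y} := HB.pack phi H.
by exists (distribution P f).
Qed.

(** * Open boxes, determination of measures, and supports *)

Section boxes.
Context {R : realType} {d : nat}.
Implicit Types (a b : 'cV[R]_d) (P Q : probability (borelRd R d) R).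

Definition box a b : set 'cV[R]_d := [set x | forall i, a i 0 < x i 0 < b i 0].

Lemma open_measurable (U : set 'cV[R]_d) : open U -> measurable (U : set (borelRd R d)).
Proof. exact: sub_sigma_algebra. Qed.

Lemma box_measurable a b : measurable (box a b : set (borelRd R d)).
Proof.
have -> : box a b = \bigcap_(i in [set: 'I_d]) ((fun x : borelRd R d => (x : 'cV[R]_d) i 0) @^-1` `]a i 0, b i 0[).
  by apply/seteqP; split => x /= H i; have := H i; rewrite /= in_itv /=; [move=> h _; exact: h|move=> h; exact: h].
apply: fin_bigcap_measurable => [|i _]; first exact: finite_finset.
rewrite -[X in measurable X]setTI; apply: coord_measurable => //; exact: measurable_itv.
Qed.

Lemma box_basis (U : set 'cV[R]_d) x : open U -> U x ->
  exists p : 'cV[rat]_d * 'cV[rat]_d, let B := box (map_mx ratr p.1) (map_mx ratr p.2) in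
  B x /\ B `<=` U.
Proof.
move=> oU Ux; have /nbhs_ballP[e /= e0 eU] : nbhs x U by apply: open_nbhs_nbhs.
have /choice[a Ha] i : exists q : rat, x i 0 - e < ratr q < x i 0.
  have /rat_in_itvoo[q] : x i 0 - e < x i 0 by rewrite gtrBl.
  by rewrite in_itv /=; exists q.
have /choice[b Hb] i : exists q : rat, x i 0 < ratr q < x i 0 + e.
  have /rat_in_itvoo[q] : x i 0 < x i 0 + e by rewrite ltrDl.
  by rewrite in_itv /=; exists q.
exists (\col_i a i, \col_i b i); split=> [i|y By] /=.
  by rewrite !mxE; have /andP[_ ->] := Ha i; have /andP[->] := Hb i.
apply: eU; split=> // i j; rewrite (ord1 j) /ball /=.
have := By i; rewrite !mxE => /andP[y1 y2].
have /andP[a1 a2] := Ha i; have /andP[b1 b2] := Hb i.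
by rewrite ltr_norml; apply/andP; split; lra.
Qed.

(** An open set is the union of the boxes with rational corners that it contains, a countable
    family. *)
Lemma borel_boxes : @measurable _ (borelRd R d) =
  <<s [set B | exists a b, B = box a b] >>.
Proof.
apply/seteqP; split; last first.
  apply: smallest_sub => //; first exact: sigma_algebra_measurable.
  by move=> _ [a [b ->]]; exact: box_measurable.
apply: smallest_sub; first exact: smallest_sigma_algebra.
move=> U oU.
pose T := g_sigma_algebraType [set B | exists a b, B = box a b].
pose F (p : 'cV[rat]_d * 'cV[rat]_d) : set T :=
  let B := box (map_mx ratr p.1) (map_mx ratr p.2) in if `[< B `<=` U >] then B else set0.
have -> : U = \bigcup_p F p.
  apply/seteqP; split => [x Ux|x [p _]].
    have [p [px pU]] := box_basis oU Ux; exists p => //.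
    by rewrite /F; case: asboolP.
  by rewrite /F; case: asboolP => // + h; apply.
suff : measurable (\bigcup_p F p : set T) by [].
apply: countable_bigcupT_measurable => [|p]; first exact: countableP.
rewrite /F; case: asboolP => // _; apply: sub_sigma_algebra; by eexists; eexists.
Qed.

(** Boxes are stable under intersection and generate the sigma-algebra, so agreement on boxes
    suffices. The indicator of a box is the pointwise limit of products of smooth steps that vanish
    outside it. *)
Lemma test_functions_determine P Q :
  (forall f rho, smooth f -> csupp rho f -> ex P f = ex Q f) ->
  forall A, measurable A -> P A = Q A.
Proof.
move=> PQ.
(* Cubes of finite measure exhausting the space, for the uniqueness theorem on measures. *)
pose g (k : nat) := box (const_mx (- k%:R)) (const_mx k%:R).
have boxPQ a b : P (box a b) = Q (box a b).
  pose f (n : nat) (x : 'cV[R]_d) :=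
    \prod_i (step (n%:R * (x i 0 - a i 0)) * step (n%:R * (b i 0 - x i 0))).
  have sf n : smooth (f n).
    apply: smooth_prod => i; have sc : smooth (fun x : 'cV[R]_d => x i 0) := smooth_coord i.
    apply: smooth_mul; apply: smooth_comp1 (@smooth_step R).
      exact: smooth_mul (smooth_cst _) (smooth_sub sc (smooth_cst _)).
    exact: smooth_mul (smooth_cst _) (smooth_sub (smooth_cst _) sc).
  have f0 n x : 0 <= f n x <= 1.
    rewrite prodr_ge0 /=; last by move=> i _; rewrite mulr_ge0 // step_ge0.
    by apply: prodr_ile1 => i _; rewrite mulr_ge0 ?step_ge0 //= mulr_ile1 ?step_ge0 ?step_le1.
  have fout n x : ~ box a b x -> f n x = 0.
    move=> /existsNP[i] /negP; rewrite negb_and -!leNgt => h.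
    rewrite /f (bigD1 i) //=; case/orP: h => h.
      by rewrite step_le0 ?mul0r // mulr_ge0_le0 // subr_le0.
    by rewrite (@step_le0 _ (n%:R * (b i 0 - _))) ?mulr0 ?mul0r // mulr_ge0_le0 // subr_le0.
  have cf n : csupp (`|a| + `|b|) (f n).
    move=> x rx; apply: fout => bx; move: rx; apply/negP; rewrite -leNgt.
    apply: cV_norm_le => [|i]; first by rewrite addr_ge0.
    have /andP[] := bx i; have := le_cV_norm a i; have := le_cV_norm b i.
    have := normr_ge0 a; have := normr_ge0 b.
    by rewrite !ler_norml => ? ? /andP[? ?] /andP[? ?] ? ?; apply/andP; split; lra.
  have lim1 (m : probability (borelRd R d) R) :
      (\int[m]_x (f n x)%:E)%E @[n --> \oo] --> m (box a b).
    have mB := box_measurable a b.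
    have -> : m (box a b) = (\int[m]_x (\1_(box a b) x)%:E)%E.
      by rewrite integral_indic // setIT.
    have [] := @dominated_convergence _ _ R m setT measurableT
      (fun n x => (f n x)%:E) (fun x => (\1_(box a b) x)%:E) (cst 1%E).
    - by move=> n; apply/measurable_EFinP; exact: (continuous_borel (smooth_cont (sf n))).
    - by apply/measurable_EFinP; exact: measurable_indic.
    - apply: aeW => x _; apply: cvg_EFin; first by apply: nearW.
      have [bx|nbx] := pselect (box a b x); last first.
        rewrite indicE memNset //; under eq_fun do rewrite /= fout //; exact: cvg_cst.
      rewrite indicE mem_set //=.
      apply: cvg_near_cst.
      suff H i : \forall n \near \oo, step (n%:R * (x i 0 - a i 0)) * step (n%:R * (b i 0 - x i 0)) = 1.
        apply: filterS (filter_forall _ H) => n Hn /=.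
        by rewrite /f big1.
      have /andP[ax xb] := bx i.
      have big (c : R) : 0 < c -> \forall n \near \oo, 1 <= n%:R * c.
        move=> c0; near=> n; rewrite -ler_pdivrMr // mul1r; near: n; exact: nbhs_infty_ger.
      near=> n; rewrite !step_ge1 ?mulr1 //; near: n; apply: big; by rewrite subr_gt0.
    - by apply: finite_measure_integrable_cst.
    - apply: aeW => x n _; rewrite /= lee_fin; have /andP[h1 h2] := f0 n x.
      by rewrite ger0_norm.
    by move=> _ _ h; exact: h.
  have e : (fun n => \int[P]_x (f n x)%:E)%E = (fun n => \int[Q]_x (f n x)%:E)%E.
    apply/funext => n; have := PQ (f n) _ (sf n) (cf n); rewrite /ex /Rintegral.
    have i1 (m : probability (borelRd R d) R) : (\int[m]_x (f n x)%:E)%E \is a fin_num.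
      apply: integrable_fin_num => //.
      apply: (le_integrable measurableT _ _ (finite_measure_integrable_cst m 1 measurableT)).
        by apply/measurable_EFinP; exact: (continuous_borel (smooth_cont (sf n))).
      move=> x _; have /andP[h1 h2] := f0 n x.
      by rewrite /= lee_fin normr1 ger0_norm.
    by move=> h; rewrite -(fineK (i1 P)) -(fineK (i1 Q)) h.
  have := lim1 P; rewrite e => /cvg_lim <- //; exact/cvg_lim/lim1.
move=> A mA; apply: (@measure_unique _ R (borelRd R d) [set B | exists a b, B = box a b] g _ _ _ _ P Q) => //.
- exact: borel_boxes.
- move=> _ _ [a [b ->]] [a' [b' ->]].
  exists (\col_i Num.max (a i 0) (a' i 0)), (\col_i Num.min (b i 0) (b' i 0)).
  apply/seteqP; split => x /=.
    move=> [h1 h2] i; rewrite !mxE gt_max lt_min.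
    by have /andP[-> ->] := h1 i; have /andP[-> ->] := h2 i.
  by move=> h; split=> i; have := h i; rewrite !mxE gt_max lt_min => /andP[/andP[h1 h2] /andP[h3 h4]];
    apply/andP.
- by move=> k; exists (const_mx (- k%:R)), (const_mx k%:R).
- apply/seteqP; split=> // x _; have := @nbhs_infty_gtr R `|x|.
  move=> [n _ /(_ n (leqnn n))] /= xn; exists n => // i; rewrite !mxE -ltr_norml.
  exact: le_lt_trans (le_cV_norm _ _) xn.
- by move=> _ [a [b ->]]; exact: boxPQ.
- by move=> k; apply: le_lt_trans (probability_le1 _ _) (ltry _); exact: box_measurable.
Unshelve. all: by end_near.
Qed.

(** A point outside the support lies in a null open set, hence in a null box with rational corners.
    There are countably many such boxes, so the complement of the support is negligible. *)
Lemma compact_support_ae P : compact (msupport P) ->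
  exists2 r : R, 0 <= r & {ae P, forall x : borelRd R d, `|x : 'cV[R]_d| <= r}.
Proof.
move=> /compact_bounded[M [_ HM]].
pose r := Num.max 0 (M + 1); exists r; first by rewrite le_max lexx.
pose B (p : 'cV[rat]_d * 'cV[rat]_d) : set (borelRd R d) := box (map_mx ratr p.1) (map_mx ratr p.2).
pose F (n : nat) : set (borelRd R d) :=
  if unpickle n is Some p then if `[< P (B p) = 0%E >] then B p else set0 else set0.
apply: (@negligibleS _ _ _ P (\bigcup_n F n)); last first.
  apply: negligible_bigcup => n; rewrite /F; case: (unpickle n) => [p|]; last exact: negligible_set0.
  case: asboolP => [Bp|_]; last exact: negligible_set0.
  by exists (B p); split => //; exact: box_measurable.
move=> x /= /negP; rewrite -ltNge => rx.
have xS : ~ msupport P x.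
  move=> Sx; have := HM r _ x Sx; rewrite /r lt_max ltrDl ltr01 orbT => /(_ isT).
  by rewrite /= leNgt rx.
have [U [oU [Ux PU]]] : exists U, open U /\ U x /\ ~ (0 < P U)%E.
  by move: xS => /existsNP[U /not_implyP[oU /not_implyP[Ux h]]]; exists U.
have [p [px pU]] := box_basis oU Ux.
exists (pickle p) => //; rewrite /F pickleK.
case: asboolP => // -[]; apply/eqP; rewrite eq_le measure_ge0 andbT.
rewrite leNgt; apply/negP => h; apply: PU; apply: lt_le_trans h _.
apply: le_measure => //; rewrite inE; [exact: box_measurable|exact: open_measurable].
Qed.

End boxes.

(** * Push-forwards by the flow are weak solutions *)

Section test_function_bounds.
Context {R : realType} {d : nat}.
Local Notation E := (R * 'cV[R]_d)%type.
Implicit Types (f : E -> R).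

Lemma norm_pair (a : R) (x : 'cV[R]_d) (c : R) : `|a| <= c -> `|x| <= c -> `|((a, x) : E)| <= c.
Proof. by move=> h1 h2; rewrite prod_normE /= ge_max h1. Qed.

Lemma le_norm_fst (p : E) : `|p.1| <= `|p|. Proof. by rewrite prod_normE le_max lexx. Qed.
Lemma le_norm_snd (p : E) : `|p.2| <= `|p|. Proof. by rewrite prod_normE le_max lexx orbT. Qed.

Lemma derive_pairE f (p v : E) : smooth f ->
  'D_v f p = v.1 * 'D_((1, 0) : E) f p + \sum_i v.2 i 0 * 'D_((0, delta_mx i 0) : E) f p.
Proof.
move=> sf; pose w (i : 'I_d) : E := (0, delta_mx i 0).
have ev : v = v.1 *: ((1, 0) : E) + \sum_i v.2 i 0 *: w i.
  have e : \sum_i v.2 i 0 *: w i = (0, v.2).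
    rewrite [X in (0, X)](col_sum_delta v.2); elim/big_rec2: _ => [//|i y1 y2 _ ->].
    by congr pair; rewrite /= ?mulr0 ?add0r // scaler0 addr0.
  rewrite e; case: (v) => a x /=; congr pair => /=.
    by rewrite addr0 /GRing.scale /= mulr1.
  by rewrite scaler0 add0r.
by rewrite {1}ev (smooth_deriveD _ _ _ sf) (smooth_deriveZ _ _ _ sf) (smooth_derive_sum _ _ _ sf).
Qed.

Section bounds.
Variables (T rho : R).
Hypothesis (T0 : 0 < T).

(** A test function is constrained on [0, T) only, and its extension to other times is arbitrary;
    all bounds are therefore restricted to times in [0, T]. *)
Definition vanishes f := forall t x, 0 <= t <= T -> rho < `|x| -> f (t, x) = 0.

(** A derivative taken at time 0 or [T] also sees values outside [0, T]. It is therefore computed at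
    interior times and extended to the endpoints by continuity. *)
Lemma vanishing_endpoints f (x : 'cV[R]_d) : continuous f -> (forall t, 0 < t < T -> f (t, x) = 0) ->
  forall t, 0 <= t <= T -> f (t, x) = 0.
Proof.
move=> cf f0 t tT; apply/eqP/negPn/negP => ne.
have cs : (fun s : R => `|f (s, x)|) s @[s --> t] --> `|f (t, x)|.
  have cp : continuous (fun s : R => (s, x) : E).
    apply: (lip_continuous (L := 1)) => a b; rewrite mul1r.
    have -> : ((a, x) : E) - (b, x) = (a - b, x - x) by [].
    by rewrite subrr; apply: norm_pair; rewrite ?normr0.
  by apply: cvg_norm; exact: (continuous_comp (cp t) (cf (t, x))).
have : \forall s \near t, 0 < `|f (s, x)| by apply: (cvgr_gt _ cs); rewrite normr_gt0.
move=> /nbhs_ballP[e /= e0 eH].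
have [t0 tT'] := andP tT.
(* The fraction by which [t] is moved towards the midpoint [T / 2]: the new time is interior and
   within [e] of [t]. *)
pose h := Num.min (1 / 2) (e / (2 * T)).
have h0 : 0 < h by rewrite lt_min !divr_gt0 // mulr_gt0.
have h1 : h < 1 by rewrite gt_min; apply/orP; left; lra.
have hT : h * T <= e / 2.
  apply: le_trans (_ : e / (2 * T) * T <= _); first by rewrite ler_pM2r // ge_min lexx orbT.
  by rewrite invfM mulrA divfK // gt_eqF.
have := eH (t + h * (T / 2 - t)); rewrite -ball_normE /= f0 ?normr0 ?ltxx.
  move=> H; suff /H : `|t - (t + h * (T / 2 - t))| < e by [].
  rewrite opprD addrA subrr add0r normrN normrM (gtr0_norm h0).
  have : `|T / 2 - t| <= T by rewrite ler_norml; apply/andP; split; lra.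
  move=> /(ler_wpM2l (ltW h0)) /le_trans /(_ hT) /le_lt_trans; apply; lra.
have a1 : 0 < h * T by rewrite mulr_gt0.
have a2 : 0 <= (1 - h) * t by rewrite mulr_ge0 // subr_ge0 ltW.
have a3 : 0 <= (1 - h) * (T - t) by rewrite mulr_ge0 // subr_ge0 // ltW.
by apply/andP; split; lra.
Qed.

Lemma convex_time (s q u : R) : 0 <= s <= T -> 0 <= q <= T -> 0 <= u -> u <= 1 ->
  0 <= s + u * (q - s) <= T.
Proof.
move=> /andP[s0 sT] /andP[q0 qT] u0 u1.
have a1 : 0 <= (1 - u) * s by rewrite mulr_ge0 // subr_ge0.
have a2 : 0 <= (1 - u) * (T - s) by rewrite mulr_ge0 // subr_ge0.
have a3 : 0 <= u * q by rewrite mulr_ge0.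
have a4 : 0 <= u * (T - q) by rewrite mulr_ge0 // subr_ge0.
by apply/andP; split; lra.
Qed.

Lemma vanishes_derive f v : smooth f -> vanishes f -> vanishes ('D_v f).
Proof.
move=> sf vf t x tT rx.
apply: (vanishing_endpoints (smooth_cont (smooth_derive v sf)) _ tT) => {tT}s /andP[s0 sT].
rewrite -(derive_cst (0 : R) ((s, x) : E) v); apply: near_eq_derive.
apply/(@nbhs_ballP _ E); exists (Num.min (Num.min s (T - s)) (`|x| - rho)) => /=.
  by rewrite !lt_min s0 !subr_gt0 sT.
move=> p; rewrite -ball_normE /= !lt_min => /andP[/andP[ps pT] px].
have h1 := le_norm_fst ((s, x) - p); have h2 := le_norm_snd ((s, x) - p); rewrite /= in h1 h2.
rewrite [p]surjective_pairing /= vf //.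
  move: (le_lt_trans h1 ps) (le_lt_trans h1 pT); rewrite !ltr_norml => /andP[? ?] /andP[? ?].
  by apply/andP; split; lra.
have := lerB_dist x p.2; have := le_lt_trans h2 px; lra.
Qed.

Lemma vanishes_bounded f : continuous f -> vanishes f ->
  exists2 C, 0 <= C & forall t x, 0 <= t <= T -> `|f (t, x)| <= C.
Proof.
move=> cf vf; pose A := `[0, T]%classic `*` [set x : 'cV[R]_d | `|x| <= `|rho|].
have A0 : A !=set0 by exists (0, 0); split; rewrite /= ?in_itv /= ?lexx ?(ltW T0) // normr0.
have cA : compact A by apply: compact_setX; [exact: segment_compact|exact: closed_ball_compact].
have cN : continuous (fun p : E => `|f p|) by move=> x; exact: (cvg_norm (cf x)).
have [c _ Hc] := compact_EVT_max A0 cA (continuous_subspaceT cN).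
exists `|f c| => // t x tT; have [xA|xA] := leP `|x| `|rho|.
  by apply: Hc; rewrite inE; split; rewrite //= in_itv.
by rewrite vf ?normr0 // (le_lt_trans (ler_norm rho)).
Qed.

Lemma vanishes_derive_bound f : smooth f -> vanishes f ->
  exists2 L, 0 <= L & forall t x v, 0 <= t <= T -> `|'D_v f (t, x)| <= L * `|v|.
Proof.
move=> sf vf.
have H v := vanishes_bounded (smooth_cont (smooth_derive v sf)) (vanishes_derive v sf vf).
have [a a0 Ha] := H (1, 0).
pose b i := s2val (cid2 (H (0, delta_mx i 0))).
have b0 i : 0 <= b i := s2valP (cid2 (H (0, delta_mx i 0))).
have Hb i t x : 0 <= t <= T -> `|'D_((0, delta_mx i 0) : E) f (t, x)| <= b i :=
  s2valP' (cid2 (H (0, delta_mx i 0))) t x.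
exists (a + \sum_i b i) => [|t x v tT]; first by rewrite addr_ge0 // sumr_ge0.
rewrite (derive_pairE _ v sf) mulrDl; apply: le_trans (ler_normD _ _) _; apply: lerD.
  by rewrite normrM mulrC ler_pM ?Ha // le_norm_fst.
rewrite mulr_suml; apply: le_trans (ler_norm_sum _ _ _) _; apply: ler_sum => i _.
by rewrite normrM mulrC ler_pM ?Hb // (le_trans (le_cV_norm _ _)) // le_norm_snd.
Qed.

Lemma segment_MVT f (p q : E) L : smooth f -> 0 <= p.1 <= T -> 0 <= q.1 <= T ->
  (forall t x v, 0 <= t <= T -> `|'D_v f (t, x)| <= L * `|v|) -> `|f q - f p| <= L * `|q - p|.
Proof.
move=> sf pT qT HL; have [t /andP[t0 t1] ->] := smooth_MVT p q sf.
rewrite [p + _]surjective_pairing; apply: HL => /=.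
exact: convex_time.
Qed.

Lemma vanishes_C2 f : smooth f -> vanishes f -> exists L D, [/\ 0 <= L, 0 <= D,
  forall t x v, 0 <= t <= T -> `|'D_v f (t, x)| <= L * `|v| &
  forall t s x y v, 0 <= t <= T -> 0 <= s <= T ->
    `|'D_v f (t, x) - 'D_v f (s, y)| <= D * `|((t - s, x - y) : E)| * `|v|].
Proof.
move=> sf vf; have [L L0 HL] := vanishes_derive_bound sf vf.
have H w := vanishes_derive_bound (smooth_derive w sf) (vanishes_derive w sf vf).
have [a a0 Ha] := H (1, 0).
pose b i := s2val (cid2 (H (0, delta_mx i 0))).
have b0 i : 0 <= b i := s2valP (cid2 (H (0, delta_mx i 0))).
have Hb i : forall t x v, 0 <= t <= T -> `|'D_v ('D_((0, delta_mx i 0) : E) f) (t, x)| <= b i * `|v| :=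
  s2valP' (cid2 (H (0, delta_mx i 0))).
exists L, (a + \sum_i b i); split => //; first by rewrite addr_ge0 // sumr_ge0.
move=> t s x y v tT sT; rewrite (derive_pairE (t, x) v sf) (derive_pairE (s, y) v sf) opprD addrACA -mulrBr -sumrB mulrDl mulrDl.
have M w c := @segment_MVT _ (s, y) (t, x) c (smooth_derive w sf) sT tT.
apply: le_trans (ler_normD _ _) _; apply: lerD.
  by rewrite normrM mulrC ler_pM // ?le_norm_fst //; exact: (M _ _ Ha).
rewrite -mulrA mulr_suml; apply: le_trans (ler_norm_sum _ _ _) _; apply: ler_sum => i _.
rewrite -mulrBr normrM mulrC mulrA ler_pM //; last by rewrite (le_trans (le_cV_norm _ _)) // le_norm_snd.
exact: (M _ _ (Hb i)).
Qed.

Lemma segment_taylor f D (t s : R) (x y : 'cV[R]_d) : smooth f -> 0 <= D -> 0 <= t <= T -> 0 <= s <= T ->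
  (forall t s x y v, 0 <= t <= T -> 0 <= s <= T ->
    `|'D_v f (t, x) - 'D_v f (s, y)| <= D * `|((t - s, x - y) : E)| * `|v|) ->
  `|f (t, x) - f (s, y) - 'D_((t - s, x - y) : E) f (s, y)| <= D * `|((t - s, x - y) : E)| ^+ 2.
Proof.
move=> sf D0 tT sT HD.
have [u /andP[u0 u1] ->] := smooth_MVT ((s, y) : E) (t, x) sf.
have -> : ((t, x) : E) - (s, y) = (t - s, x - y) by [].
set v := ((t - s, x - y) : E).
have -> : ((s, y) : E) + u *: v = (s + u * (t - s), y + u *: (x - y)) by [].
apply: le_trans (HD _ _ _ _ _ _ _) _; [exact: convex_time | exact: sT |].
rewrite [s + _]addrC [y + _]addrC !addrK expr2 mulrA ler_wpM2r // ler_wpM2l //.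
have -> : ((u * (t - s), u *: (x - y)) : E) = u *: v by [].
by rewrite normrZ (ger0_norm u0) ler_piMl.
Qed.

End bounds.

(** A nonzero value at time [T] would persist at slightly earlier times and put the point in the
    closure that defines the support, which avoids the final time. *)
Lemma test_vanishes (T : R) f : 0 < T -> test_function T f ->
  exists rho, [/\ vanishes T rho f & forall x, f (T, x) = 0].
Proof.
move=> T0 [sf cS ST]; have /compact_bounded[M [_ HM]] := cS.
have fT x : f (T, x) = 0.
  apply/eqP/negPn/negP => ne.
  suff H : closure [set p : E | 0 <= p.1 < T /\ f p != 0] (T, x).
    by have /andP[_] := ST _ H; rewrite ltxx.
  move=> B nB.
  have nz : nbhs (f (T, x)) [set y : R | y != 0].
    apply/nbhs_ballP; exists `|f (T, x)|; first by rewrite /= normr_gt0.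
    by move=> y; rewrite -ball_normE /=; apply: contraTneq => ->; rewrite subr0 ltxx.
  have nf : nbhs ((T, x) : E) [set p | f p != 0] := smooth_cont sf nz.
  have [e /= e0 eH] := (@nbhs_ballP _ E _ _).1 (filterI nB nf).
  pose s := T - Num.min T (e / 2).
  have m0 : 0 < Num.min T (e / 2) by rewrite lt_min T0 divr_gt0.
  have mT : Num.min T (e / 2) <= T by rewrite ge_min lexx.
  have me : Num.min T (e / 2) < e by rewrite gt_min; apply/orP; right; lra.
  have [] := eH (s, x).
    rewrite -ball_normE /= prod_normE /= subrr normr0 /s opprB addrCA subrr addr0 gtr0_norm //.
    by rewrite gt_max me.
  move=> Bs fs; exists (s, x); split => //; split => //=; rewrite /s; apply/andP; split; lra.
exists (M + 1); split=> // t x /andP[t0 tT] rx.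
have [tT'|] := ltP t T; last by move=> Tt; rewrite (le_anti (_ : t <= T <= t)) ?fT // tT.
apply/eqP/negPn/negP => ne.
have Sx : closure [set p : E | 0 <= p.1 < T /\ f p != 0] (t, x).
  by apply: subset_closure => /=; rewrite t0.
have := HM (M + 1) _ _ Sx; rewrite ltrDl ltr01 => /(_ isT) /=.
by move/(le_trans (le_norm_snd _)); rewrite /= leNgt rx.
Qed.

End test_function_bounds.

(** * Flow estimates and images of measures *)

Section flows.
Context {R : realType} {d : nat}.
Implicit Types (V : R -> 'cV[R]_d -> 'cV[R]_d).

(** The last clause is the differential equation in integrated form: the position is frozen at the
    start of the interval, with a quadratic defect. It makes sense for fields that are only
    measurable in time. *)
Definition flow_of (T M K : R) V (X : R -> 'cV[R]_d -> 'cV[R]_d) : Prop :=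
  [/\ forall x, X 0 x = x,
  forall t x y, 0 <= t <= T -> `|X t x - X t y| <= expR (K * T) * `|x - y|,
  forall t x r, 0 <= t <= T -> `|x| <= r -> `|X t x| <= (r + M * T) * expR (K * T) &
  forall s t x r, 0 <= s -> s <= t -> t <= T -> `|x| <= r ->
    `|X t x - X s x - incr V s t (X s x)| <=
      K * (M + K * ((r + M * T) * expR (K * T))) * (t - s) ^+ 2].

Lemma flow_exists T M K V : 0 < T -> admissible T V M K -> exists X, flow_of T M K V X.
Proof.
move=> T0 okV; have [M0 K0 _ _ _] := okV.
apply: (additive_flow_exists T0 M0 K0).
- by move=> s u t x; exact: (incr_add okV).
- by move=> s t x y; exact: (incr_lip okV).
- by move=> s t x; exact: (incr_bound okV).
Qed.

(** Taking [|x|] itself as the radius turns the bounds on balls into linear growth in [|x|], whose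
    square is integrable under a finite second moment. *)
Lemma flow_growth T M K V X : 0 < T -> admissible T V M K -> flow_of T M K V X ->
  exists c, [/\ 0 <= c,
    forall t x, 0 <= t <= T -> `|X t x| <= c * (1 + `|x|),
    forall s t x, 0 <= s -> s <= t -> t <= T -> `|X t x - X s x| <= c * (1 + `|x|) * (t - s) &
    forall s t x, 0 <= s -> s <= t -> t <= T ->
      `|X t x - X s x - incr V s t (X s x)| <= c * (1 + `|x|) * (t - s) ^+ 2].
Proof.
move=> T0 okV [_ _ bX lX]; have [M0 K0 _ _ _] := okV.
have E0 : 0 <= expR (K * T) := expR_ge0 _.
set E := expR (K * T) in bX lX E0.
have MT : 0 <= M * T by rewrite mulr_ge0 // ltW.
have KT : 0 <= K * T by rewrite mulr_ge0 // ltW.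
pose c0 := E * (1 + M * T); pose s0 := M + K * c0.
have c00 : 0 <= c0 by rewrite mulr_ge0 // addr_ge0.
have s00 : 0 <= s0 by rewrite addr_ge0 // mulr_ge0.
have rad_le (x : 'cV[R]_d) : (`|x| + M * T) * E <= c0 * (1 + `|x|).
  rewrite /c0 -mulrA mulrC ler_wpM2l // mulrDl mul1r mulrDr mulr1.
  have : 0 <= M * T * `|x| by rewrite mulr_ge0.
  by have := normr_ge0 x; lra.
have spd_le (x : 'cV[R]_d) : M + K * ((`|x| + M * T) * E) <= s0 * (1 + `|x|).
  rewrite /s0 [leRHS]mulrDl; apply: lerD; first by rewrite ler_peMr // lerDl.
  by rewrite -mulrA ler_wpM2l.
have spd0 (x : 'cV[R]_d) : 0 <= M + K * ((`|x| + M * T) * E).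
  by rewrite addr_ge0 // mulr_ge0 // mulr_ge0 // addr_ge0.
have w0 (x : 'cV[R]_d) : 0 <= 1 + `|x| by rewrite addr_ge0.
have loc s t x : 0 <= s -> s <= t -> t <= T ->
      `|X t x - X s x - incr V s t (X s x)| <= K * s0 * (1 + `|x|) * (t - s) ^+ 2.
  move=> s00' st tT; apply: le_trans (lX s t x _ s00' st tT (lexx _)) _.
  by rewrite -[K * s0 * _]mulrA ler_wpM2r ?sqr_ge0 // ler_wpM2l.
have Ks0 : 0 <= K * s0 by rewrite mulr_ge0.
have KTs : 0 <= s0 * (1 + K * T) by rewrite mulr_ge0 // addr_ge0.
exists (c0 + s0 * (1 + K * T) + K * s0); split.
- exact: addr_ge0 (addr_ge0 c00 KTs) Ks0.
- move=> t x tT; apply: le_trans (bX t x _ tT (lexx _)) _; apply: le_trans (rad_le x) _.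
  by rewrite ler_wpM2r // -addrA lerDl addr_ge0.
- move=> s t x s1 st tT; have ts : 0 <= t - s by rewrite subr_ge0.
  have sI : 0 <= s <= T by rewrite s1 (le_trans st).
  rewrite -(subrK (incr V s t (X s x)) (X t x - X s x)).
  apply: le_trans (ler_normD _ _) _.
  apply: le_trans (lerD (loc s t x s1 st tT) (incr_bound okV (X s x) s1 st tT)) _.
  apply: le_trans (_ : K * s0 * (1 + `|x|) * (T * (t - s)) + (t - s) * (s0 * (1 + `|x|)) <= _).
    apply: lerD.
      rewrite ler_wpM2l ?mulr_ge0 // expr2 ler_wpM2r //; lra.
    rewrite ler_wpM2l //; apply: le_trans (spd_le x); rewrite lerD2l ler_wpM2l //.
    exact: bX.
  have -> : K * s0 * (1 + `|x|) * (T * (t - s)) + (t - s) * (s0 * (1 + `|x|)) =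
    s0 * (1 + K * T) * (1 + `|x|) * (t - s) by ring.
  have cc : s0 * (1 + K * T) <= c0 + s0 * (1 + K * T) + K * s0 by move: c00 Ks0; lra.
  by rewrite ler_wpM2r // ler_wpM2r.
- move=> s t x s1 st tT; apply: le_trans (loc s t x s1 st tT) _.
  by rewrite ler_wpM2r ?sqr_ge0 // ler_wpM2r // lerDr addr_ge0.
Qed.

Lemma measurable_continuous_map (F : 'cV[R]_d -> 'cV[R]_d) : continuous F ->
  measurable_fun setT (F : borelRd R d -> borelRd R d).
Proof.
move=> cF; apply: (@measurability _ _ (borelRd R d) (borelRd R d) setT F open) => //.
move=> _ [U oU <-]; rewrite setTI; apply: sub_sigma_algebra.
by apply: open_comp => // x _; exact: cF.
Qed.

Lemma W2_ge0 (P Q : probability (borelRd R d) R) : (0 <= W2 P Q)%E.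
Proof. by apply: le_ereal_inf_tmp => _ [gam _ <-]; exact: poweR_ge0. Qed.

Lemma W2_pushforward (mu P Q : probability (borelRd R d) R) (F G : 'cV[R]_d -> 'cV[R]_d) (e : R) :
  0 <= e -> continuous F -> continuous G ->
  (forall A : set (borelRd R d), measurable A -> P A = mu (F @^-1` A)) ->
  (forall A : set (borelRd R d), measurable A -> Q A = mu (G @^-1` A)) ->
  (\int[mu]_x (enorm (F x - G x) ^+ 2)%:E <= (e ^+ 2)%:E)%E -> (W2 P Q <= e%:E)%E.
Proof.
move=> e0 cF cG PF QG le.
have mF := measurable_continuous_map cF; have mG := measurable_continuous_map cG.
have mFG : measurable_fun setT (fun x : borelRd R d => (F x : borelRd R d, G x : borelRd R d)).
  exact: measurable_fun_pair.
have [gam Hg] := pushforward_exists mu mFG.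
apply: (@W2_le_coupling _ _ _ _ gam) => //.
  move=> A mA; rewrite PF // QG // !Hg //.
    by rewrite -[X in measurable X]setTI; exact: measurable_snd.
  by rewrite -[X in measurable X]setTI; exact: measurable_fst.
rewrite (@ge0_transfer _ _ _ _ _ mu gam _ mFG) //.
- by move=> A mA; rewrite Hg.
- by apply/measurable_EFinP; exact: measurable_sqdist.
- by move=> y; rewrite lee_fin sqr_ge0.
Qed.

Lemma quad_mul_bounded (f g : 'cV[R]_d -> R) C : quad f -> continuous g -> (forall x, `|g x| <= C) ->
  quad (fun x => f x * g x).
Proof.
move=> [cf [a [b [a0 b0 H]]]] cg gC; split; first by move=> x; exact: (cvgM (cf x) (cg x)).
have C0 : 0 <= C := le_trans (normr_ge0 _) (gC 0).
exists (a * C), (b * C); split; rewrite ?mulr_ge0 // => x.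
by rewrite normrM mulrAC -mulrDl ler_pM.
Qed.

Lemma quad_weight : quad (fun x : 'cV[R]_d => (1 + `|x|) ^+ 2).
Proof.
have cn : continuous (fun x : 'cV[R]_d => 1 + `|x|).
  apply: (lip_continuous (L := 1)) => x y; rewrite mul1r opprD addrACA subrr add0r.
  exact: ler_dist_dist.
split; first by under eq_fun do rewrite expr2; move=> x; exact: (cvgM (cn x) (cn x)).
exists 2, 2; split=> // x; rewrite ger0_norm ?sqr_ge0 //.
have := norm2_enorm2 x; have := sqr_ge0 (`|x| - 1); nra.
Qed.

Lemma ex_weight_le (mu : probability (borelRd R d) R) f C : finite_second_moment mu -> quad f ->
  (forall x, `|f x| <= C * (1 + `|x|) ^+ 2) -> `|ex mu f| <= C * ex mu (fun x => (1 + `|x|) ^+ 2).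
Proof.
move=> m2 qf fC; rewrite -(exZ m2 C quad_weight).
exact: (ex_norm_le m2 qf (quad_scale C quad_weight)).
Qed.

End flows.

(** * Test functions along the flow *)

Section existence.
Context {R : realType} {d : nat}.

Let balance (a b u v w e1 e2 : R) : `|a - b - v| <= e1 -> `|v - w| <= e2 ->
  `|a - (u + w) - (b - u)| <= e1 + e2.
Proof.
move=> h1 h2; have -> : a - (u + w) - (b - u) = (a - b - v) + (v - w) by ring.
exact: le_trans (ler_normD _ _) (lerD h1 h2).
Qed.

Variables (T M K : R) (V : R -> 'cV[R]_d -> 'cV[R]_d) (mu0 : probability (borelRd R d) R).
Hypotheses (T0 : 0 < T) (okV : admissible T V M K) (m20 : finite_second_moment mu0).
Variables (X : R -> 'cV[R]_d -> 'cV[R]_d) (c : R).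
Hypothesis (flowX : flow_of T M K V X).
Hypothesis (c0 : 0 <= c).
Hypothesis X_growth : forall t x, 0 <= t <= T -> `|X t x| <= c * (1 + `|x|).
Hypothesis X_speed : forall s t x, 0 <= s -> s <= t -> t <= T -> `|X t x - X s x| <= c * (1 + `|x|) * (t - s).
Hypothesis X_local : forall s t x, 0 <= s -> s <= t -> t <= T ->
      `|X t x - X s x - incr V s t (X s x)| <= c * (1 + `|x|) * (t - s) ^+ 2.

Local Notation E := (R * 'cV[R]_d)%type.
Let Ek := expR (K * T).
Let M0 : 0 <= M. Proof. by have [] := okV. Qed.
Let K0 : 0 <= K. Proof. by have [] := okV. Qed.
Let w1 (x : 'cV[R]_d) : 1 <= 1 + `|x|. Proof. by rewrite lerDl. Qed.
Let w0 (x : 'cV[R]_d) : 0 <= 1 + `|x|. Proof. by rewrite addr_ge0. Qed.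
Let w2 (x : 'cV[R]_d) : 1 + `|x| <= (1 + `|x|) ^+ 2. Proof. by rewrite expr2 ler_peMr. Qed.
Let I2 := ex mu0 (fun x => (1 + `|x|) ^+ 2).

Let I20 : 0 <= I2.
Proof.
rewrite -(ex_cst mu0 0); apply: (ex_le m20 (quad_cst 0) quad_weight) => x; exact: sqr_ge0.
Qed.

Lemma flow_continuous t : 0 <= t <= T -> continuous (X t).
Proof. by have [_ lX _ _] := flowX => tT; apply: (lip_continuous (L := Ek)) => x y; exact: lX. Qed.

Lemma quad_flow f t : quad f -> 0 <= t <= T -> quad (fun x => f (X t x)).
Proof.
move=> [cf [a [b [a0 b0 H]]]] tT; split.
  by move=> x; exact: (continuous_comp (flow_continuous tT (x := x)) (cf (X t x))).
pose k := b * (d%:R * c ^+ 2).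
have k0 : 0 <= k by rewrite mulr_ge0 // mulr_ge0 // sqr_ge0.
exists (a + k * 2), (k * 2); split; rewrite ?addr_ge0 ?mulr_ge0 // => x.
apply: le_trans (H _) _; rewrite -addrA lerD2l.
apply: le_trans (_ : k * (1 + `|x|) ^+ 2 <= _).
  rewrite /k -mulrA ler_wpM2l // enormE.
  have -> : d%:R * c ^+ 2 * (1 + `|x|) ^+ 2 = \sum_(i < d) (c * (1 + `|x|)) ^+ 2.
    by rewrite sumr_const card_ord exprMn -[LHS]mulrA mulr_natl.
  apply: ler_sum => i _; rewrite -[leLHS]real_normK ?num_real //.
  rewrite lerXn2r ?nnegrE ?mulr_ge0 // (le_trans (le_cV_norm _ _)) //; exact: X_growth.
have -> : k * 2 + k * 2 * enorm x ^+ 2 = k * (2 + 2 * enorm x ^+ 2) by ring.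
rewrite ler_wpM2l //.
by have := norm2_enorm2 x; have := sqr_ge0 (`|x| - 1); nra.
Qed.

Lemma bmeas_lipschitz (h : R -> R) (C : R) :
  (forall s t, 0 <= s -> s <= t -> t <= T -> `|h t - h s| <= C * (t - s)) -> bmeas T h.
Proof.
move=> Lh; apply: bmeas_continuous; apply/subspace_continuousP => t /=; rewrite in_itv /= => tT.
have C' : 0 < `|C| + 1 by rewrite ltr_wpDl.
have H s : 0 <= s <= T -> `|h t - h s| <= (`|C| + 1) * `|t - s|.
  move=> /andP[s0 sT]; have [t0 tT'] := andP tT.
  have CC : C <= `|C| + 1 by rewrite (le_trans (ler_norm C)) // lerDl.
  have [st|ts] := leP s t.
    have ts : 0 <= t - s by rewrite subr_ge0.
    by apply: le_trans (Lh s t s0 st tT') _; rewrite (ger0_norm ts); exact: ler_wpM2r.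
  rewrite distrC [X in _ <= _ * X]distrC; apply: le_trans (Lh t s t0 (ltW ts) sT) _.
  have st : 0 <= s - t by rewrite subr_ge0 ltW.
  by rewrite (ger0_norm st); exact: ler_wpM2r.
apply/cvgrPdist_lt => e e0; rewrite /= near_withinE; near=> s; rewrite /= in_itv /= => sT.
apply: le_lt_trans (H s sT) _; rewrite -ltr_pdivlMl //.
near: s; apply/nbhs_ballP; exists ((`|C| + 1)^-1 * e) => /=; first by rewrite mulr_gt0 ?invr_gt0.
by move=> s; rewrite -ball_normE.
Unshelve. all: by end_near. Qed.

Section weak.
Variables (phi : E -> R) (L D : R).
Hypotheses (sphi : smooth phi) (L0 : 0 <= L) (D0 : 0 <= D).
Hypothesis HL : forall t x v, 0 <= t <= T -> `|'D_v phi (t, x)| <= L * `|v|.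
Hypothesis HD : forall t s x y v, 0 <= t <= T -> 0 <= s <= T ->
    `|'D_v phi (t, x) - 'D_v phi (s, y)| <= D * `|((t - s, x - y) : E)| * `|v|.

(** With [a = 1] and [v] the value of the field this is the integrand of the weak equation, time
    derivative plus gradient term. *)
Let dir (a : R) (v : 'cV[R]_d) (s : R) (x : 'cV[R]_d) : R := 'D_((a, v) : E) phi (s, x).

Let dirB a a' v v' s x : dir a v s x - dir a' v' s x = dir (a - a') (v - v') s x.
Proof. by rewrite /dir -(smooth_deriveB _ _ _ sphi). Qed.

Let dirE a v s x : dir a v s x = a * dir 1 0 s x + \sum_i v i 0 * dir 0 (delta_mx i 0) s x.
Proof. by rewrite /dir (derive_pairE _ _ sphi). Qed.

Let dir_le a v s x : 0 <= s <= T -> `|dir a v s x| <= L * (`|a| + `|v|).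
Proof.
move=> sT; apply: le_trans (HL x (a, v) sT) _; rewrite ler_wpM2l //.
by apply: norm_pair; rewrite ?lerDl ?lerDr.
Qed.

Let dir_cont a v s : 0 <= s <= T -> continuous (fun x => dir a v s (X s x)).
Proof.
move=> sT; have [_ lX _ _] := flowX.
apply: (lip_continuous (L := D * Ek * `|((a, v) : E)|)) => x y.
apply: le_trans (HD (X s x) (X s y) (a, v) sT sT) _.
rewrite [leRHS]mulrAC; apply: ler_wpM2r => //; rewrite -mulrA; apply: ler_wpM2l => //.
by rewrite subrr; apply: norm_pair; [rewrite normr0 mulr_ge0 ?expR_ge0 | exact: lX].
Qed.

Lemma quad_direction a (b : 'cV[R]_d -> 'cV[R]_d) kap s : 0 <= s <= T ->
  (forall x y, `|b x - b y| <= kap * `|x - y|) -> quad (fun x => 'D_((a, b x) : E) phi (s, x)).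
Proof.
move=> sT bl; have dc a' v : continuous (dir a' v s).
  apply: (lip_continuous (L := D * `|((a', v) : E)|)) => x y.
  apply: le_trans (HD x y (a', v) sT sT) _.
  rewrite [leRHS]mulrAC; apply: ler_wpM2r => //; apply: ler_wpM2l => //.
  by rewrite subrr; apply: norm_pair; rewrite ?normr0.
have -> : (fun x => 'D_((a, b x) : E) phi (s, x)) =
   (fun x => a * dir 1 0 s x + \sum_i b x i 0 * dir 0 (delta_mx i 0) s x).
  by apply/funext => x; rewrite -dirE.
apply: quad_add.
  apply: quad_scale; apply: (quad_bounded (C := L * (`|1| + `|0 : 'cV[R]_d|))); first exact: dc.
  by move=> x; exact: dir_le.
apply: quad_sum => i; apply: (quad_mul_bounded (C := L * (`|0| + `|delta_mx i 0 : 'cV[R]_d|))).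
- apply: (quad_lip (L := kap)) => x y; apply: le_trans (bl x y).
  by have := le_cV_norm (b x - b y) i; rewrite !mxE.
- exact: dc.
- by move=> x; exact: dir_le.
Qed.

Lemma quad_dir a (b : 'cV[R]_d -> 'cV[R]_d) kap s : 0 <= s <= T ->
  (forall x y, `|b x - b y| <= kap * `|x - y|) -> quad (fun x => dir a (b (X s x)) s (X s x)).
Proof. by move=> sT bl; exact: (quad_flow (quad_direction a sT bl) sT). Qed.

Let J (s r : R) : R := ex mu0 (fun x => dir 1 (V r (X s x)) s (X s x)).

Let smooth_base s : R := ex mu0 (fun x => dir 1 0 s (X s x)).

Let pair_of (I : finType) (psi : I -> 'cV[R]_d -> R) k i s : R :=
  ex mu0 (fun x => psi k (X s x) * dir 0 (delta_mx i 0) s (X s x)).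

Let step_le s t x : 0 <= s -> s <= t -> t <= T ->
  `|((t - s, X t x - X s x) : E)| <= (1 + c) * (1 + `|x|) * (t - s).
Proof.
move=> s0 st tT; have ts : 0 <= t - s by rewrite subr_ge0.
have cw : 0 <= c * (1 + `|x|) by rewrite mulr_ge0.
rewrite mulrDl mul1r; apply: norm_pair.
  rewrite ger0_norm // ler_peMl // (le_trans (w1 x)) // lerDl //.
by apply: le_trans (X_speed x s0 st tT) _; rewrite ler_wpM2r // lerDr.
Qed.

Lemma dir_time_lip a v s t x : 0 <= s -> s <= t -> t <= T ->
  `|dir a v t (X t x) - dir a v s (X s x)| <= D * (1 + c) * (`|a| + `|v|) * (1 + `|x|) * (t - s).
Proof.
move=> s0 st tT.
have tI : 0 <= t <= T by rewrite (le_trans s0 st).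
have sI : 0 <= s <= T by rewrite s0 (le_trans st).
apply: le_trans (HD (X t x) (X s x) (a, v) tI sI) _.
have -> : D * (1 + c) * (`|a| + `|v|) * (1 + `|x|) * (t - s) =
  D * ((1 + c) * (1 + `|x|) * (t - s)) * (`|a| + `|v|) by ring.
rewrite ler_pM ?mulr_ge0 // ?ler_wpM2l // ?step_le //.
by apply: norm_pair; rewrite ?lerDl ?lerDr.
Qed.

Let quad_base s : 0 <= s <= T -> quad (fun x => dir 1 0 s (X s x)).
Proof.
move=> sT; apply: (quad_bounded (C := L * (`|1| + `|0 : 'cV[R]_d|))); first exact: dir_cont.
by move=> x; exact: dir_le.
Qed.

Lemma base_bmeas : bmeas T smooth_base.
Proof.
apply: (@bmeas_lipschitz _ (D * (1 + c) * (`|1| + `|0 : 'cV[R]_d|) * I2)) => s t s0 st tT.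
have tI : 0 <= t <= T by rewrite (le_trans s0 st).
have sI : 0 <= s <= T by rewrite s0 (le_trans st).
have ts : 0 <= t - s by rewrite subr_ge0.
have qt := quad_base tI; have qs := quad_base sI.
rewrite -(exB m20 qt qs) mulrAC.
apply: (ex_weight_le m20).
  by have := quad_add qt (quad_scale (-1) qs); under eq_fun do rewrite mulN1r.
move=> x; apply: le_trans (dir_time_lip _ _ x s0 st tT) _.
rewrite mulrAC; apply: ler_wpM2l => //.
exact: mulr_ge0 (mulr_ge0 (mulr_ge0 D0 (addr_ge0 ler01 c0)) (addr_ge0 (normr_ge0 _) (normr_ge0 _))) ts.
Qed.

Section smoothing.
Variables (I : finType) (psi : I -> 'cV[R]_d -> R) (node : I -> 'cV[R]_d) (B A eta r0 : R).
Hypotheses (B0 : 0 <= B) (r00 : 0 < r0) (Cpsi : forall k, C2b (psi k) B A).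
Hypotheses (psi0 : forall k x, 0 <= psi k x) (psi1 : forall x, \sum_k psi k x = 1).
Hypothesis (close : forall k x, psi k x != 0 -> `|x - node k| <= eta + `|x| ^+ 2 / r0).

Let pair := pair_of psi.

Let quad_pair k i s : 0 <= s <= T -> quad (fun x => psi k (X s x) * dir 0 (delta_mx i 0) s (X s x)).
Proof.
move=> sT; apply: (quad_mul_bounded (C := L * (`|0| + `|delta_mx i 0 : 'cV[R]_d|))).
- by apply: (@quad_flow (psi k) s _ sT); apply: (quad_lip (L := B)) => x y; exact: (C2b_lip x y (Cpsi k)).
- exact: dir_cont.
- by move=> x; exact: dir_le.
Qed.

Lemma smoothed_direction a (b : 'cV[R]_d -> 'cV[R]_d) kap s : 0 <= s <= T -> 0 <= kap ->
  (forall x y, `|b x - b y| <= kap * `|x - y|) ->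
  `|ex mu0 (fun x => dir a (b (X s x)) s (X s x)) -
    (a * smooth_base s + \sum_k \sum_i b (node k) i 0 * pair k i s)| <= L * kap * (eta + c ^+ 2 * I2 / r0).
Proof.
move=> sT kap0 bl.
have qs : quad (fun x => a * dir 1 0 s (X s x) +
   \sum_k \sum_i b (node k) i 0 * (psi k (X s x) * dir 0 (delta_mx i 0) s (X s x))).
  apply: quad_add; first exact: (quad_scale _ (quad_base sT)).
  by apply: quad_sum => k; apply: quad_sum => i; exact: (quad_scale _ (quad_pair k i sT)).
have -> : a * smooth_base s + \sum_k \sum_i b (node k) i 0 * pair k i s =
   ex mu0 (fun x => a * dir 1 0 s (X s x) +
   \sum_k \sum_i b (node k) i 0 * (psi k (X s x) * dir 0 (delta_mx i 0) s (X s x))).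
  have qki k i := quad_scale (b (node k) i 0) (quad_pair k i sT).
  have qk k := quad_sum (fun i => qki k i).
  rewrite (exD m20 (quad_scale a (quad_base sT)) (quad_sum qk)) (exZ m20 _ (quad_base sT)); congr (_ + _).
  rewrite (ex_sum m20 qk); apply: eq_bigr => k _; rewrite (ex_sum m20 (fun i => qki k i)).
  by apply: eq_bigr => i _; rewrite (exZ m20 _ (quad_pair k i sT)).
have qd := quad_dir a sT bl.
rewrite -(exB m20 qd qs).
have Lk : 0 <= L * kap by rewrite mulr_ge0.
have qd' : quad (fun x => dir a (b (X s x)) s (X s x) - (a * dir 1 0 s (X s x) +
   \sum_k \sum_i b (node k) i 0 * (psi k (X s x) * dir 0 (delta_mx i 0) s (X s x)))).
  by have := quad_add qd (quad_scale (-1) qs); under eq_fun do rewrite mulN1r.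
pose g x := L * kap * eta + L * kap * (c ^+ 2 / r0) * (1 + `|x : 'cV[R]_d|) ^+ 2.
have qg : quad g by apply: quad_add; [exact: quad_cst | exact: (quad_scale _ quad_weight)].
have -> : L * kap * (eta + c ^+ 2 * I2 / r0) = ex mu0 g.
  rewrite (exD m20 (quad_cst _) (quad_scale _ quad_weight)) (exZ m20 _ quad_weight) ex_cst -/I2.
  by ring.
apply: (ex_norm_le m20 qd' qg) => x.
have -> : a * dir 1 0 s (X s x) + \sum_k \sum_i b (node k) i 0 * (psi k (X s x) * dir 0 (delta_mx i 0) s (X s x)) =
   dir a (\sum_k psi k (X s x) *: b (node k)) s (X s x).
  rewrite [RHS]dirE; congr (_ + _); rewrite exchange_big; apply: eq_bigr => i _.
  rewrite summxE mulr_suml; apply: eq_bigr => k _; rewrite !mxE; ring.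
rewrite dirB subrr; apply: le_trans (dir_le _ _ _ sT) _; rewrite normr0 add0r.
apply: le_trans (ler_wpM2l L0 (smoothing_error (X s x) kap0 psi0 psi1 close bl)) _.
have -> : g x = L * (kap * (eta + (c * (1 + `|x|)) ^+ 2 / r0)) by rewrite /g; ring.
rewrite !ler_wpM2l // lerD2l ler_wpM2r ?invr_ge0 ?(ltW r00) //.
by rewrite lerXn2r ?nnegrE ?mulr_ge0 // X_growth.
Qed.

Lemma pair_bmeas k i : bmeas T (pair k i).
Proof.
pose l := `|0 : R| + `|delta_mx i 0 : 'cV[R]_d|.
apply: (@bmeas_lipschitz _ ((B * c * (L * l) + D * (1 + c) * l) * I2)) => s t s0 st tT.
have tI : 0 <= t <= T by rewrite (le_trans s0 st).
have sI : 0 <= s <= T by rewrite s0 (le_trans st).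
have ts : 0 <= t - s by rewrite subr_ge0.
have qt := quad_pair k i tI; have qs := quad_pair k i sI.
rewrite -(exB m20 qt qs) mulrAC.
have l0 : 0 <= l by rewrite addr_ge0.
have C1 : 0 <= B * c * (L * l) by rewrite !mulr_ge0.
have C2 : 0 <= D * (1 + c) * l by rewrite !mulr_ge0 // addr_ge0.
apply: (ex_weight_le m20).
  by have := quad_add qt (quad_scale (-1) qs); under eq_fun do rewrite mulN1r.
move=> x.
have -> : psi k (X t x) * dir 0 (delta_mx i 0) t (X t x) - psi k (X s x) * dir 0 (delta_mx i 0) s (X s x) =
  (psi k (X t x) - psi k (X s x)) * dir 0 (delta_mx i 0) t (X t x) +
  psi k (X s x) * (dir 0 (delta_mx i 0) t (X t x) - dir 0 (delta_mx i 0) s (X s x)) by ring.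
apply: le_trans (ler_normD _ _) _.
apply: le_trans (_ : (B * c * (L * l) + D * (1 + c) * l) * (t - s) * (1 + `|x|) <= _); last first.
  by rewrite ler_wpM2l // mulr_ge0 // addr_ge0.
have -> : (B * c * (L * l) + D * (1 + c) * l) * (t - s) * (1 + `|x|) =
  B * (c * (1 + `|x|) * (t - s)) * (L * l) + D * (1 + c) * l * (1 + `|x|) * (t - s) by ring.
apply: lerD; rewrite normrM.
  rewrite ler_pM //; last exact: dir_le.
  apply: le_trans (C2b_lip _ _ (Cpsi k)) _; rewrite ler_wpM2l //; exact: X_speed.
rewrite -[leRHS]mul1r ler_pM //; last exact: dir_time_lip.
exact: psi_le1.
Qed.

End smoothing.

Let L_K : 0 <= L * K. Proof. exact: mulr_ge0. Qed.
Let c2I : 0 <= c ^+ 2 * I2. Proof. by rewrite mulr_ge0 ?sqr_ge0. Qed.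

Let smoothed_bmeas (I : finType) (node : I -> 'cV[R]_d) (p : I -> 'I_d -> R -> R) (b : R -> R) :
  bmeas T b -> (forall k i, bmeas T (p k i)) ->
  bmeas T (fun r => 1 * b r + \sum_k \sum_i V r (node k) i 0 * p k i r).
Proof.
have [_ _ mV _ _] := okV => bb bp; apply: (bmeasD (bmeasZ 1 bb) _).
by apply: bmeas_sum => k; apply: bmeas_sum => i; exact: (bmeasM (mV (node k) i) (bp k i)).
Qed.

Lemma diagonal_bmeas : bmeas T (fun r => J r r).
Proof.
have [_ _ mV lV _] := okV; have [C C0 part] := @partition_of_unity R d.
apply: bmeas_lim => e e0.
have [eta [r [eta0 _ r0 small]]] := small_errors c2I L_K e0.
have [I [psi [node [B [A [[B0 A0 Cpsi] [psi0 psi1 close _ _]]]]]]] := part eta r eta0 r0.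
exists (fun u => 1 * smooth_base u + \sum_k \sum_i V u (node k) i 0 * pair_of psi k i u).
  exact: (smoothed_bmeas node base_bmeas (fun k i => pair_bmeas B0 Cpsi psi0 psi1 k i)).
move=> u uT.
exact: le_trans (smoothed_direction r0 Cpsi psi0 psi1 close 1 uT K0 (lV u uT)) small.
Qed.

Lemma frozen_bmeas s : 0 <= s <= T -> bmeas T (J s).
Proof.
have [_ _ mV lV _] := okV => sT; have [C C0 part] := @partition_of_unity R d.
apply: bmeas_lim => e e0.
have [eta [r [eta0 _ r0 small]]] := small_errors c2I L_K e0.
have [I [psi [node [B [A [[B0 A0 Cpsi] [psi0 psi1 close _ _]]]]]]] := part eta r eta0 r0.
exists (fun u => 1 * smooth_base s + \sum_k \sum_i V u (node k) i 0 * pair_of psi k i s).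
  exact: (smoothed_bmeas node (bmeas_cst T (smooth_base s)) (fun k i => bmeas_cst T (pair_of psi k i s))).
move=> u uT.
exact: le_trans (smoothed_direction r0 Cpsi psi0 psi1 close 1 sT K0 (lV u uT)) small.
Qed.

(** An exchange of the integrals over [mu0] and over time. It rests on the expansion at the nodes,
    where only finite sums are exchanged, and not on joint measurability of the integrand. *)
Lemma frozen_integral s t : 0 <= s -> s <= t -> t <= T ->
  ex mu0 (fun x => dir (t - s) (incr V s t (X s x)) s (X s x)) = tint s t (J s).
Proof.
move=> s0 st tT; have [_ _ mV lV _] := okV; have [C C0 part] := @partition_of_unity R d.
have sI : 0 <= s <= T by rewrite s0 (le_trans st).
have ts : 0 <= t - s by rewrite subr_ge0.
apply/eqP; rewrite -subr_eq0 -normr_le0; apply/ler_addgt0Pl => e e0; rewrite addr0.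
(* The factor 2 counts two smoothing errors: that of [incr V s t], and that of [V] under the time
   integral. *)
have k0 : 0 <= 2 * (L * (K * (t - s))) by rewrite !mulr_ge0.
have [eta [r [eta0 _ r0 small]]] := small_errors c2I k0 e0.
have [I [psi [node [B [A [[B0 A0 Cpsi] [psi0 psi1 close _ _]]]]]]] := part eta r eta0 r0.
have Kts : 0 <= K * (t - s) by rewrite mulr_ge0.
have e1 := smoothed_direction r0 Cpsi psi0 psi1 close (t - s) sI Kts (fun x y => incr_lip okV x y s0 st tT).
pose p k i := pair_of psi k i s.
pose W u := 1 * smooth_base s + \sum_k \sum_i V u (node k) i 0 * p k i.
have bw k i : bmeas T (fun u => V u (node k) i 0 * p k i) := bmeasM (mV (node k) i) (bmeas_cst T (p k i)).
have bw' k : bmeas T (fun u => \sum_i V u (node k) i 0 * p k i) := bmeas_sum (bw k).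
have bW : bmeas T W := bmeasD (bmeas_cst T _) (bmeas_sum bw').
have eW : tint s t W = (t - s) * smooth_base s + \sum_k \sum_i incr V s t (node k) i 0 * p k i.
  rewrite /W (tintD (bmeas_cst T _) (bmeas_sum bw') s0 tT) (tint_cst _ st) mul1r mulrC; congr (_ + _).
  rewrite (tint_sum bw' s0 st tT); apply: eq_bigr => k _.
  rewrite (tint_sum (bw k) s0 st tT); apply: eq_bigr => i _.
  by rewrite mxE [RHS]mulrC -(tintZ _ (mV (node k) i) s0 tT); apply: tint_eq => u _; rewrite mulrC.
have bJ := frozen_bmeas sI.
have e2 : `|tint s t W - tint s t (J s)| <= L * K * (eta + c ^+ 2 * I2 / r) * (t - s).
  rewrite -(tintB bW bJ s0 tT); apply: (tint_norm_le (bmeasB bW bJ) s0 st tT) => u /andP[su ut].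
  have uT : 0 <= u <= T by rewrite (le_trans s0 (ltW su)) (le_trans ut tT).
  rewrite distrC; exact: (smoothed_direction r0 Cpsi psi0 psi1 close 1 sI K0 (lV u uT)).
rewrite -eW in e1.
apply: le_trans (ler_distD (tint s t W) _ _) _; apply: le_trans (lerD e1 e2) _; apply: le_trans small.
by rewrite le_eqVlt; apply/orP; left; apply/eqP; ring.
Qed.

Let phi_lip t x y : 0 <= t <= T -> `|phi (t, x) - phi (t, y)| <= L * `|x - y|.
Proof.
move=> tT; apply: le_trans (@segment_MVT _ _ T _ (t, y) (t, x) L sphi tT tT HL) _.
rewrite ler_wpM2l //.
have -> : ((t, x) : E) - (t, y) = (t - t, x - y) by [].
by rewrite subrr; apply: norm_pair; rewrite ?normr0.
Qed.

Lemma quad_test t : 0 <= t <= T -> quad (fun x => phi (t, X t x)).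
Proof.
move=> tT; apply: (@quad_flow (fun x => phi (t, x)) t _ tT).
by apply: (quad_lip (L := L)) => x y; exact: phi_lip.
Qed.

Let incr_lin s t : 0 <= s <= T -> 0 <= s -> s <= t -> t <= T ->
  quad (fun x => dir (t - s) (incr V s t (X s x)) s (X s x)).
Proof.
move=> sI s0 st tT; apply: (quad_dir (kap := K * (t - s)) _ sI) => x y; exact: (incr_lip okV x y s0 st tT).
Qed.

(** Taylor's formula for [phi] between two space-time points of a trajectory, after which [X_local]
    replaces the displacement by the increment of the field; both errors are quadratic in
    [t - s]. *)
Lemma test_increment s t : 0 <= s -> s <= t -> t <= T ->
  `|ex mu0 (fun x => phi (t, X t x)) - ex mu0 (fun x => phi (s, X s x)) - tint s t (J s)| <=
  (D * (1 + c) ^+ 2 + L * c) * (t - s) ^+ 2 * I2.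
Proof.
move=> s0 st tT; rewrite -(frozen_integral s0 st tT).
have tI : 0 <= t <= T by rewrite (le_trans s0 st).
have sI : 0 <= s <= T by rewrite s0 (le_trans st).
have ts : 0 <= t - s by rewrite subr_ge0.
have qB f1 f2 : quad f1 -> quad f2 -> quad (fun x : 'cV[R]_d => f1 x - f2 x).
  by move=> q1 q2; have := quad_add q1 (quad_scale (-1) q2); under eq_fun do rewrite mulN1r.
have q1 := qB _ _ (quad_test tI) (quad_test sI); have q2 := incr_lin sI s0 st tT.
rewrite -(exB m20 (quad_test tI) (quad_test sI)) -(exB m20 q1 q2).
apply: (ex_weight_le m20 (qB _ _ q1 q2)) => x.
have tay := @segment_taylor _ _ T phi D t s (X t x) (X s x) sphi D0 tI sI HD.
have st2 := step_le x s0 st tT.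
have -> : phi (t, X t x) - phi (s, X s x) - dir (t - s) (incr V s t (X s x)) s (X s x) =
  (phi (t, X t x) - phi (s, X s x) - dir (t - s) (X t x - X s x) s (X s x)) +
  dir 0 (X t x - X s x - incr V s t (X s x)) s (X s x).
  have -> : dir 0 (X t x - X s x - incr V s t (X s x)) s (X s x) =
     dir (t - s) (X t x - X s x) s (X s x) - dir (t - s) (incr V s t (X s x)) s (X s x) by rewrite dirB subrr.
  by rewrite addrA subrK.
apply: le_trans (ler_normD _ _) _.
have -> : (D * (1 + c) ^+ 2 + L * c) * (t - s) ^+ 2 * (1 + `|x|) ^+ 2 =
   D * ((1 + c) * (1 + `|x|) * (t - s)) ^+ 2 + L * (c * (1 + `|x|) ^+ 2 * (t - s) ^+ 2) by ring.
apply: lerD.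
  by apply: le_trans tay _; rewrite ler_wpM2l // lerXn2r ?nnegrE // (le_trans _ st2).
apply: le_trans (dir_le _ _ _ sI) _; rewrite normr0 add0r ler_wpM2l //.
apply: le_trans (X_local x s0 st tT) _; rewrite ler_wpM2r ?sqr_ge0 // ler_wpM2l //.
Qed.

Lemma frozen_error s r : 0 <= s -> s <= r -> r <= T ->
  `|J s r - J r r| <= (D * (1 + c) * (1 + (M + K * c)) + L * (K * c)) * (r - s) * I2.
Proof.
move=> s0 sr rT; have [_ _ _ lV V0] := okV.
have rI : 0 <= r <= T by rewrite (le_trans s0 sr).
have sI : 0 <= s <= T by rewrite s0 (le_trans sr).
have rs : 0 <= r - s by rewrite subr_ge0.
have q1 := quad_dir 1 sI (lV r rI); have q2 := quad_dir 1 rI (lV r rI).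
rewrite distrC -(exB m20 q2 q1); apply: (ex_weight_le m20).
  by have := quad_add q2 (quad_scale (-1) q1); under eq_fun do rewrite mulN1r.
move=> x.
have -> : dir 1 (V r (X r x)) r (X r x) - dir 1 (V r (X s x)) s (X s x) =
  (dir 1 (V r (X r x)) r (X r x) - dir 1 (V r (X r x)) s (X s x)) + dir 0 (V r (X r x) - V r (X s x)) s (X s x).
  have -> : dir 0 (V r (X r x) - V r (X s x)) s (X s x) =
     dir 1 (V r (X r x)) s (X s x) - dir 1 (V r (X s x)) s (X s x) by rewrite dirB subrr.
  by rewrite addrA subrK.
apply: le_trans (ler_normD _ _) _.
have -> : (D * (1 + c) * (1 + (M + K * c)) + L * (K * c)) * (r - s) * (1 + `|x|) ^+ 2 =
  D * (1 + c) * ((1 + (M + K * c)) * (1 + `|x|)) * (1 + `|x|) * (r - s) +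
  L * (K * (c * (1 + `|x|) ^+ 2 * (r - s))) by ring.
have Dc : 0 <= D * (1 + c) by rewrite mulr_ge0 // addr_ge0.
apply: lerD.
  apply: le_trans (dir_time_lip _ _ x s0 sr rT) _.
  apply: ler_wpM2r => //; apply: ler_wpM2r => //; apply: ler_wpM2l => //.
  rewrite normr1 mulrDl mul1r; apply: lerD; first exact: w1.
  apply: le_trans (lip_growth (V0 r rI) (lV r rI) (X r x)) _.
  rewrite mulrDl; apply: lerD; first by rewrite ler_peMr.
  by rewrite -mulrA ler_wpM2l // X_growth.
apply: le_trans (dir_le _ _ _ sI) _; rewrite normr0 add0r ler_wpM2l //.
apply: le_trans (lV r rI _ _) _; rewrite ler_wpM2l //.
apply: le_trans (X_speed x s0 sr rT) _; rewrite ler_wpM2r // ler_wpM2l //.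
Qed.

Lemma weak_balance :
  ex mu0 (fun x => phi (T, X T x)) - ex mu0 (fun x => phi (0, x)) = tint 0 T (fun r => J r r).
Proof.
have [X0 _ _ _] := flowX.
have bD := diagonal_bmeas.
pose G t := ex mu0 (fun x => phi (t, X t x)) - tint 0 t (fun r => J r r).
pose C := (D * (1 + c) ^+ 2 + L * c) * I2 + (D * (1 + c) * (1 + (M + K * c)) + L * (K * c)) * I2.
have GG : G T = G 0.
  apply: (telescoping_const (C := C) (ltW T0)) => s t s0 st tT.
  have sI : 0 <= s <= T by rewrite s0 (le_trans st).
  have ts : 0 <= t - s by rewrite subr_ge0.
  have bJ := frozen_bmeas sI.
  have e1 := test_increment s0 st tT.
  have e2 : `|tint s t (J s) - tint s t (fun r => J r r)| <=
     (D * (1 + c) * (1 + (M + K * c)) + L * (K * c)) * (t - s) * I2 * (t - s).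
    rewrite -(tintB bJ bD s0 tT); apply: (tint_norm_le (bmeasB bJ bD) s0 st tT) => u /andP[su ut].
    apply: le_trans (frozen_error s0 (ltW su) (le_trans ut tT)) _.
    rewrite ler_wpM2r // ler_wpM2l ?lerD2r //.
    exact: addr_ge0 (mulr_ge0 (mulr_ge0 D0 (addr_ge0 ler01 c0)) (addr_ge0 ler01 (addr_ge0 M0 (mulr_ge0 K0 c0))))
      (mulr_ge0 L0 (mulr_ge0 K0 c0)).
  rewrite /G (tint_add bD (lexx 0) s0 st tT).
  apply: le_trans (balance _ e1 e2) _.
  by rewrite /C le_eqVlt; apply/orP; left; apply/eqP; ring.
have -> : ex mu0 (fun x => phi (0, x)) = ex mu0 (fun x => phi (0, X 0 x)).
  by congr (ex mu0 _); apply/funext => x; rewrite X0.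
have t00 : tint 0 0 (fun r => J r r) = 0.
  apply/eqP; rewrite -normr_le0; have := tint_norm_le bD (lexx 0) (lexx 0) (ltW T0) (C := 0).
  rewrite subrr mulr0; apply.
  by move=> u /andP[u0 u1]; have := lt_le_trans u0 u1; rewrite ltxx.
by move: GG; rewrite /G t00 subr0 => <-; rewrite opprB addrC subrK.
Qed.

End weak.
End existence.

(** * The image of the initial measure under the flow *)

Section flow_solution.
Context {R : realType} {d : nat}.
Variables (T M K : R) (V : R -> 'cV[R]_d -> 'cV[R]_d) (mu0 : probability (borelRd R d) R).
Hypotheses (T0 : 0 < T) (okV : admissible T V M K) (m20 : finite_second_moment mu0).
Variables (X : R -> 'cV[R]_d -> 'cV[R]_d).
Hypothesis (flowX : flow_of T M K V X).

Local Notation E := (R * 'cV[R]_d)%type.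

Theorem flow_weak_solution : exists nu : R -> probability (borelRd R d) R,
  weak_solution T V mu0 nu /\
  forall t, 0 <= t <= T -> forall A : set (borelRd R d), measurable A -> nu t A = mu0 (X t @^-1` A).
Proof.
have [c [c0 X_growth X_speed X_local]] := flow_growth T0 okV flowX.
(* Times outside [0, T] receive [mu0] as a default value. *)
have ex_nu t : exists Q : probability (borelRd R d) R, 0 <= t <= T ->
    forall A : set (borelRd R d), measurable A -> Q A = mu0 (X t @^-1` A).
  have [tT|tT] := boolP (0 <= t <= T); last by exists mu0 => //.
  have cX := flow_continuous flowX tT.
  by have [Q HQ] := pushforward_exists mu0 (measurable_continuous_map cX); exists Q.
have [nu Hnu] := choice ex_nu; exists nu; split; last exact: Hnu.
have cX t : 0 <= t <= T -> continuous (X t) := fun tT => flow_continuous flowX tT.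
have mX t tT := measurable_continuous_map (cX t tT).
have push t (tT : 0 <= t <= T) (A : set (borelRd R d)) : measurable A -> mu0 (X t @^-1` A) = nu t A.
  by move=> mA; rewrite Hnu.
have qflow f t qf tT := @quad_flow R d T M K V X c flowX c0 X_growth f t qf tT.
have m2 t : 0 <= t <= T -> finite_second_moment (nu t).
  move=> tT; rewrite /finite_second_moment (ge0_transfer (mX t tT) (push t tT)).
  - by rewrite (EFin_ex m20 (qflow _ _ (@quad_enorm2 R d) tT)) ltry.
  - by apply/measurable_EFinP; exact: (continuous_borel (@continuous_enorm2 R d)).
  - by move=> y; rewrite lee_fin sqr_ge0.
have ex_push t f : 0 <= t <= T -> quad f -> ex (nu t) f = ex mu0 (fun x => f (X t x)).
  by move=> tT qf; exact: (transfer_Rintegral (mX t tT) (push t tT) (quad_integrable (m2 t tT) qf)).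
have w0 (x : 'cV[R]_d) : 0 <= 1 + `|x| by rewrite addr_ge0.
split.
  split=> t; rewrite in_itv /= => tT; first exact: m2.
  pose I2 := ex mu0 (fun x => (1 + `|x|) ^+ 2).
  have I20 : 0 <= I2.
    rewrite -(ex_cst mu0 0); apply: (ex_le m20 (quad_cst 0) quad_weight) => x; exact: sqr_ge0.
  (* Adding 1 avoids a square root, since z <= (z + 1)^2 for z >= 0. *)
  pose C := d%:R * c ^+ 2 * I2 + 1.
  have C0 : 0 <= d%:R * c ^+ 2 * I2 by rewrite !mulr_ge0 // sqr_ge0.
  have C1 : 0 <= C by rewrite addr_ge0.
  have W s : 0 <= s <= T -> (W2 (nu s) (nu t) <= (C * `|s - t|)%:E)%E.
    move=> sT; apply: (W2_pushforward (mu := mu0) _ (cX s sT) (cX t tT) (Hnu s sT) (Hnu t tT)).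
      exact: mulr_ge0.
    have dist x : `|X s x - X t x| <= c * (1 + `|x|) * `|s - t|.
      have [/andP[s0 sT'] /andP[t0 tT']] := (sT, tT).
      have [st|ts] := leP s t.
        have h : 0 <= t - s by rewrite subr_ge0.
        by rewrite distrC [X in _ <= _ * X]distrC (ger0_norm h); exact: X_speed.
      have h : 0 <= s - t by rewrite subr_ge0 ltW.
      by rewrite (ger0_norm h); apply: X_speed => //; exact: ltW.
    have qb := quad_scale (d%:R * c ^+ 2 * (s - t) ^+ 2) (@quad_weight R d).
    apply: (@le_trans _ _ (\int[mu0]_x (d%:R * c ^+ 2 * (s - t) ^+ 2 * (1 + `|x : 'cV[R]_d|) ^+ 2)%:E)%E).
      apply: ge0_le_integral => //.
      - by move=> x _; rewrite lee_fin sqr_ge0.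
      - apply/measurable_EFinP.
        have cF : continuous (fun x => X s x - X t x).
          by move=> x; exact: (cvgB (cX s sT x) (cX t tT x)).
        apply: continuous_borel => x.
        exact: (continuous_comp (cF x) (@continuous_enorm2 R d (X s x - X t x))).
      - by apply/measurable_EFinP; exact: (continuous_borel qb.1).
      move=> x _; rewrite lee_fin enormE.
      have -> : d%:R * c ^+ 2 * (s - t) ^+ 2 * (1 + `|x|) ^+ 2 = \sum_(i < d) (c * (1 + `|x|) * `|s - t|) ^+ 2.
        have -> : (c * (1 + `|x|) * `|s - t|) ^+ 2 = c ^+ 2 * (1 + `|x|) ^+ 2 * (s - t) ^+ 2.
          by rewrite !exprMn real_normK ?num_real.
        rewrite sumr_const card_ord -[RHS]mulr_natl; ring.
      apply: ler_sum => i _; rewrite -[leLHS]real_normK ?num_real //.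
      rewrite lerXn2r ?nnegrE ?mulr_ge0 //.
      by apply: le_trans (le_cV_norm _ _) _; exact: dist.
    rewrite (EFin_ex m20 qb) (exZ m20 _ quad_weight) -/I2 lee_fin.
    have -> : d%:R * c ^+ 2 * (s - t) ^+ 2 * I2 = (d%:R * c ^+ 2 * I2) * (s - t) ^+ 2 by ring.
    rewrite exprMn real_normK ?num_real // ler_wpM2r ?sqr_ge0 //.
    by rewrite /C; move: C0; set z := _ * I2 => C0; nra.
  apply: (@squeeze_cvge _ _ _ _ (fun=> 0%E) _ (fun s => (C * `|s - t|)%:E)).
  - near=> s; rewrite W2_ge0 /=; apply: W.
    by near: s; apply: withinT; exact: nbhs_filter.
  - exact: cvg_cst.
  - apply: cvg_EFin; first exact: nearW.
    have cc : continuous (fun s : R => C * `|s - t|).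
      apply: (lip_continuous (L := C)) => a b; rewrite -mulrBr normrM (ger0_norm C1) ler_wpM2l //.
      by apply: le_trans (ler_dist_dist _ _) _; rewrite opprB addrA subrK.
    have tt : C * `|t - t| = 0 by rewrite subrr normr0 mulr0.
    have h : C * `|s - t| @[s --> t] --> (0 : R) by rewrite -tt; exact: cc.
    exact: cvg_within_filter h.
move=> phi test; have [rho [van phiT]] := test_vanishes T0 test.
have sphi : smooth phi by case: test.
have [L [D [L0 D0 HL HD]]] := vanishes_C2 T0 sphi van.
have [_ _ _ lV _] := okV.
have bal := weak_balance T0 okV m20 flowX c0 X_growth X_speed X_local sphi L0 D0 HL HD.
have bJ := diagonal_bmeas okV m20 flowX c0 X_growth X_speed sphi L0 D0 HL HD.
have e0 : ex mu0 (fun x => phi (T, X T x)) = 0.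
  by rewrite -(ex_cst mu0 0); congr (ex mu0 _); apply/funext => x; rewrite phiT.
have T00 : 0 <= (0 : R) <= T by rewrite lexx ltW.
have q0 : quad (fun x => phi (0, x)).
  have := quad_test flowX c0 X_growth sphi L0 HL T00; have [X0 _ _ _] := flowX.
  by under eq_fun do rewrite X0.
rewrite e0 sub0r in bal.
rewrite (EFin_ex m20 q0) -EFinN bal -(integral_tint (ltW T0) bJ).
have qd (u : R) : 0 <= u <= T -> quad (fun x => 'D_((1, V u x) : E) phi (u, x)).
  by move=> uT; exact: (quad_direction sphi L0 D0 HL HD 1 uT (lV u uT)).
have dE (u : R) x : dt phi u x + dot (grad phi u x) (V u x) = 'D_((1, V u x) : E) phi (u, x).
  rewrite /dt /grad dotE (derive_pairE (u, x) (1, V u x) sphi) /= mul1r; congr (_ + _).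
  by apply: eq_bigr => i _; rewrite mxE mulrC.
apply: eq_integral => r; rewrite inE /= in_itv /= => rT.
rewrite -(ex_push r _ rT (qd r rT)) -(EFin_ex (m2 r rT) (qd r rT)); apply: eq_integral => x _.
by rewrite dE.
Unshelve. all: by end_near. Qed.

End flow_solution.

(** * Approximation by cycling through neurons *)

Section layers.
Context {R : realType} {d : nat}.
Variable sigma : R -> R.

Let coordB (u v : 'cV[R]_d) i : (u - v) i 0 = u i 0 - v i 0. Proof. by rewrite !mxE. Qed.

Definition layer : Type := ('M[R]_d * 'M[R]_d * 'cV[R]_d)%type.

Definition lval (l : layer) (x : 'cV[R]_d) : 'cV[R]_d := l.1.1 *m map_mx sigma (l.1.2 *m x + l.2).

(** Pads lists of neurons to a common length. *)
Definition zero_layer : layer := (0, 0, 0).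

Lemma lval_zero x : lval zero_layer x = 0. Proof. by rewrite /lval mul0mx. Qed.

Lemma norm_mulmx_le (A : 'M[R]_d) (u : 'cV[R]_d) : `|A *m u| <= (\sum_i \sum_k `|A i k|) * `|u|.
Proof.
apply: cV_norm_le => [|i]; first by rewrite mulr_ge0 // sumr_ge0 // => i _; rewrite sumr_ge0.
apply: le_trans (_ : (\sum_k `|A i k|) * `|u| <= _); last first.
  rewrite ler_wpM2r // [leRHS](bigD1 i) //= lerDl sumr_ge0 // => j _; exact: sumr_ge0.
rewrite mxE mulr_suml; apply: le_trans (ler_norm_sum _ _ _) _; apply: ler_sum => k _.
by rewrite normrM ler_wpM2l // le_cV_norm.
Qed.

Lemma lval_lip Ls (l : layer) : 0 <= Ls -> (forall a b, `|sigma a - sigma b| <= Ls * `|a - b|) ->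
  exists2 k, 0 <= k & forall x y, `|lval l x - lval l y| <= k * `|x - y|.
Proof.
move=> Ls0 Hs; pose m (A : 'M[R]_d) := \sum_i \sum_k `|A i k|.
have m0 A : 0 <= m A by apply: sumr_ge0 => i _; apply: sumr_ge0.
exists (m l.1.1 * (Ls * m l.1.2)) => [|x y]; first by rewrite !mulr_ge0.
rewrite /lval -mulmxBr; apply: le_trans (norm_mulmx_le _ _) _.
rewrite -mulrA; apply: (ler_wpM2l (m0 l.1.1)).
have r0 : 0 <= Ls * m l.1.2 * `|x - y| by rewrite !mulr_ge0.
apply: (cV_norm_le r0) => i.
have -> : (map_mx sigma (l.1.2 *m x + l.2) - map_mx sigma (l.1.2 *m y + l.2)) i 0 =
  sigma ((l.1.2 *m x) i 0 + l.2 i 0) - sigma ((l.1.2 *m y) i 0 + l.2 i 0) 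
  by rewrite coordB; move: (l.1.2 *m x) (l.1.2 *m y) => p q; rewrite !mxE.
apply: le_trans (Hs _ _) _; rewrite -mulrA; apply: (ler_wpM2l Ls0).
apply: le_trans (norm_mulmx_le l.1.2 (x - y)); rewrite mulmxBr.
have := le_cV_norm (l.1.2 *m x - l.1.2 *m y) i; rewrite coordB.
by rewrite opprD addrACA subrr addr0.
Qed.

(** One neuron acting on coordinate [i]: every row of the inner matrix is [w], so all hidden
    coordinates carry the same value, and the outer matrix keeps the [i]-th one. *)
Definition neuron (i : 'I_d) (a : R) (w : 'cV[R]_d) (th : R) : layer :=
  (a *: delta_mx i i, \matrix_(k, l) w l 0, const_mx th).

Lemma lval_neuron i a w th x : lval (neuron i a w th) x = (a * sigma (dot w x + th)) *: delta_mx i 0.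
Proof.
have e : map_mx sigma ((neuron i a w th).1.2 *m x + (neuron i a w th).2) = const_mx (sigma (dot w x + th)).
  apply/matrixP => k j; rewrite !mxE; congr (sigma (_ + _)).
  by rewrite dotE (ord1 j); apply: eq_bigr => l _; rewrite mxE.
rewrite /lval e; apply/matrixP => k j; rewrite !mxE (ord1 j) (bigD1 i) //= big1 => [|l li].
  by rewrite !mxE !eqxx !andbT addr0; case: (k == i); rewrite ?mulr1 // !mulr0 mul0r.
by rewrite !mxE (negbTE li) andbF mulr0 mul0r.
Qed.

(** Universality concerns scalar functions. It is applied to each coordinate and the neurons of all
    coordinates are joined in one list; the sup norm lets [delta] pass unchanged. *)
Lemma network_layers (b : 'cV[R]_d -> 'cV[R]_d) (rho delta : R) : universal d sigma ->
  (exists K, forall x y, `|b x - b y| <= K * `|x - y|) -> 0 < delta ->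
  exists s : seq layer, forall x, `|x| <= rho -> `|b x - \sum_(l <- s) lval l x| <= delta.
Proof.
move=> uni [K bl] d0.
have cbi i : continuous (fun x => b x i 0).
  apply: (lip_continuous (L := K)) => x y; apply: le_trans (bl x y).
  by have := le_cV_norm (b x - b y) i; rewrite !mxE.
have Hi i : exists s : seq layer, forall x, `|x| <= rho ->
    exists2 g : R, \sum_(l <- s) lval l x = g *: delta_mx i 0 & `|b x i 0 - g| <= delta.
  have [g [m _ [al [w [th gE]]]] gs] := uni _ _ _ (cbi i) (@closed_ball_compact R d rho) d0.
  exists [seq neuron i (al k) (w k) (th k) | k <- index_enum 'I_m] => x xr; exists (g x).
    rewrite big_map gE scaler_suml; apply: eq_bigr => k _; exact: lval_neuron.
  rewrite -lee_fin; apply: le_trans (ltW gs); apply: ereal_sup_ubound; by exists x.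
have [s Hs] := choice Hi.
exists (flatten [seq s i | i <- index_enum 'I_d]) => x xr.
apply: cV_norm_le => [|i]; first exact: ltW.
have /choice[g Hg] k : exists g : R, \sum_(l <- s k) lval l x = g *: delta_mx k 0 /\ `|b x k 0 - g| <= delta.
  by have [g g1 g2] := Hs k x xr; exists g.
rewrite big_flatten big_map /= (eq_bigr (fun k => g k *: delta_mx k 0)) => [|k _]; last by have [] := Hg k.
have [_] := Hg i; congr (_ <= _); congr (`|_|); rewrite coordB; congr (_ - _).
rewrite summxE (bigD1 i) //= big1 => [|k ki]; first by rewrite !mxE !eqxx mulr1 addr0.
by rewrite !mxE eq_sym (negbTE ki) mulr0.
Qed.

End layers.

(** * Equal time cells and piecewise constant functions *)

Section cells.
Context {R : realType}.

Let cell_index Q k q : (q < Q)%N -> (Q - q.+1 < k.+1)%N -> (k < Q - q)%N -> (Q.-1 - k)%N = q.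
Proof. lia. Qed.

Variables (T : R) (Q : nat).
Hypotheses (T0 : 0 < T) (Q0 : (0 < Q)%N).

Let tau : R := T / Q%:R.

Let Qp : 0 < Q%:R :> R. Proof. by rewrite ltr0n. Qed.
Let tau0 : 0 < tau. Proof. exact: divr_gt0 T0 Qp. Qed.
Let tauQ : Q%:R * tau = T. Proof. by rewrite /tau mulrC divfK // gt_eqF. Qed.

(* Cells are closed on the right; the truncated subtraction puts time 0 in cell 0. *)
Definition cell (t : R) : nat := (Q.-1 - Num.trunc ((T - t) / (T / Q%:R)))%N.

Definition cell_itv (q : nat) : interval R :=
  Interval (if q == 0%N then BLeft 0 else BRight (q%:R * tau)) (BRight (q.+1%:R * tau)).

Lemma cell_itvP q t : (q < Q)%N -> 0 <= t <= T -> (t \in cell_itv q) = (cell t == q).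
Proof.
move=> qQ /andP[t0 tT]; rewrite /cell -/tau.
have u0 : 0 <= (T - t) / tau by rewrite divr_ge0 ?(ltW tau0) // subr_ge0.
have := truncn_itv u0; set k := Num.trunc _ => /andP[k1 k2].
rewrite (ler_pdivlMr _ _ tau0) in k1; rewrite (ltr_pdivrMr _ _ tau0) in k2.
rewrite in_itv /=; apply/idP/eqP.
  move=> /andP[lo hi].
  have h1 : (Q - q.+1 < k.+1)%N.
    rewrite -(ltr_nat R) -(ltr_pM2r tau0) natrB // mulrBl tauQ; apply: le_lt_trans k2; lra.
  have [q0|q0] := eqVneq q 0%N.
    by rewrite q0; apply/eqP; rewrite subn_eq0; move: h1; rewrite q0 subn1.
  move: lo; rewrite (negbTE q0) /= => lo.
  apply: (cell_index qQ h1); rewrite -(ltr_nat R) -(ltr_pM2r tau0) natrB ?(ltnW qQ) // mulrBl tauQ.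
  apply: le_lt_trans k1 _; lra.
have [Qk|kQ] := leqP Q k.
  have -> : (Q.-1 - k)%N = 0%N by apply/eqP; rewrite subn_eq0 (leq_trans (leq_pred _)).
  have : Q%:R * tau <= k%:R * tau by rewrite ler_wpM2r ?(ltW tau0) // ler_nat.
  rewrite tauQ => Tk <-; rewrite /= t0 mul1r /=; move: k1 Tk tau0; lra.
move=> <-; have e : (Q.-1 - k)%:R * tau = T - k.+1%:R * tau.
  by rewrite -subn1 -subnDA add1n natrB // mulrBl tauQ.
have e' : (Q.-1 - k).+1%:R * tau = T - k%:R * tau by rewrite -natr1 mulrDl e -natr1; ring.
rewrite e'; apply/andP; split; last by lra.
case: eqP => _ /=; rewrite ?t0 // e; lra.
Qed.

Lemma cell_eq q t : (q < Q)%N -> q%:R * tau < t <= q.+1%:R * tau -> cell t = q.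
Proof.
move=> qQ /andP[qt tq]; apply/eqP; rewrite -cell_itvP //; last first.
  have qtau : 0 <= q%:R * tau by rewrite mulr_ge0 // ltW.
  rewrite (le_trans qtau (ltW qt)) /=; apply: le_trans tq _; rewrite -tauQ.
  by rewrite ler_wpM2r ?(ltW tau0) // ler_nat.
rewrite in_itv /=; case: eqP => [q0|_]; last by rewrite /= qt.
by rewrite /= tq andbT (le_trans _ (ltW qt)) // mulr_ge0 // ltW.
Qed.

Lemma cell_lt t : (cell t < Q)%N.
Proof. by rewrite /cell; case: (Q) Q0 => // m _; rewrite ltnS leq_subr. Qed.

Lemma cell_itv_sub q t : (q < Q)%N -> t \in cell_itv q -> 0 <= t <= T.
Proof.
move=> qQ; rewrite in_itv /= => /andP[h1 h2]; apply/andP; split.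
  move: h1; case: eqP => [_|_] //= h1; apply: le_trans (ltW h1); by rewrite mulr_ge0 // ltW.
by apply: le_trans h2 _; rewrite -tauQ ler_wpM2r ?(ltW tau0) // ler_nat.
Qed.

Lemma piecewise_constant_cell (U : Type) (f : nat -> U) : piecewise_constant T (fun t => f (cell t)).
Proof.
exists Q, (fun q : 'I_Q => cell_itv q); split.
- apply/seteqP; split => [t [q _ /= tq]|t /=].
    by rewrite in_itv /=; exact: cell_itv_sub tq.
  rewrite in_itv /= => tT; exists (Ordinal (cell_lt t)) => //=.
  by rewrite (cell_itvP (cell_lt t) tT).
- move=> q q' _ _ [t [/= tq tq']]; apply/val_inj.
  have tT := cell_itv_sub (ltn_ord q) tq.
  by move: tq tq'; rewrite !cell_itvP // => /eqP h1 /eqP h2; rewrite /= -h1.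
- move=> q s t sq tq; congr f.
  have sT := cell_itv_sub (ltn_ord q) sq; have tT := cell_itv_sub (ltn_ord q) tq.
  by move: sq tq; rewrite !cell_itvP // => /eqP -> /eqP.
Qed.

Lemma bmeas_cell (f : nat -> R) : bmeas T (fun t => f (cell t)).
Proof.
have bi (q : 'I_Q) : bmeas T (fun t => f q * (t \in cell_itv q)%:R).
  apply: bmeasZ; split; last by exists 1 => t _; case: (_ \in _); rewrite ?normr1 ?normr0.
  have -> : (fun t : lebesgueR R => (t \in cell_itv q)%:R) = \1_([set` cell_itv q] : set (lebesgueR R)) :> (_ -> R).
    by apply/funext => t; rewrite indicE mem_setE.
  by apply: measurable_indic; exact: itv_lebesgueR.
apply: bmeas_eq (bmeas_sum bi) _ => t tT.
rewrite (bigD1 (Ordinal (cell_lt t))) //= big1 => [|q qt].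
  by rewrite (cell_itvP (cell_lt t) tT) eqxx mulr1 addr0.
rewrite cell_itvP //; have /negbTE -> : cell t != q by apply: contra qt => /eqP e; apply/eqP/val_inj.
by rewrite mulr0.
Qed.

End cells.

(** * Grouping small steps into a coarse one *)

Section averaging.
Context {R : realType}.

(** During [p] steps of length [ka] the point moves by a multiple of [p * ka], so [b] can be frozen
    at the initial point at a quadratic cost. *)
Lemma averaged_step (W : normedModType R) (y : nat -> W) (b : W -> W) (ka e S K : R) p :
  0 <= ka -> 0 <= e -> 0 <= K -> 0 <= S ->
  (forall i, (i < p)%N -> `|y i.+1 - y i - ka *: b (y i)| <= ka * e) ->
  (forall i, (i < p)%N -> `|b (y i)| <= S) ->
  (forall u v, `|b u - b v| <= K * `|u - v|) ->
  (forall i, (i <= p)%N -> `|y i - y 0%N| <= i%:R * ka * (S + e)) /\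
  `|y p - y 0%N - (p%:R * ka) *: b (y 0%N)| <= p%:R * ka * e + K * (p%:R * ka) ^+ 2 * (S + e).
Proof.
move=> ka0 e0 K0 S0 Hy HS Hb.
have P1 i : (i <= p)%N -> `|y i - y 0%N| <= i%:R * ka * (S + e).
  elim: i => [|i IH] ip; first by rewrite subrr normr0 !mul0r.
  have -> : y i.+1 - y 0%N = (y i.+1 - y i - ka *: b (y i)) + ka *: b (y i) + (y i - y 0%N).
    by rewrite subrK addrA subrK.
  apply: le_trans (ler_normD _ _) _.
  apply: le_trans (lerD (ler_normD _ _) (IH (ltnW ip))) _.
  rewrite normrZ (ger0_norm ka0).
  apply: le_trans (lerD (lerD (Hy i ip) (ler_wpM2l ka0 (HS i ip))) (lexx _)) _.
  by rewrite -natr1 le_eqVlt; apply/orP; left; apply/eqP; ring.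
split=> //.
have P2 i : (i <= p)%N ->
    `|y i - y 0%N - (i%:R * ka) *: b (y 0%N)| <= i%:R * ka * e + i%:R * ka * (K * (p%:R * ka * (S + e))).
  elim: i => [|i IH] ip; first by rewrite !mul0r scale0r !subrr normr0 addr0.
  have -> : y i.+1 - y 0%N - (i.+1%:R * ka) *: b (y 0%N) =
     (y i.+1 - y i - ka *: b (y i)) + ka *: (b (y i) - b (y 0%N)) + (y i - y 0%N - (i%:R * ka) *: b (y 0%N)).
    rewrite -natr1 mulrDl mul1r scalerDl scalerBr.
    move: (y i.+1) (y i) (y 0%N) (ka *: b (y i)) (ka *: b (y 0%N)) ((i%:R * ka) *: _) => A B C D F G.
    rewrite [G + F]addrC.
    by rewrite [A - B - D + _]addrA subrK [RHS]addrACA [A - B + _]addrA subrK -opprD [F + G]addrC.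
  apply: le_trans (ler_normD _ _) _.
  apply: le_trans (lerD (ler_normD _ _) (IH (ltnW ip))) _.
  rewrite normrZ (ger0_norm ka0).
  have h : ka * `|b (y i) - b (y 0%N)| <= ka * (K * (p%:R * ka * (S + e))).
    rewrite ler_wpM2l //; apply: le_trans (Hb _ _) _; rewrite ler_wpM2l //.
    apply: le_trans (P1 i (ltnW ip)) _; rewrite ler_wpM2r ?addr_ge0 // ler_wpM2r // ler_nat; exact: ltnW.
  apply: le_trans (lerD (lerD (Hy i ip) h) (lexx _)) _.
  by rewrite -natr1 le_eqVlt; apply/orP; left; apply/eqP; ring.
apply: le_trans (P2 p (leqnn p)) _.
by rewrite le_eqVlt; apply/orP; left; apply/eqP; ring.
Qed.

End averaging.

Section averaged_flow.
Context {R : realType} {d : nat}.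
Variables (T M K : R) (V : R -> 'cV[R]_d -> 'cV[R]_d).
Hypotheses (T0 : 0 < T) (okV : admissible T V M K).
Variables (X : R -> 'cV[R]_d) (n p : nat) (R0 CX delta : R) (y : nat -> 'cV[R]_d).
Hypotheses (n0 : (0 < n)%N) (p0 : (0 < p)%N) (R00 : 0 <= R0) (CX0 : 0 <= CX).
Hypotheses (d0 : 0 <= delta) (d1 : delta <= 1).

Let h : R := T / n%:R.
Let ka : R := h / p%:R.
Let E : R := expR (K * T).

(** The Groenwall radius for starting points in the ball of radius [R0]; [M] is raised by 2 to cover
    the step error [2 * delta], where [delta <= 1]. *)
Definition trap : R := (R0 + T * (M + 2)) * E.

Definition average (j : nat) (x : 'cV[R]_d) : 'cV[R]_d :=
  h^-1 *: incr V (j%:R * h) (j.+1%:R * h) x.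

Hypothesis (y0 : y 0%N = X 0) (yR : `|y 0%N| <= R0).
Hypothesis ystep : forall m, (m < n * p)%N -> `|y m| <= trap ->
  `|y m.+1 - y m - ka *: average (m %/ p) (y m)| <= ka * (2 * delta).
Hypothesis Xlocal : forall s t, 0 <= s -> s <= t -> t <= T ->
  `|X t - X s - incr V s t (X s)| <= CX * (t - s) ^+ 2.

Let M0 : 0 <= M. Proof. by have [] := okV. Qed.
Let K0 : 0 <= K. Proof. by have [] := okV. Qed.
Let nR : 0 < n%:R :> R. Proof. by rewrite ltr0n. Qed.
Let pR : 0 < p%:R :> R. Proof. by rewrite ltr0n. Qed.
Let h0 : 0 < h. Proof. exact: divr_gt0 T0 nR. Qed.
Let ka0 : 0 < ka. Proof. exact: divr_gt0 h0 pR. Qed.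
Let nh : n%:R * h = T. Proof. by rewrite /h mulrC divfK // gt_eqF. Qed.
Let pka : p%:R * ka = h. Proof. by rewrite /ka mulrC divfK // gt_eqF. Qed.
Let gridT (j : nat) : (j <= n)%N -> j%:R * h <= T.
Proof. by move=> jn; rewrite -nh ler_wpM2r ?(ltW h0) // ler_nat. Qed.
Let grid0 (j : nat) : 0 <= j%:R * h. Proof. by rewrite mulr_ge0 // ltW. Qed.
Let gridS (j : nat) : j%:R * h <= j.+1%:R * h.
Proof. by rewrite ler_wpM2r ?(ltW h0) // ler_nat. Qed.
Let gridB (j : nat) : j.+1%:R * h - j%:R * h = h. Proof. by rewrite -natr1; ring. Qed.

Lemma average_lip j u v : (j < n)%N -> `|average j u - average j v| <= K * `|u - v|.
Proof.
move=> jn; have := incr_lip okV u v (grid0 j) (gridS j) (gridT jn); rewrite gridB.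
rewrite /average -scalerBr normrZ gtr0_norm ?invr_gt0 // ler_pdivrMl // => /le_trans; apply.
by rewrite le_eqVlt; apply/orP; left; apply/eqP; ring.
Qed.

Lemma average_bound j u : (j < n)%N -> `|average j u| <= M + K * `|u|.
Proof.
move=> jn; have := incr_bound okV u (grid0 j) (gridS j) (gridT jn); rewrite gridB.
by rewrite /average normrZ gtr0_norm ?invr_gt0 // ler_pdivrMl.
Qed.

(** A bootstrap: networks approximate on a ball only, so [ystep] holds only at points already known
    to lie in it. Strong induction provides this for the earlier points, and Groenwall then bounds
    the current one. *)
Lemma stays_in_trap m : (m <= n * p)%N -> `|y m| <= trap.
Proof.
elim/ltn_ind: m => m IH mnp.
have b0 : 0 <= ka * (M + 2) by rewrite mulr_ge0 ?(ltW ka0) // addr_ge0.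
have := @discrete_gronwall R (fun k => `|y k|) (K * ka) (ka * (M + 2)) m (mulr_ge0 K0 (ltW ka0)) b0 (normr_ge0 _).
move=> H; apply: le_trans (H _ m (leqnn m)) _.
  move=> k km; have knp : (k < n * p)%N by apply: leq_trans km mnp.
  have kb : (k %/ p < n)%N by rewrite ltn_divLR.
  have yk := IH k km (ltnW knp).
  have st := ystep knp yk; have bd := average_bound (y k) kb.
  rewrite -[X in `|X| <= _](subrK (y k)) -[X in `|X + _| <= _](subrK (ka *: average (k %/ p) (y k))).
  apply: le_trans (ler_normD _ _) _.
  apply: le_trans (lerD (ler_normD _ _) (lexx _)) _.
  rewrite normrZ (gtr0_norm ka0).
  apply: le_trans (lerD (lerD st (ler_wpM2l (ltW ka0) bd)) (lexx _)) _.
  have : ka * (2 * delta) <= ka * 2 by rewrite ler_wpM2l ?(ltW ka0) //; move: d1; lra.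
  lra.
have mka : m%:R * ka <= T.
  rewrite -nh -pka mulrA -natrM ler_wpM2r ?(ltW ka0) // ler_nat //.
rewrite /trap ler_pM ?expR_ge0 //.
- by rewrite addr_ge0 // mulr_ge0.
- by rewrite lerD // mulrA ler_wpM2r // addr_ge0.
- by rewrite ler_expR -mulrA ler_wpM2l // mulrC.
Qed.

Let S : R := M + K * trap.

Let trap0 : 0 <= trap.
Proof. by rewrite mulr_ge0 ?expR_ge0 // addr_ge0 // mulr_ge0 ?(ltW T0) // addr_ge0. Qed.

Let S0 : 0 <= S. Proof. by rewrite addr_ge0 // mulr_ge0. Qed.

Let S2 : 0 <= S + 2 := addr_ge0 S0 (ler0n _ 2).
Let d20 : 0 <= 2 * delta := mulr_ge0 (ler0n _ 2) d0.

(** As [p * ka] is [h] and [h] times the average is the increment of [V], [averaged_step] turns the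
    [p] rounds of a coarse cell into one Euler step. *)
Let coarse j : (j < n)%N ->
  (forall i, (i <= p)%N -> `|y (j * p + i)%N - y (j * p)%N| <= h * (S + 2)) /\
  `|y (j.+1 * p)%N - y (j * p)%N - incr V (j%:R * h) (j.+1%:R * h) (y (j * p)%N)| <=
     h * (2 * delta) + K * h ^+ 2 * (S + 2).
Proof.
move=> jn; have jp i : (i < p)%N -> (j * p + i < n * p)%N.
  by move=> ip; apply: (@leq_trans (j.+1 * p)%N); rewrite ?leq_mul2r ?jn ?orbT // mulSn addnC ltn_add2r.
have [|||] := @averaged_step R _ (fun i => y (j * p + i)%N) (average j) ka (2 * delta) S K p (ltW ka0) d20 K0 S0.
- move=> i ip; have := ystep (jp i ip) (stays_in_trap (ltnW (jp i ip))).
  have e : ((j * p + i) %/ p)%N = j by rewrite divnMDl // (divn_small ip) addn0.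
  by rewrite e -addnS => z; exact: z.
- move=> i ip; apply: le_trans (average_bound _ jn) _.
  by rewrite lerD2l ler_wpM2l // stays_in_trap // ltnW // jp.
- by move=> u v; exact: average_lip.
rewrite addn0 => P1 P2; split.
  move=> i ip; apply: le_trans (P1 i ip) _; rewrite -pka.
  apply: (ler_pM (mulr_ge0 (ler0n _ i) (ltW ka0)) (addr_ge0 S0 d20)).
    by apply: (ler_wpM2r (ltW ka0)); rewrite ler_nat.
  by rewrite lerD2l; move: d1; lra.
move: P2; rewrite pka {1}/average scalerA divff ?gt_eqF // scale1r -mulSnr => P2.
apply: le_trans P2 _; rewrite lerD2l; apply: (ler_wpM2l (mulr_ge0 K0 (sqr_ge0 h))).
by rewrite lerD2l; move: d1; lra.
Qed.

Lemma averaged_flow_error j i : (j * p + i <= n * p)%N -> (i < p)%N ->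
  `|y (j * p + i)%N - X (j%:R * h)| <= h * (S + 2) + T * E * (2 * delta + h * (CX + K * (S + 2))).
Proof.
move=> jip ip.
have jn : (j <= n)%N by rewrite -(leq_pmul2r p0) (leq_trans _ jip) // leq_addr.
have c1 : `|y (j * p + i)%N - y (j * p)%N| <= h * (S + 2).
  have [jn'|nj] := ltnP j n; first by have [H _] := coarse jn'; apply: H; exact: ltnW.
  (* At the final node there is no further coarse cell, and [i] must be 0. *)
  have jE : j = n by apply/eqP; rewrite eqn_leq jn.
  have -> : i = 0%N by move: jip; rewrite jE -[X in (_ <= X)%N]addn0 leq_add2l leqn0 => /eqP.
  by rewrite addn0 subrr normr0; exact: mulr_ge0 (ltW h0) S2.
rewrite -(subrK (y (j * p)%N) (y (j * p + i)%N)) -addrA.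
apply: le_trans (ler_normD _ _) (lerD c1 _).
have e10 : 0 <= h * (2 * delta) + K * h ^+ 2 * (S + 2) :=
  addr_ge0 (mulr_ge0 (ltW h0) d20) (mulr_ge0 (mulr_ge0 K0 (sqr_ge0 h)) S2).
have e20 : 0 <= CX * h ^+ 2 by rewrite mulr_ge0 ?sqr_ge0.
have := @gronwall_compare R _ (fun k => incr V (k%:R * h) (k.+1%:R * h))
  (fun k => y (k * p)%N) (fun k => X (k%:R * h)) n (K * h) _ _ (mulr_ge0 K0 (ltW h0)) e10 e20.
move=> H; apply: le_trans (H _ _ _ j jn) _.
- by move=> k kn; have := incr_lip okV (y (k * p)%N) (X (k%:R * h)) (grid0 k) (gridS k) (gridT kn); rewrite gridB.
- by move=> k kn; have [_] := coarse kn.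
- by move=> k kn; have := Xlocal (grid0 k) (gridS k) (gridT kn); rewrite gridB.
rewrite mul0n mul0r y0 subrr normr0 add0r.
have -> : j%:R * (h * (2 * delta) + K * h ^+ 2 * (S + 2) + CX * h ^+ 2) =
  (j%:R * h) * (2 * delta + h * (CX + K * (S + 2))) by ring.
rewrite mulrAC; have z0 : 0 <= 2 * delta + h * (CX + K * (S + 2)) :=
  addr_ge0 d20 (mulr_ge0 (ltW h0) (addr_ge0 CX0 (mulr_ge0 K0 S2))).
apply: ler_wpM2r => //; apply: ler_pM; rewrite ?expR_ge0 ?grid0 ?gridT //.
by rewrite ler_expR -mulrA ler_wpM2l // mulrC gridT.
Qed.

End averaged_flow.

(** * Fields given by one layer per time cell *)

Section cell_fields.
Context {R : realType} {d : nat}.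
Variables (sigma : R -> R) (T : R) (Q : nat) (lay : nat -> @layer R d).
Hypotheses (T0 : 0 < T) (Q0 : (0 < Q)%N).

Definition cell_field (t : R) (x : 'cV[R]_d) : 'cV[R]_d := lval sigma (lay (cell T Q t)) x.

Variables (MF KF : R).
Hypotheses (MF0 : 0 <= MF) (KF0 : 0 <= KF).
Hypothesis lay_lip : forall q, (q < Q)%N -> forall x y,
  `|lval sigma (lay q) x - lval sigma (lay q) y| <= KF * `|x - y|.
Hypothesis lay0 : forall q, (q < Q)%N -> `|lval sigma (lay q) 0| <= MF.

Lemma cell_field_admissible : admissible T cell_field MF KF.
Proof.
split; [exact: MF0 | exact: KF0 | | | ].
- by move=> x i; exact: (bmeas_cell T0 Q0 (fun q => lval sigma (lay q) x i 0)).
- by move=> t _ x y; apply: lay_lip; exact: cell_lt.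
- by move=> t _; apply: lay0; exact: cell_lt.
Qed.

Lemma cell_field_incr a k x : (a + k <= Q)%N ->
  incr cell_field (a%:R * (T / Q%:R)) ((a + k)%:R * (T / Q%:R)) x =
    (T / Q%:R) *: \sum_(i < k) lval sigma (lay (a + i)%N) x.
Proof.
have tau0 : 0 < T / Q%:R by rewrite divr_gt0 // ltr0n.
set tau := T / Q%:R in tau0 *.
have tauQ : Q%:R * tau = T by rewrite /tau mulrC divfK // gt_eqF // ltr0n.
have g0 (q : nat) : 0 <= q%:R * tau by rewrite mulr_ge0 // ltW.
have gl (q r : nat) : (q <= r)%N -> q%:R * tau <= r%:R * tau by move=> qr; rewrite ler_wpM2r ?(ltW tau0) // ler_nat.
have adm := cell_field_admissible.
elim: k => [|k IH] akQ.
  rewrite big_ord0 scaler0 addn0; apply/eqP; rewrite -normr_le0.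
  have aQ : a%:R * tau <= T by rewrite -tauQ gl //; move: akQ; rewrite addn0.
  by apply: le_trans (incr_bound adm x (g0 a) (lexx _) aQ) _; rewrite subrr mul0r.
have kT : (a + k.+1)%:R * tau <= T by rewrite -tauQ gl.
have akQ' : (a + k < Q)%N by rewrite -addnS.
rewrite (incr_add adm x (g0 a) (gl _ _ (leq_addr k a)) (gl (a + k)%N (a + k.+1)%N _) kT); last by rewrite addnS.
rewrite IH ?(ltnW akQ') // big_ord_recr /= scalerDr; congr (_ + _).
apply/matrixP => i j; rewrite !mxE (ord1 j).
rewrite (tint_eq (h2 := fun=> lval sigma (lay (a + k)%N) x i 0)); last first.
  by move=> u; rewrite addnS => uu; rewrite /cell_field (cell_eq T0 Q0 akQ' uu).
rewrite tint_cst ?gl // ?addnS // mulrC; congr (_ * _); last by rewrite mxE.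
by rewrite -natr1 mulrDl mul1r addrAC subrr add0r.
Qed.

End cell_fields.

(** * Choice of the parameters of the neural field *)

Section neural_approximation.
Context {R : realType} {d : nat}.
Variable sigma : R -> R.

Definition scale_layer (a : R) (l : @layer R d) : @layer R d := (a *: l.1.1, l.1.2, l.2).

Lemma lval_scale a l x : lval sigma (scale_layer a l) x = a *: lval sigma l x.
Proof. by rewrite /lval /= scalemxAl. Qed.

Lemma sum_nth_layer (s : seq (@layer R d)) N x : (size s <= N)%N ->
  \sum_(l < N) lval sigma (nth (@zero_layer R d) s l) x = \sum_(l <- s) lval sigma l x.
Proof.
move=> sN; rewrite (big_nth (@zero_layer R d)) (big_mkord xpredT (fun i => lval sigma (nth (@zero_layer R d) s i) x)).
rewrite (big_ord_widen _ (fun i => lval sigma (nth (@zero_layer R d) s i) x) sN) [LHS](bigID (fun i : 'I_N => (i < size s)%N)) /=.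
rewrite [X in _ + X]big1 ?addr0 // => i; rewrite -leqNgt => si.
by rewrite nth_default // lval_zero.
Qed.

Lemma le_sum_ord n (f : nat -> R) k : (forall i, 0 <= f i) -> (k < n)%N -> f k <= \sum_(i < n) f i.
Proof. by move=> f0 kn; rewrite (bigD1 (Ordinal kn)) //= lerDl sumr_ge0. Qed.

Let div_truncn_le (a e : R) : 0 < e -> a / (Num.trunc (a / e)).+1%:R <= e.
Proof. by move=> e0; rewrite ler_pdivrMr ?ltr0n // mulrC -ler_pdivrMr // ltW // truncnS_gt. Qed.

Variables (T M K : R) (V : R -> 'cV[R]_d -> 'cV[R]_d) (X : R -> 'cV[R]_d -> 'cV[R]_d).
Hypotheses (T0 : 0 < T) (okV : admissible T V M K) (flowX : flow_of T M K V X).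

(** Order of choices: the accuracy [delta], the number [n] of coarse cells, the networks and their
    common size [N], and last the number [p] of rounds per coarse cell. Since rounds repeat the same
    layers, [KF] and [MF] do not depend on [p], and [p] can compensate for the large speed of the
    weighted neurons. *)
Lemma neural_flow (Ls R0 eps : R) : 0 <= Ls -> (forall a b, `|sigma a - sigma b| <= Ls * `|a - b|) ->
  universal d sigma -> 0 <= R0 -> 0 < eps ->
  exists Q lay MF KF Y, [/\ (0 < Q)%N, admissible T (cell_field sigma T Q lay) MF KF,
    flow_of T MF KF (cell_field sigma T Q lay) Y &
    forall t x, 0 <= t <= T -> `|x| <= R0 -> `|Y t x - X t x| <= eps].
Proof.
move=> Ls0 Hs uni R00 eps0; have [M0 K0 _ _ _] := okV.
have [c [c0 _ Xspeed Xlocal]] := flow_growth T0 okV flowX.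
pose E := expR (K * T); have E0 : 0 <= E := expR_ge0 _.
pose rho := trap T M K R0.
have rho0 : 0 <= rho.
  by apply: mulr_ge0 E0; apply: addr_ge0 R00 _; apply: mulr_ge0 (ltW T0) _; rewrite addr_ge0.
pose S := M + K * rho; have S2 : 0 <= S + 2 by rewrite addr_ge0 // addr_ge0 // mulr_ge0.
pose CX := c * (1 + R0); have CX0 : 0 <= CX by rewrite mulr_ge0 // addr_ge0.
have TE0 : 0 <= T * E := mulr_ge0 (ltW T0) E0.
pose W := (S + 2) + CX + T * E * (CX + K * (S + 2)).
have W0 : 0 <= W := addr_ge0 (addr_ge0 S2 CX0) (mulr_ge0 TE0 (addr_ge0 CX0 (mulr_ge0 K0 S2))).
have TE1 : 0 < 2 * (1 + 2 * (T * E)) by rewrite mulr_gt0 // ltr_pwDl // mulr_ge0.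
pose delta := Num.min 1 (eps / (2 * (1 + 2 * (T * E)))).
have delta0 : 0 < delta by rewrite lt_min ltr01 divr_gt0.
have delta1 : delta <= 1 by rewrite ge_min lexx.
have delta_small : delta * (1 + 2 * (T * E)) <= eps / 2.
  have : delta <= eps / (2 * (1 + 2 * (T * E))) by rewrite ge_min lexx orbT.
  by rewrite ler_pdivlMr //; lra.
pose n := (Num.trunc (T * W / (eps / 2))).+1.
have n0 : (0 < n)%N by [].
have nR : 0 < n%:R :> R by rewrite ltr0n.
pose h := T / n%:R; have h0 : 0 < h := divr_gt0 T0 nR.
have e2 : 0 < eps / 2 by rewrite divr_gt0.
have h_small : h * W <= eps / 2.
  by rewrite /h mulrAC; exact: div_truncn_le.
pose b := average T V n.
have bl j : (j < n)%N -> forall x y, `|b j x - b j y| <= K * `|x - y|.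
  by move=> jn x y; exact: (average_lip T0 okV n0).
have /choice[s Hs'] j : exists s : seq (@layer R d), (j < n)%N ->
    forall x, `|x| <= rho -> `|b j x - \sum_(l <- s) lval sigma l x| <= delta.
  have [jn|jn] := ltnP j n; last by exists [::].
  by have [s Hs'] := network_layers rho uni (ex_intro _ K (bl j jn)) delta0; exists s.
(* A common length for all the lists; the successor makes it positive. *)
pose N := (\max_(j < n) size (s j)).+1.
have N0 : (0 < N)%N by [].
have NR : 0 < N%:R :> R by rewrite ltr0n.
have sN j : (j < n)%N -> (size (s j) <= N)%N.
  by move=> jn; apply: leqW; exact: (leq_bigmax (Ordinal jn)).
pose lay0 j l := scale_layer N%:R (nth (@zero_layer R d) (s j) l).
have /choice[kk Hkk] (l : @layer R d) : exists k, 0 <= k /\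
    forall x y, `|lval sigma l x - lval sigma l y| <= k * `|x - y|.
  by have [k k0 Hk] := lval_lip l Ls0 Hs; exists k.
have kk0 l : 0 <= kk l by have [] := Hkk l.
(* Crude bounds common to all layers, fixed before [p]. *)
pose KF := \sum_(j < n) \sum_(l < N) kk (lay0 j l).
pose MF := \sum_(j < n) \sum_(l < N) `|lval sigma (lay0 j l) 0|.
have KF0 : 0 <= KF by apply: sumr_ge0 => j _; exact: sumr_ge0.
have MF0 : 0 <= MF by apply: sumr_ge0 => j _; exact: sumr_ge0.
have KF_le j l : (j < n)%N -> (l < N)%N -> kk (lay0 j l) <= KF.
  move=> jn lN; apply: le_trans (_ : \sum_(l < N) kk (lay0 j l) <= _).
    exact: (@le_sum_ord N (fun l => kk (lay0 j l))).
  by apply: (@le_sum_ord n (fun j => \sum_(l < N) kk (lay0 j l))) => // i; exact: sumr_ge0.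
have MF_le j l : (j < n)%N -> (l < N)%N -> `|lval sigma (lay0 j l) 0| <= MF.
  move=> jn lN; apply: le_trans (_ : \sum_(l < N) `|lval sigma (lay0 j l) 0| <= _).
    exact: (@le_sum_ord N (fun l => `|lval sigma (lay0 j l) 0|)).
  by apply: (@le_sum_ord n (fun j => \sum_(l < N) `|lval sigma (lay0 j l) 0|)) => // i; exact: sumr_ge0.
pose sF := MF + KF * ((R0 + MF * T) * expR (KF * T)).
have sF0 : 0 <= sF.
  apply: addr_ge0 => //; apply: mulr_ge0 => //; apply: mulr_ge0 (expR_ge0 _).
  exact: addr_ge0 R00 (mulr_ge0 MF0 (ltW T0)).
(* The first two terms bound the speed of [Y], the last one is the constant of its quadratic
   defect. *)
pose CF := sF + KF * sF * T + KF * sF.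
have Ks0 : 0 <= KF * sF := mulr_ge0 KF0 sF0.
have KsT0 : 0 <= KF * sF * T := mulr_ge0 Ks0 (ltW T0).
have CF0 : 0 <= CF := addr_ge0 (addr_ge0 sF0 KsT0) Ks0.
(* Rounds of length [ka] so short that during one of them [Y] moves by at most [delta], and its
   defect is at most [ka * delta]. *)
pose p := (Num.trunc (CF * h / delta)).+1.
have p0 : (0 < p)%N by [].
have pR : 0 < p%:R :> R by rewrite ltr0n.
pose ka := h / p%:R; have ka0 : 0 < ka := divr_gt0 h0 pR.
have ka_small : CF * ka <= delta.
  by rewrite /ka mulrA; exact: div_truncn_le.
pose Q := (n * (p * N))%N.
have Q0 : (0 < Q)%N by rewrite !muln_gt0 n0 p0 N0.
have QR : 0 < Q%:R :> R by rewrite ltr0n.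
(* The quotient is the coarse cell that contains piece [q], the remainder its position within a
   round. *)
pose lay q := lay0 (q %/ (p * N))%N (q %% N)%N.
have lay_lip q : (q < Q)%N -> forall x y, `|lval sigma (lay q) x - lval sigma (lay q) y| <= KF * `|x - y|.
  move=> qQ x y; have [_ Hk] := Hkk (lay q); apply: le_trans (Hk x y) _; apply: ler_wpM2r => //.
  by apply: KF_le; [rewrite ltn_divLR // muln_gt0 p0 | rewrite ltn_mod].
have lay0_le q : (q < Q)%N -> `|lval sigma (lay q) 0| <= MF.
  by move=> qQ; apply: MF_le; [rewrite ltn_divLR // muln_gt0 p0 | rewrite ltn_mod].
pose F := cell_field sigma T Q lay.
have admF : admissible T F MF KF := cell_field_admissible T0 Q0 MF0 KF0 lay_lip lay0_le.
have [Y flowY] := flow_exists T0 admF.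
exists Q, lay, MF, KF, Y; split => //.
have [Y0 _ Ybound Ylocal] := flowY; have [X0 _ _ _] := flowX.
have tauN : N%:R * (T / Q%:R) = ka.
  by rewrite /ka /h /Q !natrM; field; rewrite !gt_eqF.
have npka : (n * p)%:R * ka = T by rewrite /ka /h natrM; field; rewrite !gt_eqF.
have grid m : (m <= n * p)%N -> m%:R * ka <= T.
  by move=> mnp; rewrite -npka ler_wpM2r ?(ltW ka0) // ler_nat.
have grid0 (m : nat) : 0 <= m%:R * ka by rewrite mulr_ge0 // ltW.
have gridS (m : nat) : m%:R * ka <= m.+1%:R * ka by rewrite ler_wpM2r ?(ltW ka0) // ler_nat.
have gridB (m : nat) : m.+1%:R * ka - m%:R * ka = ka by rewrite -natr1 mulrDl mul1r addrAC subrr add0r.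
have incrF m x : (m < n * p)%N ->
    incr F (m%:R * ka) (m.+1%:R * ka) x = ka *: \sum_(l <- s (m %/ p)%N) lval sigma l x.
  move=> mnp; have mp : (m %/ p < n)%N by rewrite ltn_divLR.
  have mQ : (m * N + N <= Q)%N by rewrite /Q mulnA addnC -mulSn leq_mul2r mnp orbT.
  have := cell_field_incr T0 Q0 MF0 KF0 lay_lip lay0_le x mQ.
  have e1 : (m * N)%:R * (T / Q%:R) = m%:R * ka by rewrite natrM -mulrA tauN.
  have e3 : (m * N + N)%:R * (T / Q%:R) = m.+1%:R * ka by rewrite addnC -mulSn natrM -mulrA tauN.
  rewrite -/F e1 e3 => ->.
  rewrite -(sum_nth_layer _ (sN _ mp)) -tauN.
  rewrite (eq_bigr (fun l : 'I_N => N%:R *: lval sigma (nth (@zero_layer R d) (s (m %/ p)%N) l) x)) => [|l _].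
    by rewrite -scaler_sumr scalerA mulrC.
  rewrite -lval_scale; congr (lval sigma _ x); rewrite /lay /lay0.
  have -> : ((m * N + l) %% N = l)%N by rewrite modnMDl (modn_small (ltn_ord l)).
  have -> // : ((m * N + l) %/ (p * N) = m %/ p)%N.
  by rewrite [(p * N)%N]mulnC divnMA divnMDl // (divn_small (ltn_ord l)) addn0.
move=> t x tT xR; have [t0 tT'] := andP tT.
have Yspeed u v : 0 <= u -> u <= v -> v <= T -> `|Y v x - Y u x| <= CF * (v - u).
  move=> u0 uv vT; have vu : 0 <= v - u by rewrite subr_ge0.
  have uI : 0 <= u <= T by rewrite u0 (le_trans uv).
  rewrite -(subrK (incr F u v (Y u x)) (Y v x - Y u x)); apply: le_trans (ler_normD _ _) _.
  apply: le_trans (lerD (Ylocal u v x R0 u0 uv vT xR) (incr_bound admF _ u0 uv vT)) _.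
  rewrite -/sF; apply: le_trans (_ : KF * sF * (T * (v - u)) + (v - u) * sF <= _).
    apply: lerD.
      apply: ler_wpM2l => //; rewrite expr2; apply: ler_wpM2r => //; move: u0 vT; lra.
    by apply: ler_wpM2l => //; rewrite lerD2l; apply: ler_wpM2l => //; exact: Ybound.
  have -> : KF * sF * (T * (v - u)) + (v - u) * sF = (sF + KF * sF * T) * (v - u) by ring.
  by apply: ler_wpM2r => //; rewrite lerDl.
pose y m := Y (m%:R * ka) x.
have ystep m : (m < n * p)%N -> `|y m| <= rho ->
    `|y m.+1 - y m - ka *: b (m %/ p)%N (y m)| <= ka * (2 * delta).
  move=> mnp ym; have mp : (m %/ p < n)%N by rewrite ltn_divLR.
  have := Ylocal _ _ x R0 (grid0 m) (gridS m) (grid _ mnp) xR.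
  rewrite -/(y m) -/(y m.+1) gridB incrF // -/sF => loc.
  have net := Hs' _ mp (y m) ym.
  set z := \sum_(l <- _) _ in loc net.
  rewrite -(subrK (ka *: z) (y m.+1 - y m)) -addrA -scalerBr; apply: le_trans (ler_normD _ _) _.
  rewrite normrZ (gtr0_norm ka0) distrC in net *.
  apply: le_trans (lerD loc (ler_wpM2l (ltW ka0) net)) _.
  have -> : ka * (2 * delta) = ka * delta + ka * delta by ring.
  rewrite lerD2r expr2 mulrA mulrC; apply: ler_wpM2l; first exact: ltW.
  apply: le_trans ka_small; apply: ler_wpM2r; first exact: ltW.
  by rewrite /CF lerDr; exact: addr_ge0.
have yR : `|y 0%N| <= R0 by rewrite /y mul0r Y0.
have y0 : y 0%N = X 0 x by rewrite /y mul0r Y0 X0.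
have XlocalR u v : 0 <= u -> u <= v -> v <= T ->
    `|X v x - X u x - incr V u v (X u x)| <= CX * (v - u) ^+ 2.
  move=> u0 uv vT; apply: le_trans (Xlocal u v x u0 uv vT) _; apply: ler_wpM2r; first exact: sqr_ge0.
  by apply: ler_wpM2l => //; rewrite lerD2l.
(* [t] is compared with the start of its round [m], and that with the start of the coarse cell
   [m %/ p], where the two flows are related by [averaged_flow_error]. *)
pose m := Num.trunc (t / ka).
have /andP[m1 m2] := truncn_itv (divr_ge0 t0 (ltW ka0)).
rewrite -/m (ler_pdivlMr _ _ ka0) in m1; rewrite -/m (ltr_pdivrMr _ _ ka0) in m2.
have mnp : (m <= n * p)%N.
  by rewrite -(ler_nat R) -(ler_pM2r ka0) npka (le_trans m1).
have mE : (m %/ p * p + m %% p)%N = m by rewrite -divn_eq.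
have err := averaged_flow_error T0 okV n0 p0 R00 CX0 (ltW delta0) delta1 y0 yR ystep XlocalR
  (j := (m %/ p)%N) (i := (m %% p)%N).
rewrite mE -/h -/rho -/S -/E in err; have {}err := err mnp (ltn_pmod m p0).
have e1 : `|Y t x - y m| <= delta.
  apply: le_trans (Yspeed _ _ (grid0 m) m1 tT') _; apply: le_trans ka_small; apply: ler_wpM2l => //.
  by move: m2; rewrite -natr1 mulrDl mul1r; lra.
have jm : (m %/ p)%:R * h <= m%:R * ka.
  have -> : h = p%:R * ka by rewrite /ka mulrC divfK // gt_eqF.
  by rewrite mulrA -natrM; apply: ler_wpM2r; [exact: ltW | rewrite ler_nat leq_divM].
have mj : t - (m %/ p)%:R * h <= h.
  have hE : h = p%:R * ka by rewrite /ka mulrC divfK // gt_eqF.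
  have : m.+1%:R * ka <= (m %/ p).+1%:R * h.
    by rewrite hE mulrA -natrM; apply: ler_wpM2r; [exact: ltW | rewrite ler_nat ltn_ceil].
  by move: m2; rewrite -[(m %/ p).+1%:R]natr1 [(_ + 1) * h]mulrDl mul1r; lra.
have e3 : `|X ((m %/ p)%:R * h) x - X t x| <= CX * h.
  rewrite distrC; have g : 0 <= (m %/ p)%:R * h := mulr_ge0 (ler0n _ _) (ltW h0).
  apply: le_trans (Xspeed _ _ x g (le_trans jm m1) tT') _.
  apply: le_trans (_ : CX * (t - (m %/ p)%:R * h) <= _); last exact: ler_wpM2l.
  apply: ler_wpM2r; first by rewrite subr_ge0 (le_trans jm).
  by apply: ler_wpM2l => //; rewrite lerD2l.
have -> : Y t x - X t x = (Y t x - y m) + (y m - X ((m %/ p)%:R * h) x) + (X ((m %/ p)%:R * h) x - X t x).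
  by rewrite !addrA !subrK.
apply: le_trans (ler_normD _ _) _; apply: le_trans (lerD (ler_normD _ _) (lexx _)) _.
apply: le_trans (lerD (lerD e1 err) e3) _.
have -> : delta + (h * (S + 2) + T * E * (2 * delta + h * (CX + K * (S + 2)))) + CX * h =
  delta * (1 + 2 * (T * E)) + h * W by rewrite /W; ring.
by apply: le_trans (lerD delta_small h_small) _; rewrite -splitr.
Qed.

End neural_approximation.

(** * Every weak solution is an image under the flow; conclusion *)

Section representation.
Context {R : realType} {d : nat}.
Variables (T M K : R) (V : R -> 'cV[R]_d -> 'cV[R]_d) (mu0 : probability (borelRd R d) R).
Hypotheses (T0 : 0 < T) (okV : admissible T V M K) (m20 : finite_second_moment mu0).
Variables (X : R -> 'cV[R]_d -> 'cV[R]_d).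
Hypothesis (flowX : flow_of T M K V X).

Theorem weak_solution_pushforward (nu : R -> probability (borelRd R d) R) (t : R) :
  weak_solution T V mu0 nu -> 0 <= t <= T ->
  forall A : set (borelRd R d), measurable A -> nu t A = mu0 (X t @^-1` A).
Proof.
move=> wnu tT; have [X0 Xlip _ Xloc] := flowX.
have mX := measurable_continuous_map (flow_continuous flowX tT).
have [P HP] := pushforward_exists mu0 mX.
have HP' (A : set (borelRd R d)) : measurable A -> mu0 (X t @^-1` A) = P A by move=> mA; rewrite HP.
move=> A mA; rewrite HP' //; apply: test_functions_determine mA => f rho sf cf.
rewrite (uniqueness_test T0 okV m20 wnu X0 Xlip Xloc sf cf tT).
have [B B0 fB] := csupp_bounded (smooth_cont sf) cf.
apply/esym; apply: (transfer_Rintegral mX HP').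
apply: (le_integrable measurableT _ _ (finite_measure_integrable_cst P B measurableT)).
  by apply/measurable_EFinP; exact: (continuous_borel (smooth_cont sf)).
by move=> x _; rewrite /= lee_fin (ger0_norm B0).
Qed.

End representation.

(** The factor [Num.sqrt d%:R] is the cost of passing from the Euclidean norm to the sup norm on the
    right-hand side. *)
Lemma bounded_lipschitz_admissible {R : realType} {d : nat} (T M K : R) (V : R -> 'cV[R]_d -> 'cV[R]_d) :
  0 < T -> 0 < K ->
  (forall x : 'cV[R]_d, measurable_fun (`[0, T] : set (lebesgueR R))
       (fun t : lebesgueR R => V t x : borelRd R d)) ->
  (forall t : R, t \in `[0, T] -> forall x y : 'cV[R]_d, enorm (V t x - V t y) <= K * enorm (x - y)) ->
  (forall t : R, t \in `[0, T] -> forall x : 'cV[R]_d, enorm (V t x) <= M) ->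
  admissible T V M (K * Num.sqrt d%:R).
Proof.
move=> T0 K0 mV lV bV; split.
- apply: le_trans (enorm_ge0 (V 0 0)) (bV 0 _ 0); by rewrite in_itv /= lexx ltW.
- by rewrite mulr_ge0 ?sqrtr_ge0 // ltW.
- move=> x i; split.
    exact: (measurableT_comp (coord_measurable i) (mV x)).
  exists M => r rT; apply: le_trans (le_cV_norm _ _) _; apply: le_trans (norm_le_enorm _) _.
  by apply: bV; rewrite in_itv.
- move=> t tT x y; apply: le_trans (norm_le_enorm _) _.
  apply: le_trans (lV t _ x y) _; first by rewrite in_itv.
  by rewrite -mulrA ler_wpM2l ?(ltW K0) // enorm_le_norm.
- by move=> t tT; apply: le_trans (norm_le_enorm _) _; apply: bV; rewrite in_itv.
Qed.

Theorem mainTheorem1 (R : realType) (T : R) (d : nat) (sigma : R -> R)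
    (V : R -> 'cV[R]_d -> 'cV[R]_d)
    (mu0 : probability (borelRd R d) R)
    (mu : R -> probability (borelRd R d) R) :
  0 < T -> (0 < d)%N ->
  lipschitz sigma ->
  universal d sigma ->
  (forall x : 'cV[R]_d,
     measurable_fun (`[0, T] : set (lebesgueR R))
       (fun t : lebesgueR R => V t x : borelRd R d)) ->
  (exists2 K : R, 0 < K & forall t : R, t \in `[0, T] ->
     forall x y : 'cV[R]_d, enorm (V t x - V t y) <= K * enorm (x - y)) ->
  (exists M : R, forall t : R, t \in `[0, T] ->
     forall x : 'cV[R]_d, enorm (V t x) <= M) ->
  finite_second_moment mu0 ->
  compact (msupport mu0) ->
  weak_solution T V mu0 mu ->
  forall eps : R, 0 < eps ->
  exists (A W : R -> 'M[R]_d) (theta : R -> 'cV[R]_d)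
         (mue : R -> probability (borelRd R d) R),
    let field := fun (t : R) (x : 'cV[R]_d) =>
      A t *m map_mx sigma (W t *m x + theta t) in
    [/\ [/\ piecewise_constant T A, piecewise_constant T W
          & piecewise_constant T theta],
        weak_solution T field mu0 mue,
        forall nu : R -> probability (borelRd R d) R,
          weak_solution T field mu0 nu ->
          forall t : R, t \in `[0, T] ->
          forall B : set (borelRd R d), measurable B -> nu t B = mue t B
      & (ereal_sup [set W2 (mue t) (mu t) | t in `[0%R, T]] <= eps%:E)%E].
Proof.
move=> T0 _ lsig uni mV [K K0 lV] [M bV] m20 csup wmu eps eps0.
have [Ls Ls0 Hs] : exists2 Ls, 0 <= Ls & forall a b, `|sigma a - sigma b| <= Ls * `|a - b|.
  have [Ls Ls0 Hs] := pinfty_ex_gt0 lsig; exists Ls; first exact: ltW.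
  by move=> a b; apply: (Hs (a, b)).
have okV := bounded_lipschitz_admissible T0 K0 mV lV bV.
have [X flowX] := flow_exists T0 okV.
have [R0 R00 HR0] := compact_support_ae csup.
pose sd : R := Num.sqrt d%:R.
have sd0 : 0 <= sd by rewrite sqrtr_ge0.
(* Accuracy in the sup norm: returning to the Euclidean norm costs a factor of at most [sd]. *)
have e0 : 0 < eps / (sd + 1) by rewrite divr_gt0 // ltr_wpDl.
have [Q [lay [MF [KF [Y [Q0 okF flowY YX]]]]]] := neural_flow T0 okV flowX Ls0 Hs uni R00 e0.
have [mue [wmue pmue]] := flow_weak_solution T0 okF m20 flowY.
exists (fun t => (lay (cell T Q t)).1.1), (fun t => (lay (cell T Q t)).1.2), (fun t => (lay (cell T Q t)).2), mue.
split.
- by split; [exact: (piecewise_constant_cell T0 Q0 (fun q => (lay q).1.1)) |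
    exact: (piecewise_constant_cell T0 Q0 (fun q => (lay q).1.2)) |
    exact: (piecewise_constant_cell T0 Q0 (fun q => (lay q).2))].
- exact: wmue.
- move=> nu wnu t; rewrite in_itv /= => tT B mB.
  by rewrite (pmue t tT B mB) (weak_solution_pushforward T0 okF m20 flowY wnu tT mB).
apply: ge_ereal_sup => _ [t /= + <-]; rewrite in_itv /= => tT.
have cX := flow_continuous flowX tT; have cY := flow_continuous flowY tT.
apply: (W2_pushforward (mu := mu0) (ltW eps0) cY cX (pmue t tT)).
  by move=> A mA; exact: (weak_solution_pushforward T0 okV m20 flowX wmu tT mA).
have mYX : measurable_fun setT (fun x : borelRd R d => (enorm (Y t x - X t x) ^+ 2)%:E).
  apply/measurable_EFinP; apply: continuous_borel => x.
  exact: (continuous_comp (cvgB (cY x) (cX x)) (@continuous_enorm2 R d (Y t x - X t x))).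
(* The flows are close only for starting points in the ball of radius [R0], so the integrand is
   bounded by [eps ^+ 2] almost everywhere. *)
apply: (@le_trans _ _ (\int[mu0]_x (eps ^+ 2)%:E)%E).
  apply: ae_ge0_le_integral => //.
  - by move=> x _; rewrite lee_fin sqr_ge0.
  - by move=> x _; rewrite lee_fin sqr_ge0.
  - apply: filterS HR0 => x xR _; rewrite lee_fin lerXn2r ?nnegrE ?enorm_ge0 ?(ltW eps0) //.
    apply: le_trans (enorm_le_norm _) _; rewrite -/sd.
    apply: le_trans (ler_wpM2l sd0 (YX t x tT xR)) _.
    by rewrite mulrA ler_pdivrMr ?ltr_wpDl // mulrC ler_wpM2l ?(ltW eps0) // lerDl.
by rewrite (EFin_ex m20 (quad_cst _)) ex_cst.
Qed.
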